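(* Let $\{a_n\}_{n=0}^\infty$ be a sequence of complex numbers satisfying the following Hausdorff condition: there exist $\delta>0$ and $M>0$ such that $$(n+1)^{1+\delta}\sum_{i=0}^n \binom{n}{i}^{2+\delta}\left|\Delta^i a_{n-i}\right|^{2+\delta}<M\qquad (n=0,1,2,\ldots),$$ and let $F\in L^2[1,+\infty)$ be the jump function associated with $\frac1{2\pi}\sum_{n=0}^\infty a_nz^n$. For each $N\in\{0,1,2,\ldots\}$ and each $\epsilon>0$ let $a_0^{(\epsilon)},\ldots,a_N^{(\epsilon)}$ be numbers with $|a_n^{(\epsilon)}-a_n|\le\epsilon$ for $n=0,1,\ldots,N$. Put $$c_m^{(\epsilon,N)}=\sqrt2\sum_{n=0}^N\frac{(-1)^n}{n!}\,a_n^{(\epsilon)}\,P_m\left[-i\left(n+\tfrac12\right)\right]\quad(m=0,1,2,\ldots),\qquad C=\|F\|^2_{L^2[1,+\infty)},$$ $$k_0(\epsilon,N)=\max\Big\{k\in\mathbb{N}:\ \sum_{m=0}^k\left|c_m^{(\epsilon,N)}\right|^2\le C\Big\},\qquad F^{(\epsilon,N)}(x)=\sum_{m=0}^{k_0(\epsilon,N)}c_m^{(\epsilon,N)}\phi_m(x)\quad(x\in(1,+\infty)).$$ Then $$\lim_{\substack{N\to\infty\\ \epsilon\to0}}\left\|F-F^{(\epsilon,N)}\right\|_{L^2[1,+\infty)}=0 .$$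
   Context: Difference operator: $\Delta f_n=f_{n+1}-f_n$ and $\Delta^k f_n=\sum_{m=0}^k(-1)^m\binom km f_{n+k-m}$. Jump function: under the stated Hausdorff condition it is known that $\frac1{2\pi}\sum_{n=0}^\infty a_nz^n$ converges in $\{|z|<1\}$ to an analytic function $f$ which extends holomorphically to $\mathbb{C}\setminus[1,+\infty)$, and that the jump function $F(x)=-i[f_+(x)-f_-(x)]$, with $f_\pm(x)=\lim_{\eta\to0,\,\eta>0}f(x\pm i\eta)$, belongs to $L^2(1,+\infty)$. It is also known that $F$ has the expansion $F=\sum_{m=0}^\infty c_m\phi_m$, convergent in the $L^2$-norm, with $c_m=\sqrt2\sum_{n=0}^\infty\frac{(-1)^n}{n!}a_nP_m[-i(n+\frac12)]$. Pollaczek polynomials: $P_m$ ($m=0,1,2,\ldots$) are the polynomials with generating function $\sum_{m=0}^\infty t^mP_m(x)=(1-it)^{ix-1/2}(1+it)^{-ix-1/2}$ for $|t|<1$. They are orthonormal on $\mathbb{R}$ with respect to the weight $w(x)=\frac1\pi\Gamma(\frac12+ix)\Gamma(\frac12-ix)$. Basis functions: $\phi_m(x)=i^m\sqrt2\,L_m(2/x)\,\frac{e^{-1/x}}{x}$, where $L_m$ are the Laguerre polynomials. The $\phi_m$ form an orthonormal basis of $L^2(0,+\infty)$. Here $\mathbb{N}=\{0,1,2,\ldots\}$. The limit is the joint limit $N\to\infty$, $\epsilon\to0^+$, taken over those $(\epsilon,N)$ (and data) for which the maximum defining $k_0(\epsilon,N)$ exists. *)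

(* Defs.v *)
From HB Require Import structures.
From mathcomp Require Import all_boot all_order all_algebra.
From mathcomp Require Import complex.
From mathcomp Require Import all_classical all_reals all_analysis.

Set Implicit Arguments.
Unset Strict Implicit.
Unset Printing Implicit Defensive.

Import Order.TTheory GRing.Theory Num.Theory.
Import numFieldNormedType.Exports.

Local Open Scope classical_set_scope.
Local Open Scope ring_scope.
Local Open Scope complex_scope.

(* The modulus of a complex number, as an element of R (the norm `|z| of the
   numDomainType R[i] is R[i]-valued). *)
Notation cmod := Normc.normc.

Section Hausdorff.
Context {R : realType}.
Implicit Types a : nat -> R[i].

Definition fdiff (k : nat) a (n : nat) : R[i] :=
  \sum_(m < k.+1) (-1) ^+ m * 'C(k, m)%:R * a (n + k - m)%N.

Definition hausdorff_condition a : Prop :=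
  exists delta M : R, [/\ 0 < delta, 0 < M &
    forall n : nat,
      n.+1%:R `^ (1 + delta) *
      (\sum_(i < n.+1) 'C(n, i)%:R `^ (2 + delta) *
                       cmod (fdiff i a (n - i)) `^ (2 + delta)) < M].

End Hausdorff.

Section ComplexPower.
Context {R : realType}.
Implicit Types z w : R[i].

Definition cexp z : R[i] :=
  (expR (complex.Re z))%:C * (cos (complex.Im z) +i* sin (complex.Im z)).

(* Principal branch, with values in ]-pi, pi]; only meaningful for z != 0. *)
Definition carg z : R :=
  if 0 <= complex.Im z then acos (complex.Re z / cmod z)
  else - acos (complex.Re z / cmod z).

Definition clog z : R[i] := ln (cmod z) +i* carg z.

Definition cpow z w : R[i] := cexp (w * clog z).

End ComplexPower.

Section SpecialPolynomials.
Context {R : realType}.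

(* The generating function determines P uniquely. For |t| < 1 both bases have
   positive real part, so that the principal powers are analytic in t.
   R[i]^o is R[i] with the topology of its norm. *)
Definition is_pollaczek (P : nat -> {poly R[i]}) : Prop :=
  forall x t : R[i], cmod t < 1 ->
    [series t ^+ m * (P m).[x]]_m @ \oo -->
      (cpow (1 - 'i * t) ('i * x - 2^-1) *
       cpow (1 + 'i * t) (- ('i * x) - 2^-1) : R[i]^o).

Definition laguerre (m : nat) : {poly R} :=
  \poly_(k < m.+1) ((-1) ^+ k * 'C(m, k)%:R / k`!%:R).

Definition phi (m : nat) (x : R) : R[i] :=
  'i ^+ m * (Num.sqrt 2 * (laguerre m).[2 / x] * (expR (- x^-1) / x))%:C.

End SpecialPolynomials.

Section JumpFunction.
Context {R : realType}.
Implicit Types (a : nat -> R[i]) (f : R[i] -> R[i]) (F : R -> R[i]).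

(* In the partial order of R[i], [1 <= z] means that z is real and at least 1;
   hence [set z | ~~ (1 <= z)] is the plane cut along [1, +oo). The values
   of f on the cut are irrelevant. *)
Definition holomorphic_off_cut f : Prop :=
  forall z : R[i], ~~ (1 <= z) ->
    derivable (f : R[i]^o -> R[i]^o) z 1.

(* The boundary values exist, and F is determined by them, only almost
   everywhere. *)
Definition is_jump_function a F : Prop :=
  exists f : R[i] -> R[i],
    [/\ forall z : R[i], cmod z < 1 ->
          ([series ((2 * pi)^-1)%:C * (a n * z ^+ n)]_n @ \oo --> (f z : R[i]^o)),
        holomorphic_off_cut f &
        {ae (@lebesgue_measure R), forall x : R, 1 < x ->
          exists fp fm : R[i],
            [/\ f (x +i* eta) @[eta --> (0:R)^'+] --> (fp : R[i]^o),
                f (x -i* eta) @[eta --> (0:R)^'+] --> (fm : R[i]^o) &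
                F x = - 'i * (fp - fm)]}].

(* The L^2 norm on [1, +oo): [\_] extends the modulus by 0. *)
Definition L2norm F : \bar R :=
  'N[@lebesgue_measure R]_2%:E
    [(fun x => (cmod (F x))%:E) \_ `[1%R : R, +oo[%classic]%E.

Definition in_L2 F : Prop :=
  [/\ measurable_fun `[1%R : R, +oo[ (fun x => complex.Re (F x)),
      measurable_fun `[1%R : R, +oo[ (fun x => complex.Im (F x)) &
      (L2norm F < +oo)%E].

End JumpFunction.

Section Regularization.
Context {R : realType}.
Variables (P : nat -> {poly R[i]}) (F : R -> R[i]).
Implicit Types (b : nat -> R[i]) (N : nat).

Definition coef b N (m : nat) : R[i] :=
  (Num.sqrt 2)%:C *
  \sum_(n < N.+1) (-1) ^+ n / n`!%:R * b n * (P m).[- 'i * (n%:R + 2^-1)].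

Definition admissible b N : set nat :=
  [set k | ((\sum_(m < k.+1) cmod (coef b N m) ^+ 2)%:E <= L2norm F ^+ 2)%E].

Definition is_max_admissible b N (k : nat) : Prop :=
  admissible b N k /\ forall j, admissible b N j -> (j <= k)%N.

(* The maximum of [admissible b N] when it exists, and 0 otherwise. *)
Definition k0 b N : nat := xget 0%N (is_max_admissible b N).

Definition approximant b N (x : R) : R[i] :=
  \sum_(m < (k0 b N).+1) coef b N m * phi m x.

End Regularization.

(* Main.v *)
From HB Require Import structures.
Require Import Defs.
From mathcomp Require Import all_boot all_order all_algebra.
From mathcomp Require Import complex.
From mathcomp Require Import all_classical all_reals all_analysis.
From mathcomp Require Import measurable_realfun.
From mathcomp Require Import ring lra zify.

(** By the Hausdorff condition the Bernstein-Durrmeyer densities of the moment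
    sequence [a] are bounded in L^2(0,1), so that they converge weakly to a
    functional L on the continuous functions on [0,1] with L(t^n) = a_n. Hence
    f(z) = (2 pi)^-1 L(t |-> 1 / (1 - t z)) off the cut, by unique continuation,
    and the jump of f between x + i eta and x - i eta is L applied to a Poisson
    kernel. These jumps are bounded in L^2 uniformly in eta; letting eta tend
    to 0 yields a_n = int_1^oo F(x) x^(-n-1) dx.

    On the other hand P_m(-i (n + 1/2)) = (-i)^m D(m,n), where the Delannoy
    numbers D(m,n) satisfy sum_n (-y)^n / n! D(m,n) = e^-y L_m(2 y). Therefore
    i^m c_m^(eps,N) tends to <F, psi_m>, where psi_m = (-i)^m phi_m is real. The
    psi_m are orthonormal and complete, and the partial sums of |<F, psi_m>|^2
    stay strictly below C = ||F||^2, because F vanishes on (0,1) whereas a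
    nontrivial finite combination of the psi_m does not. So every K is
    eventually admissible, k_0 tends to infinity, and for admissible k_0
    ||F - F^(eps,N)||^2 <= 2 C - 2 Re sum_(m <= k_0) c_m^(eps,N) conj(c_m)
    tends to 0. *)

Set Implicit Arguments.
Unset Strict Implicit.
Unset Printing Implicit Defensive.

Import Order.TTheory GRing.Theory Num.Theory.
Import numFieldNormedType.Exports.

Local Open Scope classical_set_scope.
Local Open Scope complex_scope.
Local Open Scope ring_scope.

(** * Integrals over segments *)

Section SegmentIntegral.
Context {R : realType}.
Local Notation mu := (@lebesgue_measure R).
Implicit Types (f g : R -> R) (a b c : R).

(** The jump function is given only through some holomorphic extension f and its boundary values
    almost everywhere, so f has to be identified with the Cauchy transform before anything can be
    said about F; this is what unique continuation is for. The functional L is never represented by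
    a function in L^2(0,1): every L^2 bound is first proved for the polynomial densities, where
    Jensen's inequality and Tonelli's theorem apply, and then passed to the limit by Fatou's lemma
    and weak convergence. Testing the boundary values against x^-(n+2) gives a_(n+1); the moment a_0
    escapes, because x^-1 is not integrable at infinity, and is recovered from the fact that L((1 -
    t)^n) tends to 0, that is, L has no mass at t = 0. In the last step strictness matters because
    the noisy coefficients may exceed the true ones: the gap between the partial sum and C absorbs
    the perturbation and makes K admissible. Beyond K the noisy coefficients are not controlled
    individually; they enter only through the admissibility constraint, by Young's inequality. *)

Lemma within_continuous_integrable f a b :
  {within `[a, b], continuous f} -> mu.-integrable `[a, b] (EFin \o f).
Proof.
by move=> cf; apply: continuous_compact_integrable => //; exact: segment_compact.
Qed.

Lemma within_continuousM f g (A : set R) : {within A, continuous f} ->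
  {within A, continuous g} -> {within A, continuous (fun x => f x * g x)}.
Proof. by move=> cf cg x; apply: cvgM; [exact: cf|exact: cg]. Qed.

Lemma within_continuousD f g (A : set R) : {within A, continuous f} ->
  {within A, continuous g} -> {within A, continuous (fun x => f x + g x)}.
Proof. by move=> cf cg x; apply: cvgD; [exact: cf|exact: cg]. Qed.

Lemma within_continuousB f g (A : set R) : {within A, continuous f} ->
  {within A, continuous g} -> {within A, continuous (fun x => f x - g x)}.
Proof. by move=> cf cg x; apply: cvgB; [exact: cf|exact: cg]. Qed.

Lemma within_continuous_norm f (A : set R) : {within A, continuous f} ->
  {within A, continuous (fun x => `|f x|)}.
Proof. by move=> cf x; apply: cvg_norm; exact: cf. Qed.

Lemma within_continuous_horner (p : {poly R}) (A : set R) :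
  {within A, continuous (fun x => p.[x])}.
Proof. exact/continuous_subspaceT/continuous_horner. Qed.

Lemma within_continuousP f (A : set R) : {within A, continuous f} <->
  (forall x (e : R), A x -> 0 < e ->
     exists2 d : R, 0 < d & forall y, A y -> `|x - y| < d -> `|f x - f y| < e).
Proof.
split=> [/subspace_continuousP cf x e Ax e0|H].
  have /cvgrPdist_lt/(_ _ e0) := cf _ Ax.
  rewrite near_withinE -nbhs_ballE/= => -[d /= d0 H].
  by exists d => // y Ay xy; exact: H.
apply/subspace_continuousP => x Ax.
apply/cvgrPdist_lt => e e0; have [d d0 H'] := H _ _ Ax e0.
rewrite near_withinE -nbhs_ballE/=; exists d => //= y xy Ay; exact: H'.
Qed.

Lemma cvg_norm_le (u : nat -> R) (l e : R) : u n @[n --> \oo] --> l ->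
  (forall n, `|u n| <= e) -> `|l| <= e.
Proof.
move=> ul ue; rewrite leNgt; apply/negP => el.
have /cvgrPdist_lt/(_ (`|l| - e)) := ul.
rewrite subr_gt0 => /(_ el) [N _ /(_ N (leqnn _)) /=].
rewrite ltNge => /negP; apply.
by rewrite (le_trans _ (lerB_dist _ _))// lerB.
Qed.

(** Compactness is used in its near-covering form, with the filter of moduli d tending to 0 from the
    right; this yields one d for all x. *)
Lemma segment_continuous_uniform f a b (e : R) : {within `[a, b], continuous f} -> 0 < e ->
  exists2 d : R, 0 < d & forall x y, a <= x <= b -> a <= y <= b ->
    `|x - y| < d -> `|f x - f y| < e.
Proof.
move=> /within_continuousP cf e0.
have : near_covering (`[a, b]%classic : set R).
  by apply/compact_near_coveringP; exact: segment_compact.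
move=> /(_ R (0 : R)^'+ (fun d x => a <= x <= b -> forall y, a <= y <= b ->
  `|x - y| < d -> `|f x - f y| < e) _) [].
  move=> x Kx; have [d d0 H] := cf x (e / 2) Kx (divr_gt0 e0 (ltr0Sn _ _)).
  exists (ball x (d / 2), [set t | t < d / 2]).
    split=> /=; first by apply: nbhsx_ballx; rewrite divr_gt0.
    by apply: nbhs_right_lt; rewrite divr_gt0.
  move=> [x' t]/= [xx' td] Kx' y Ky x'y.
  rewrite -(subrK (f x) (f x')) -addrA (le_lt_trans (ler_normD _ _))// (splitr e) ltrD//.
    rewrite distrC H//= ?in_itv//= (lt_trans xx')//.
    by rewrite ltr_pdivrMr// ltr_pMr// ltr1n.
  rewrite H//= ?in_itv//= -(subrK x' x) -addrA (le_lt_trans (ler_normD _ _))//.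
  by rewrite (splitr d) ltrD// (lt_trans x'y).
move=> d /= d0 /(_ (d / 2)) H.
exists (d / 2); first by rewrite divr_gt0.
move=> x y xab yab xy; apply: H => //=.
- by rewrite sub0r normrN gtr0_norm ?divr_gt0// ltr_pdivrMr// ltr_pMr// ltr1n.
- by rewrite divr_gt0.
Qed.

Lemma segment_bounded f a b : {within `[a, b], continuous f} ->
  exists2 M : R, 0 < M & forall x, a <= x <= b -> `|f x| <= M.
Proof.
move=> cf.
have /compact_bounded[M0 [_ H]] := continuous_compact cf (@segment_compact R a b).
exists (`|M0| + 1); first by rewrite ltr_wpDl.
move=> x xab; apply: (H (`|M0| + 1)).
  by rewrite (le_lt_trans (ler_norm M0))// ltrDl.
by exists x; rewrite //= in_itv.
Qed.

Lemma segment_integralD f g a b : {within `[a, b], continuous f} ->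
  {within `[a, b], continuous g} ->
  \int[mu]_(x in `[a, b]) (f x + g x) =
  \int[mu]_(x in `[a, b]) f x + \int[mu]_(x in `[a, b]) g x.
Proof. by move=> cf cg; rewrite RintegralD//; exact: within_continuous_integrable. Qed.

Lemma segment_integralB f g a b : {within `[a, b], continuous f} ->
  {within `[a, b], continuous g} ->
  \int[mu]_(x in `[a, b]) (f x - g x) =
  \int[mu]_(x in `[a, b]) f x - \int[mu]_(x in `[a, b]) g x.
Proof. by move=> cf cg; rewrite RintegralB//; exact: within_continuous_integrable. Qed.

Lemma segment_integralZ f a b k : {within `[a, b], continuous f} ->
  \int[mu]_(x in `[a, b]) (k * f x) = k * \int[mu]_(x in `[a, b]) f x.
Proof. by move=> cf; rewrite RintegralZl//; exact: within_continuous_integrable. Qed.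

Lemma within_continuous_cst (k : R) (A : set R) :
  {within A, continuous (fun=> k)}.
Proof. by apply: continuous_subspaceT => x; exact: cvg_cst. Qed.

Lemma within_continuous_sum (n : nat) (F : nat -> R -> R) (A : set R) :
  (forall i, {within A, continuous F i}) ->
  {within A, continuous (fun x => \sum_(i < n) F i x)}.
Proof.
move=> cF; elim: n => [|n IH].
  by under eq_fun do rewrite big_ord0; exact: within_continuous_cst.
under eq_fun do rewrite big_ord_recr/=.
exact: within_continuousD.
Qed.

Lemma segment_integral_sum (n : nat) (F : nat -> R -> R) a b :
  (forall i, {within `[a, b], continuous F i}) ->
  \int[mu]_(x in `[a, b]) (\sum_(i < n) F i x) =
  \sum_(i < n) \int[mu]_(x in `[a, b]) F i x.
Proof.
move=> cF; elim: n => [|n IH].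
  under eq_Rintegral do rewrite big_ord0.
  by rewrite big_ord0 /Rintegral integral0.
under eq_Rintegral do rewrite big_ord_recr/=.
rewrite segment_integralD//; last exact: within_continuous_sum.
by rewrite IH big_ord_recr.
Qed.

Lemma segment_integral_cst a b k : a <= b ->
  \int[mu]_(x in `[a, b]) k = k * (b - a).
Proof.
move=> ab; rewrite Rintegral_cst//= lebesgue_measure_itv/= lte_fin.
by move: ab; rewrite le_eqVlt => /predU1P[->|->]//; rewrite ltxx subrr.
Qed.

Lemma le_segment_integral f g a b : {within `[a, b], continuous f} ->
  {within `[a, b], continuous g} -> (forall x, a <= x <= b -> f x <= g x) ->
  \int[mu]_(x in `[a, b]) f x <= \int[mu]_(x in `[a, b]) g x.
Proof.
move=> cf cg fg; apply: le_Rintegral => //.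
- exact: within_continuous_integrable.
- exact: within_continuous_integrable.
Qed.

Lemma segment_integral_le_norm f a b (M : R) : a <= b ->
  {within `[a, b], continuous f} -> (forall x, a <= x <= b -> `|f x| <= M) ->
  `|\int[mu]_(x in `[a, b]) f x| <= M * (b - a).
Proof.
move=> ab cf fM.
rewrite (le_trans (le_normr_Rintegral _ _))//; first exact: within_continuous_integrable.
rewrite -segment_integral_cst// le_segment_integral//; first exact: within_continuous_norm.

by apply: continuous_subspaceT => x; exact: cvg_cst.
Qed.

Lemma segment_integral_cat f a b c : a <= c <= b ->
  {within `[a, b], continuous f} ->
  \int[mu]_(x in `[a, b]) f x =
  \int[mu]_(x in `[a, c]) f x + \int[mu]_(x in `[c, b]) f x.
Proof.
move=> /andP[ac cb] cf.
have := @Rintegral_itvB R f (BLeft a) (BRight b) c (within_continuous_integrable cf).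
rewrite !bnd_simp => /(_ ac cb) h.
rewrite -(Rintegral_itv_obnd_cbnd (r := c)) -?h; last first.
  have : mu.-integrable `[a, b] (EFin \o f) by exact: within_continuous_integrable.
  move/integrableS; apply => //; apply: subset_itv; rewrite bnd_simp//.
ring.
Qed.

End SegmentIntegral.

(** * Polynomial approximation and Bernstein-Durrmeyer densities *)

Section Bernstein.
Context {R : realType}.
Implicit Types (n i j k : nat) (x : R) (h : R -> R).

Definition bernstein n i : {poly R} := 'X^i * (1 - 'X) ^+ (n - i) *+ 'C(n, i).

Lemma bin_mul_bin n i j : (j <= i <= n)%N ->
  ('C(n, i) * 'C(i, j) = 'C(n, j) * 'C(n - j, i - j))%N.
Proof.
move=> /andP[ji iN].
have jn : (j <= n)%N by exact: leq_trans iN.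
have h1 := bin_fact iN; have h2 := bin_fact ji; have h3 := bin_fact jn.
have h4 : ('C(n - j, i - j) * ((i - j)`! * (n - i)`!) = (n - j)`!)%N.
  rewrite -(bin_fact (n := n - j) (m := i - j)) ?leq_sub2r//.
  by congr (_ * (_ * _`!))%N; lia.
apply/eqP; rewrite -(eqn_pmul2r (m := j`! * (i - j)`! * (n - i)`!)); last first.
  by rewrite !muln_gt0 !fact_gt0.
apply/eqP; transitivity n`!.
  by rewrite -h1 -h2; ring.
by rewrite -h3 -h4; ring.
Qed.

(** Only i >= j contributes, and [bin_mul_bin] turns the rest into X^j times the binomial expansion
    of ((1 - X) + X)^(n - j). These factorial moments give the partition of unity (j = 0), the
    variance (j <= 2) and, for general j, the moments of the Durrmeyer densities. *)
Lemma sum_bernstein_bin n j :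
  \sum_(i < n.+1) bernstein n i *+ 'C(i, j) = 'X^j *+ 'C(n, j).
Proof.
have [jn|nj] := leqP j n; last first.
  rewrite bin_small// mulr0n big1// => i _.
  by rewrite bin_small//; have := ltn_ord i; lia.
rewrite -(big_mkord xpredT (fun i => bernstein n i *+ 'C(i, j))).
rewrite (big_cat_nat (n := j))//=; last lia.
rewrite big_nat_cond big1 ?add0r; last first.
  by move=> i /andP[/andP[_ ij] _]; rewrite bin_small.
have -> : 'X^j *+ 'C(n, j) = 'X^j * ((1 - 'X) + 'X) ^+ (n - j) *+ 'C(n, j) :> {poly R}.
  by rewrite subrK expr1n mulr1.
rewrite exprDn mulr_sumr -sumrMnl -{1}(add0n j) big_addn subSn// big_mkord.
apply: eq_bigr => i _; rewrite /bernstein -mulrnA bin_mul_bin; last first.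
  by have := ltn_ord i; lia.
rewrite addnK mulnC mulrnA mulrnAr; congr (_ *+ _ *+ _).
have -> : (n - (i + j) = n - j - i)%N by lia.
by rewrite exprD; ring.
Qed.

Lemma sum_bernstein n : \sum_(i < n.+1) bernstein n i = 1.
Proof.
have := sum_bernstein_bin n 0; rewrite bin0 expr0 mulr1n => <-.
by apply: eq_bigr => i _; rewrite bin0.
Qed.

Lemma horner_bernstein n i x :
  (bernstein n i).[x] = x ^+ i * (1 - x) ^+ (n - i) *+ 'C(n, i).
Proof. by rewrite /bernstein hornerMn hornerM hornerXn horner_exp !hornerE. Qed.

Lemma bernstein_ge0 n i x : 0 <= x <= 1 -> 0 <= (bernstein n i).[x].
Proof.
move=> /andP[x0 x1]; rewrite horner_bernstein mulrn_wge0// mulr_ge0// exprn_ge0//.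
by rewrite subr_ge0.
Qed.

Lemma sum_horner_bernstein n x : \sum_(i < n.+1) (bernstein n i).[x] = 1.
Proof. by rewrite -horner_sum sum_bernstein hornerC. Qed.

(** Follows from the factorial moments of order 0, 1 and 2, through i^2 = 2 C(i, 2) + i. *)
Lemma bernstein_variance n x :
  \sum_(i < n.+1) (n%:R * x - i%:R) ^+ 2 * (bernstein n i).[x] =
  n%:R * x * (1 - x).
Proof.
have S j : \sum_(i < n.+1) 'C(i, j)%:R * (bernstein n i).[x] = x ^+ j *+ 'C(n, j).
  rewrite -hornerXn -hornerMn -sum_bernstein_bin horner_sum.
  by apply: eq_bigr => i _; rewrite hornerMn mulr_natl.
have sq i : (i%:R : R) ^+ 2 = 2 * 'C(i, 2)%:R + i%:R.
  have : (i * i = 2 * 'C(i, 2) + i)%N.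
    by elim: i => // i IH; rewrite binS bin1; lia.
  by move=> /(congr1 (fun k => k%:R : R)); rewrite natrM natrD natrM expr2.
transitivity ((n%:R * x) ^+ 2 * \sum_(i < n.+1) 'C(i, 0)%:R * (bernstein n i).[x]
  + 2 * \sum_(i < n.+1) 'C(i, 2)%:R * (bernstein n i).[x]
  + (1 - 2 * n%:R * x) * \sum_(i < n.+1) 'C(i, 1)%:R * (bernstein n i).[x]).
  rewrite !mulr_sumr -!big_split; apply: eq_bigr => i _ /=.
  by rewrite bin0 bin1 sqrrB sq; ring.
have := sq n; rewrite !S bin0 bin1 => e.
rewrite -(mulr_natl (x ^+ 0)) -(mulr_natl (x ^+ 1)) -(mulr_natl (x ^+ 2)).
have -> : 'C(n, 2)%:R = (n%:R ^+ 2 - n%:R) / 2 :> R by rewrite e; field.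
by field.
Qed.

(* Bernstein's argument: by uniform continuity |h x - h y| <= e + B (x - y)^2,
   and the quadratic term is controlled by the variance. *)
Lemma weierstrass h (e : R) : 0 < e -> {within `[0, 1], continuous h} ->
  exists p : {poly R}, forall x, 0 <= x <= 1 -> `|h x - p.[x]| <= e.
Proof.
move=> e0 ch.
have [M M0 hM] := segment_bounded ch.
have [B B0 hB] : exists2 B : R, 0 < B & forall x y : R, 0 <= x <= 1 -> 0 <= y <= 1 ->
    `|h x - h y| <= e / 2 + B * (x - y) ^+ 2.
  have [d d0 hd] := segment_continuous_uniform ch (divr_gt0 e0 (ltr0Sn _ 1)).
  exists (2 * M / d ^+ 2); first by rewrite divr_gt0 ?mulr_gt0 ?exprn_gt0.
  move=> x y x01 y01; have [xyd|xyd] := ltP `|x - y| d.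
    rewrite (le_trans (ltW (hd x y x01 y01 xyd)))// lerDl mulr_ge0 ?sqr_ge0//.
    by rewrite divr_ge0 ?sqr_ge0// mulr_ge0 ?ltW.
  apply: (@le_trans _ _ (2 * M)).
    rewrite (le_trans (ler_normB _ _))// mulr2n mulrDl mul1r.
    by rewrite lerD ?hM.
  rewrite -[leLHS]add0r lerD ?divr_ge0 ?(ltW e0)//.
  rewrite -mulrA ler_peMr ?mulr_ge0 ?(ltW M0)//.
  rewrite mulrC ler_pdivlMr ?exprn_gt0// mul1r -(real_normK (num_real (x - y))).
  by rewrite lerXn2r// nnegrE ltW.
have [n nB] : exists n, B / (e / 2) < n.+1%:R.
  exists (Num.truncn (B / (e / 2))); exact: truncnS_gt.
have n0 : n.+1%:R != 0 :> R by rewrite pnatr_eq0.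
exists (\sum_(i < n.+2) h (i%:R / n.+1%:R) *: bernstein n.+1 i) => x x01.
have -> : h x = \sum_(i < n.+2) h x * (bernstein n.+1 i).[x].
  by rewrite -mulr_sumr sum_horner_bernstein mulr1.
rewrite horner_sum -sumrB (le_trans (ler_norm_sum _ _ _))//.
apply: (@le_trans _ _ (\sum_(i < n.+2) (e / 2 + B * (x - i%:R / n.+1%:R) ^+ 2) *
   (bernstein n.+1 i).[x])).
  apply: ler_sum => i _; rewrite hornerZ -mulrBl normrM.
  rewrite [X in _ * X]ger0_norm ?bernstein_ge0//.
  apply: ler_wpM2r; first exact: bernstein_ge0.
  apply: hB => //; rewrite divr_ge0//= ler_pdivrMr// mul1r ler_nat.
  by have := ltn_ord i; lia.
have -> : \sum_(i < n.+2) (e / 2 + B * (x - i%:R / n.+1%:R) ^+ 2) *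
   (bernstein n.+1 i).[x] = e / 2 + B * (x * (1 - x) / n.+1%:R).
  transitivity (e / 2 * \sum_(i < n.+2) (bernstein n.+1 i).[x] +
    B / n.+1%:R ^+ 2 * \sum_(i < n.+2) (n.+1%:R * x - i%:R) ^+ 2 * (bernstein n.+1 i).[x]).
    rewrite !mulr_sumr -big_split; apply: eq_bigr => i _ /=.
    by move: n0; move: (n.+1%:R) => N n0; field.
  rewrite sum_horner_bernstein bernstein_variance.
  by move: n0; move: (n.+1%:R) => N n0; field.
have : B * (x * (1 - x) / n.+1%:R) <= e / 2.
  rewrite mulrA ler_pdivrMr// -ler_pdivrMl ?divr_gt0// .
  have : x * (1 - x) <= 1 by case/andP: x01 => ? ?; nra.
  move: nB; rewrite mulrC => nB h1; apply: (le_trans _ (ltW nB)).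
  rewrite ler_wpM2l ?invr_ge0 ?divr_ge0 ?(ltW e0)//.
  by rewrite ler_piMr// ltW.
by move=> h1; rewrite [leRHS]splitr lerD2l.
Qed.

End Bernstein.

Section Durrmeyer.
Context {R : realType}.
Local Notation mu := (@lebesgue_measure R).
Implicit Types (n i j k : nat) (a : nat -> R).

Lemma integral_monomial_onem i j :
  \int[mu]_(x in `[0, 1]) (x ^+ i * (1 - x) ^+ j) =
  (i`! * j`!)%:R / (i + j).+1`!%:R.
Proof.
by rewrite -beta_fun_fact /beta_fun -Rintegral_mkcond.
Qed.

(** The beta integral is arranged so that i occurs only in C(i + k, k), which Vandermonde's identity
    can expand later. *)
Lemma integral_bernsteinXn n i k : (i <= n)%N ->
  \int[mu]_(x in `[0, 1]) ((bernstein n i).[x] * x ^+ k) =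
  'C(i + k, k)%:R / ('C(n + k + 1, k)%:R * n.+1%:R).
Proof.
move=> iN.
transitivity (\int[mu]_(x in `[0, 1])
    ('C(n, i)%:R * (x ^+ (i + k) * (1 - x) ^+ (n - i)))).
  apply: eq_Rintegral => x _; rewrite horner_bernstein -mulr_natl exprD.
  by rewrite mulrA mulrAC !mulrA.
rewrite segment_integralZ; last first.
  apply: within_continuousM; first exact/continuous_subspaceT/exprn_continuous.
  by apply: continuous_subspaceT => x; exact: continuous_onemXn.
rewrite integral_monomial_onem.
have f m : m`!%:R != 0 :> R by rewrite pnatr_eq0 -lt0n fact_gt0.
have -> : (i + k + (n - i)).+1 = (n + k + 1)%N by lia.
have -> : 'C(n + k + 1, k)%:R = (n + k + 1)`!%:R / (k`!%:R * n.+1`!%:R) :> R.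
  rewrite -(bin_fact (n := n + k + 1) (m := k)); last lia.
  have -> : (n + k + 1 - k = n.+1)%N by lia.
  by rewrite !natrM mulfK ?mulf_neq0 ?f.
have -> : 'C(i + k, k)%:R = (i + k)`!%:R / (k`!%:R * i`!%:R) :> R.
  rewrite -(bin_fact (n := i + k) (m := k)); last lia.
  rewrite addnK !natrM mulfK// mulf_neq0// pnatr_eq0 -lt0n fact_gt0//.
have -> : 'C(n, i)%:R = n`!%:R / (i`!%:R * (n - i)`!%:R) :> R.
  by rewrite -(bin_fact iN) !natrM mulfK ?mulf_neq0 ?f.
rewrite factS !natrM.
have := f (i + k)%N.
have := f n; have := f i; have := f (n - i)%N; have := f k; have := f (n + k + 1)%N.
have : n.+1%:R != 0 :> R by rewrite pnatr_eq0.
move: (n.+1%:R : R) (n`!%:R : R) (i`!%:R : R) ((n - i)`!%:R : R) (k`!%:R : R) ((n + k + 1)`!%:R : R) ((i + k)`!%:R : R) => A B C D E F G.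
by move=> *; field; do ! (apply/andP; split).
Qed.

(** Plays the role of integration against an unknown density on [0,1] with moments a. *)
Definition moment_form a (p : {poly R}) : R := \sum_(i < size p) p`_i * a i.

Lemma moment_formE a (p : {poly R}) N : (size p <= N)%N ->
  moment_form a p = \sum_(i < N) p`_i * a i.
Proof.
move=> pN; rewrite /moment_form (big_ord_widen _ (fun i => p`_i * a i) pN).
rewrite big_mkcond; apply: eq_bigr => i _; case: ltnP => // h.
by rewrite nth_default// mul0r.
Qed.

Lemma moment_form_linear a : linear_for *%R (moment_form a).
Proof.
move=> k p q; pose N := maxn (size (k *: p + q)) (maxn (size p) (size q)).
rewrite (@moment_formE a _ N) ?leq_maxl// (@moment_formE a p N); last first.
  by rewrite /N maxnCA leq_maxl.
rewrite (@moment_formE a q N); last by rewrite /N maxnA leq_maxr.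
rewrite mulr_sumr -big_split; apply: eq_bigr => i _ /=.
by rewrite coefD coefZ mulrDl mulrA.
Qed.

HB.instance Definition _ a := GRing.isLinear.Build R {poly R} R *%R
  (moment_form a) (moment_form_linear a).

Lemma moment_formXn a k : moment_form a 'X^k = a k.
Proof.
rewrite /moment_form size_polyXn big_ord_recr/= coefXn eqxx mul1r big1 ?add0r//.
by move=> i _; rewrite coefXn ltn_eqF// mul0r.
Qed.

Definition rdiff k a n : R := \sum_(m < k.+1) (-1) ^+ m * 'C(k, m)%:R * a (n + k - m)%N.

(** Expanding (1 - X)^i in X^(n-i) (1 - X)^i produces the i-th difference of a, up to sign; hence
    the Hausdorff condition bounds the moment form on the Bernstein basis. *)
Lemma moment_form_bernstein a n i : (i <= n)%N ->
  moment_form a (bernstein n (n - i)) = (-1) ^+ i * ('C(n, i)%:R * rdiff i a (n - i)).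
Proof.
move=> iN; rewrite /bernstein bin_sub// subKn// raddfMn/= -[LHS]mulr_natl mulrCA.
congr (_ * _); rewrite exprBn mulr_sumr raddf_sum/= mulr_sumr.
rewrite (reindex_inj rev_ord_inj)/=; apply: eq_bigr => -[m mi] _ /=.
rewrite ltnS in mi; have -> : (i.+1 - m.+1 = i - m)%N by [].
rewrite expr1n mulr1 bin_sub//.
have -> : 'X^(n - i) * ((-1) ^+ (i - m) * 'X^(i - m) *+ 'C(i, m)) =
    ((-1) ^+ (i - m) * 'C(i, m)%:R) *: 'X^(n - i + (i - m)) :> {poly R}.
  rewrite exprD -mul_polyC rmorphM rmorphXn/= rmorphN1 rmorph_nat.
  by rewrite -mulr_natl; ring.
rewrite linearZ/= moment_formXn.
have -> : (n - i + (i - m) = n - i + i - m)%N by lia.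
by rewrite !mulrA -exprD; congr (_ * _ * _); rewrite -signr_odd -[in RHS]signr_odd oddB// oddD.
Qed.

(** The Bernstein-Durrmeyer operator, with the integrals of the unknown density against the
    Bernstein basis replaced by the moment form; n + 1 is the reciprocal of the integral of a basis
    polynomial. *)
Definition durrmeyer a n : {poly R} :=
  \sum_(i < n.+1) (n.+1%:R * moment_form a (bernstein n i)) *: bernstein n i.

Definition moment_energy a n : R :=
  n.+1%:R * \sum_(i < n.+1) moment_form a (bernstein n i) ^+ 2.

Lemma durrmeyer_moment a n k :
  \int[mu]_(x in `[0, 1]) ((durrmeyer a n).[x] * x ^+ k) =
  (\sum_(j < k.+1) 'C(k, j)%:R * 'C(n, j)%:R * a j) / 'C(n + k + 1, k)%:R.
Proof.
have n0 : n.+1%:R != 0 :> R by rewrite pnatr_eq0.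
have c0 : 'C(n + k + 1, k)%:R != 0 :> R by rewrite pnatr_eq0 -lt0n bin_gt0; lia.
transitivity (\sum_(i < n.+1) n.+1%:R * moment_form a (bernstein n i) *
    \int[mu]_(x in `[0, 1]) ((bernstein n i).[x] * x ^+ k)).
  rewrite -(big_mkord xpredT (fun i => n.+1%:R * moment_form a (bernstein n i) *
    \int[mu]_(x in `[0, 1]) ((bernstein n i).[x] * x ^+ k))) big_mkord.
  transitivity (\int[mu]_(x in `[0, 1]) (\sum_(i < n.+1)
      (n.+1%:R * moment_form a (bernstein n i)) * ((bernstein n i).[x] * x ^+ k))).
    apply: eq_Rintegral => x _; rewrite horner_sum mulr_suml.
    by apply: eq_bigr => i _; rewrite hornerZ mulrA.
  have cb i : {within `[0, 1], continuous (fun x : R => (bernstein n i).[x] * x ^+ k)}.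
    apply: within_continuousM; first exact: within_continuous_horner.
    exact/continuous_subspaceT/exprn_continuous.
  rewrite (@segment_integral_sum _ n.+1 (fun i x => n.+1%:R * moment_form a (bernstein n i) *
      ((bernstein n i).[x] * x ^+ k))); last first.
    by move=> i; apply: within_continuousM => //; exact: within_continuous_cst.
  by apply: eq_bigr => i _; rewrite segment_integralZ.
transitivity ((\sum_(i < n.+1) moment_form a (bernstein n i) * 'C(i + k, k)%:R) /
    'C(n + k + 1, k)%:R).
  rewrite mulr_suml; apply: eq_bigr => i _.
  rewrite integral_bernsteinXn; last by rewrite -ltnS.
  rewrite mulrACA mulrA; field.
  by rewrite c0 nat1r n0.
congr (_ / _).
(* Vandermonde: C(i + k, k) = sum_j C(k, j) C(i, j), after which the sum over i is
   [sum_bernstein_bin]. *)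
under eq_bigr => i _ do rewrite -binomial.Vandermonde natr_sum mulr_sumr.
rewrite exchange_big/=; apply: eq_bigr => j _.
under eq_bigr => i _ do rewrite bin_sub -1?ltnS//.
transitivity ('C(k, j)%:R * moment_form a ('X^j *+ 'C(n, j))); last first.
  by rewrite raddfMn/= moment_formXn -[a j *+ _]mulr_natl mulrA.
rewrite -sum_bernstein_bin raddf_sum/= mulr_sumr; apply: eq_bigr => i _.
by rewrite raddfMn/= -[moment_form _ _ *+ _]mulr_natl natrM; ring.
Qed.

(** At each x the Bernstein values are weights of sum 1, so the square of the weighted mean is at
    most the weighted mean of the squares; each weight then integrates to 1/(n + 1). *)
Lemma durrmeyer_sqr a n :
  \int[mu]_(x in `[0, 1]) ((durrmeyer a n).[x] ^+ 2) <= moment_energy a n.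
Proof.
pose l i := moment_form a (bernstein n i).
have bi (i : 'I_n.+1) : \int[mu]_(x in `[0, 1]) (bernstein n i).[x] = n.+1%:R^-1 :> R.
  have := @integral_bernsteinXn n i 0; rewrite -ltnS ltn_ord !bin0 !mul1r => <-//.
  by apply: eq_Rintegral => x _; rewrite expr0 mulr1.
have dE x : (durrmeyer a n).[x] = n.+1%:R * \sum_(i < n.+1) l i * (bernstein n i).[x].
  rewrite horner_sum mulr_sumr; apply: eq_bigr => i _.
  by rewrite hornerZ mulrA.
have cl i : {within `[0, 1], continuous
    (fun x => (n.+1%:R ^+ 2 * l i ^+ 2) * (bernstein n i).[x])}.
  apply: within_continuousM; first exact: within_continuous_cst.
  exact: within_continuous_horner.
apply: (@le_trans _ _ (\int[mu]_(x in `[0, 1])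
   (\sum_(i < n.+1) (n.+1%:R ^+ 2 * l i ^+ 2) * (bernstein n i).[x]))).
  apply: le_segment_integral.
  - rewrite (_ : (fun x : R => _) = horner (durrmeyer a n ^+ 2)).
      exact: within_continuous_horner.
    by apply/funext => x; rewrite horner_exp.
  - exact: (within_continuous_sum _ (F := fun i x =>
      (n.+1%:R ^+ 2 * l i ^+ 2) * (bernstein n i).[x])).
  move=> x x01; rewrite dE exprMn.
  under [leRHS]eq_bigr do rewrite -mulrA.
  rewrite -mulr_sumr ler_wpM2l ?sqr_ge0//.
  set m := \sum_(i < _) _.
  have : 0 <= \sum_(i < n.+1) (l i - m) ^+ 2 * (bernstein n i).[x].
    by apply: sumr_ge0 => i _; rewrite mulr_ge0 ?sqr_ge0 ?bernstein_ge0.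
  have -> : \sum_(i < n.+1) (l i - m) ^+ 2 * (bernstein n i).[x] =
     \sum_(i < n.+1) l i ^+ 2 * (bernstein n i).[x] - 2 * m * m +
     m ^+ 2 * \sum_(i < n.+1) (bernstein n i).[x].
    have -> : 2 * m * m = \sum_(i < n.+1) 2 * m * (l i * (bernstein n i).[x]).
      by rewrite -mulr_sumr.
    rewrite [m ^+ 2 * _]mulr_sumr -sumrB -big_split/=; apply: eq_bigr => i _; ring.
  by rewrite sum_horner_bernstein; lra.
rewrite (@segment_integral_sum _ n.+1 (fun i x =>
      (n.+1%:R ^+ 2 * l i ^+ 2) * (bernstein n i).[x]))//.
rewrite /moment_energy mulr_sumr; apply: ler_sum => i _.
rewrite segment_integralZ; last exact: within_continuous_horner.
rewrite bi -/(l i) expr2 -!mulrA ler_wpM2l// mulrCA.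
by rewrite (mulrCA n.+1%:R) mulfV ?pnatr_eq0// mulr1 -expr2.
Qed.

(** Induction through (j + 1) C(n + c, j + 1) = (n + c - j) C(n + c, j), where (n + c - j)/(n + 1) =
    1 + (c - j - 1)/(n + 1). *)
Lemma cvg_bin_ratio (c j : nat) :
  'C(n + c, j)%:R / n.+1%:R ^+ j @[n --> \oo] --> (j`!%:R^-1 : R).
Proof.
elim: j => [|j IH].
  by under eq_fun do rewrite bin0 expr0 divr1; rewrite fact0 invr1; exact: cvg_cst.
have -> : j.+1`!%:R^-1 = j`!%:R^-1 * (1 + (c%:R - j%:R - 1) * 0) / j.+1%:R :> R.
  by rewrite factS natrM invfM mulr0 addr0 mulr1 mulrC.
have H : 'C(n + c, j)%:R / n.+1%:R ^+ j * (1 + (c%:R - j%:R - 1) * n.+1%:R^-1) / j.+1%:R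
    @[n --> \oo] --> (j`!%:R^-1 * (1 + (c%:R - j%:R - 1) * 0) / j.+1%:R : R).
  apply: cvgMl; apply: cvgM => //; apply: cvgD; first exact: cvg_cst.
  by apply: cvgMr; exact: cvg_harmonic.
apply: cvg_trans H; apply: near_eq_cvg; exists j => // n /= jn.
have e : j.+1%:R * 'C(n + c, j.+1)%:R = (n%:R + c%:R - j%:R) * 'C(n + c, j)%:R :> R.
  by rewrite -natrM mul_bin_left natrM natrB ?natrD//; lia.
have n0 : 1 + n%:R != 0 :> R by rewrite nat1r pnatr_eq0.
have j0 : 1 + j%:R != 0 :> R by rewrite nat1r pnatr_eq0.
have -> : 'C(n + c, j.+1)%:R = (n%:R + c%:R - j%:R) * 'C(n + c, j)%:R / j.+1%:R :> R.
  by rewrite -e mulrC mulKf// pnatr_eq0.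
rewrite -!nat1r exprS; field.
by rewrite expf_neq0// n0 j0.
Qed.

(** In [durrmeyer_moment] the ratio C(n, j) / C(n + k + 1, k) is of order n^(j - k), so only j = k
    survives, with limit 1. *)
Lemma durrmeyer_moment_cvg a k :
  \int[mu]_(x in `[0, 1]) ((durrmeyer a n).[x] * x ^+ k) @[n --> \oo] --> a k.
Proof.
rewrite (_ : (fun n => _) = (fun n => \sum_(j < k.+1) 'C(k, j)%:R * a j *
    ('C(n, j)%:R / 'C(n + k + 1, k)%:R))); last first.
  apply/funext => n; rewrite durrmeyer_moment mulr_suml; apply: eq_bigr => j _; ring.
have f0 m : m`!%:R != 0 :> R by rewrite pnatr_eq0 -lt0n fact_gt0.
have H (j : nat) : (j <= k)%N ->
    'C(n, j)%:R / 'C(n + k + 1, k)%:R @[n --> \oo] --> ((j == k)%:R : R).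
  move=> jk.
  have -> : (j == k)%:R = j`!%:R^-1 / k`!%:R^-1 * (j == k)%:R :> R.
    by case: eqVneq => [->|_]; rewrite ?mulr0// mulfV ?mulr1// invr_neq0.
  have h3 : n.+1%:R^-1 ^+ (k - j) @[n --> \oo] --> ((j == k)%:R : R).
    have := continuous_cvg _ (@exprn_continuous R (k - j) 0) cvg_harmonic.
    rewrite expr0n subn_eq0 => h.
    have -> : (j == k) = (k <= j)%N by lia.
    exact: h.
  have h1 := @cvg_bin_ratio 0 j; have h2 := @cvg_bin_ratio (k + 1) k.
  apply: (cvg_trans _ (cvgM (cvgM h1 (cvgV (invr_neq0 (f0 k)) h2)) h3)).
  apply: near_eq_cvg.
  apply: nearW => n /=; rewrite addn0 addnA.
  have n0 : n.+1%:R != 0 :> R by rewrite pnatr_eq0.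
  have c0 : 'C(n + k + 1, k)%:R != 0 :> R by rewrite pnatr_eq0 -lt0n bin_gt0; lia.
  have -> : n.+1%:R ^+ k = n.+1%:R ^+ j * n.+1%:R ^+ (k - j) :> R.
    by rewrite -exprD subnKC.
  rewrite exprVn; have := expf_neq0 (k - j) n0; have := expf_neq0 j n0.
  move: (n.+1%:R ^+ j) (n.+1%:R ^+ (k - j)) => A B A0 B0.
  by field; rewrite A0 B0 c0.
have -> : a k = \sum_(j < k.+1) 'C(k, j)%:R * a j * (j == k :> nat)%:R.
  rewrite big_ord_recr/= eqxx binn mul1r mulr1 big1 ?add0r//.
  by move=> i _; rewrite ltn_eqF// mulr0.
apply: cvg_big => [|j _]; first exact: add_continuous.
by apply: cvgMr; apply: H; rewrite -ltnS.
Qed.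

End Durrmeyer.

(** * The limit functional *)

Section LimitFunctional.
Context {R : realType}.
Local Notation mu := (@lebesgue_measure R).
Variables (a : nat -> R) (v : nat -> {poly R}) (C : R).
Hypothesis v_sqr : forall n, \int[mu]_(x in `[0, 1]) ((v n).[x] ^+ 2) <= C.
Hypothesis v_moment : forall k,
  \int[mu]_(x in `[0, 1]) ((v n).[x] * x ^+ k) @[n --> \oo] --> a k.
Implicit Types (h g : R -> R).

Definition limit_form h : R :=
  lim (\int[mu]_(x in `[0, 1]) ((v n).[x] * h x) @[n --> \oo]).

Let cvh n h : {within `[0, 1], continuous h} ->
  {within `[0, 1], continuous (fun x => (v n).[x] * h x)}.
Proof. by move=> ch; apply: within_continuousM => //; exact: within_continuous_horner. Qed.

(** The pointwise bound |v| <= v^2 + 1 turns the L^2 bound C into the L^1 bound C + 1. *)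
Lemma density_integral_le n h (e : R) : 0 <= e -> {within `[0, 1], continuous h} ->
  (forall x, 0 <= x <= 1 -> `|h x| <= e) ->
  `|\int[mu]_(x in `[0, 1]) ((v n).[x] * h x)| <= (C + 1) * e.
Proof.
move=> e0 ch he.
rewrite (le_trans (le_normr_Rintegral _ _))//.
  by apply: within_continuous_integrable; exact: cvh.
have cv2 : {within `[0, 1], continuous (fun x : R => (v n).[x] ^+ 2)}.
  rewrite (_ : (fun _ => _) = horner (v n ^+ 2)); first exact: within_continuous_horner.
  by apply/funext => x; rewrite horner_exp.
have c1 : {within `[0, 1], continuous (fun x : R => (v n).[x] ^+ 2 + 1)}.
  by apply: within_continuousD => //; exact: within_continuous_cst.
apply: (@le_trans _ _ (\int[mu]_(x in `[0, 1]) (e * ((v n).[x] ^+ 2 + 1)))).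
  apply: le_segment_integral.
  - by apply: within_continuous_norm; exact: cvh.
  - by apply: within_continuousM => //; exact: within_continuous_cst.
  move=> x x01; rewrite normrM mulrC.
  have h1 := he _ x01; apply: ler_pM => //.
  rewrite -(real_normK (num_real (v n).[x])).
  by have := normr_ge0 (v n).[x]; set y := `|_|; nra.
rewrite segment_integralZ// segment_integralD//; last exact: within_continuous_cst.
by rewrite segment_integral_cst// subr0 mulr1 mulrC ler_wpM2r// lerD2r.
Qed.

Lemma density_poly_cvg (p : {poly R}) :
  \int[mu]_(x in `[0, 1]) ((v n).[x] * p.[x]) @[n --> \oo] --> moment_form a p.
Proof.
rewrite (_ : (fun n => _) = (fun n => \sum_(i < size p) p`_i *
   \int[mu]_(x in `[0, 1]) ((v n).[x] * x ^+ i))).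
  by apply: cvg_big => [|i _]; [exact: add_continuous|exact: cvgMr].
apply/funext => n.
have cX i : {within `[0, 1], continuous (fun x : R => (v n).[x] * x ^+ i)}.
  by apply: cvh; exact/continuous_subspaceT/exprn_continuous.
transitivity (\int[mu]_(x in `[0, 1])
   (\sum_(i < size p) p`_i * ((v n).[x] * x ^+ i))).
  apply: eq_Rintegral => x _; rewrite (horner_coef p) mulr_sumr.
  by apply: eq_bigr => i _; rewrite mulrCA.
rewrite (@segment_integral_sum _ _ (fun i x => p`_i * ((v n).[x] * x ^+ i))).
  by apply: eq_bigr => i _; rewrite segment_integralZ.
by move=> i; apply: within_continuousM => //; exact: within_continuous_cst.
Qed.

Let C0 : 0 <= C.
Proof.
rewrite (le_trans _ (v_sqr 0))// Rintegral_ge0// => x _; exact: sqr_ge0.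
Qed.

(** The integrals are Cauchy: h is uniformly close to a polynomial p, the densities are bounded in
    L^1, and the integrals of p converge to [moment_form a p], which serves as the centre of the
    Cauchy ball. *)
Lemma limit_form_cvg h : {within `[0, 1], continuous h} ->
  \int[mu]_(x in `[0, 1]) ((v n).[x] * h x) @[n --> \oo] --> limit_form h.
Proof.
move=> ch; apply/cauchy_cvgP/cauchy_exP => e e0.
have C1 : 0 < C + 1 by rewrite ltr_wpDl.
pose d := e / (C + 1) / 2.
have d0 : 0 < d by rewrite !divr_gt0.
have [p hp] := weierstrass d0 ch.
exists (moment_form a p).
have /cvgrPdist_lt/(_ (e / 2)) := @density_poly_cvg p.
rewrite divr_gt0// => /(_ isT); apply: filterS => n /= H.
have cp := @within_continuous_horner R p `[0, 1].
have : `|\int[mu]_(x in `[0, 1]) ((v n).[x] * (h x - p.[x]))| <= (C + 1) * d.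
  by apply: density_integral_le => //; [exact: ltW|exact: within_continuousB].
rewrite (_ : \int[mu]_(x in `[0, 1]) ((v n).[x] * (h x - p.[x])) =
   \int[mu]_(x in `[0, 1]) ((v n).[x] * h x) - \int[mu]_(x in `[0, 1]) ((v n).[x] * p.[x])).
  have -> : (C + 1) * d = e / 2 by rewrite /d; field; rewrite gt_eqF.
  move=> H2; rewrite /ball/=.
  rewrite -(subrK (\int[mu]_(x in `[0, 1]) ((v n).[x] * p.[x])) (moment_form a p)) -addrA.
  by rewrite (le_lt_trans (ler_normD _ _))// (splitr e) ltr_leD// distrC.
rewrite -segment_integralB; [|exact: cvh..].
by apply: eq_Rintegral => x _; rewrite mulrBr.
Qed.

Lemma limit_form0 : limit_form (fun=> 0) = 0.
Proof.
rewrite /limit_form (_ : (fun n => _) = fun=> 0) ?lim_cst//.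
apply/funext => n; under eq_Rintegral do rewrite mulr0.
by rewrite /Rintegral integral0.
Qed.

Lemma limit_form_Xn k : limit_form (fun x => x ^+ k) = a k.
Proof. by apply: cvg_lim => //; exact: v_moment. Qed.

Lemma limit_formD h g : {within `[0, 1], continuous h} ->
  {within `[0, 1], continuous g} ->
  limit_form (fun x => h x + g x) = limit_form h + limit_form g.
Proof.
move=> ch cg; apply: cvg_lim => //.
rewrite (_ : (fun n => _) = (fun n => \int[mu]_(x in `[0, 1]) ((v n).[x] * h x) +
  \int[mu]_(x in `[0, 1]) ((v n).[x] * g x))).
  by apply: cvgD; exact: limit_form_cvg.
apply/funext => n; rewrite -segment_integralD; [|exact: cvh..].
by apply: eq_Rintegral => x _; rewrite mulrDr.
Qed.

Lemma limit_formZ k h : {within `[0, 1], continuous h} ->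
  limit_form (fun x => k * h x) = k * limit_form h.
Proof.
move=> ch; apply: cvg_lim => //.
rewrite (_ : (fun n => _) = (fun n => k * \int[mu]_(x in `[0, 1]) ((v n).[x] * h x))).
  by apply: cvgMr; exact: limit_form_cvg.
apply/funext => n; rewrite -segment_integralZ; last exact: cvh.
by apply: eq_Rintegral => x _; rewrite mulrCA.
Qed.

Lemma limit_form_le h (e : R) : 0 <= e -> {within `[0, 1], continuous h} ->
  (forall x, 0 <= x <= 1 -> `|h x| <= e) -> `|limit_form h| <= (C + 1) * e.
Proof.
move=> e0 ch he; apply: cvg_norm_le (limit_form_cvg ch) _ => n.
exact: density_integral_le.
Qed.

End LimitFunctional.

(** * Goursat's theorem and unique continuation off the cut *)

Section ComplexModulus.
Context {R : realType}.
Implicit Types (z w : R[i]) (x y : R).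

Lemma normE z : `|z| = (cmod z)%:C.
Proof. by []. Qed.

Lemma cmod_ge0 z : 0 <= cmod z.
Proof. by case: z => x y; rewrite /= sqrtr_ge0. Qed.

Lemma cmodD z w : cmod (z + w) <= cmod z + cmod w.
Proof. exact: le_normcD. Qed.

Lemma cmodN z : cmod (- z) = cmod z.
Proof. exact: normcN. Qed.

Lemma cmodB z w : cmod (z - w) <= cmod z + cmod w.
Proof. by rewrite -(cmodN w) cmodD. Qed.

Lemma cmodBC z w : cmod (z - w) = cmod (w - z).
Proof. by rewrite -cmodN opprB. Qed.

Lemma cmodM z w : cmod (z * w) = cmod z * cmod w.
Proof. exact: Normc.normcM. Qed.

Lemma cmodV z : cmod z^-1 = (cmod z)^-1.
Proof. exact: Normc.normcV. Qed.

Lemma cmodX z n : cmod (z ^+ n) = cmod z ^+ n.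
Proof. by elim: n => [|n IH]; [rewrite !expr0 Normc.normc1|rewrite !exprS cmodM IH]. Qed.

Lemma cmod_sqr z : cmod z ^+ 2 = complex.Re z ^+ 2 + complex.Im z ^+ 2.
Proof. by case: z => x y /=; rewrite sqr_sqrtr// addr_ge0 ?sqr_ge0. Qed.

Lemma cmodr x : cmod x%:C = `|x|.
Proof. by rewrite /= expr0n addr0 sqrtr_sqr. Qed.

Lemma cmodi : cmod ('i : R[i]) = 1.
Proof. by rewrite /= expr0n add0r expr1n sqrtr1. Qed.

Lemma cmod_eq0 z : (cmod z == 0) = (z == 0).
Proof. by apply/eqP/eqP => [/Normc.eq0_normc|->]; rewrite ?Normc.normc0. Qed.

Lemma cmod_gt0 z : (0 < cmod z) = (z != 0).
Proof. by rewrite lt_def cmod_ge0 andbT cmod_eq0. Qed.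

Lemma le_Re_cmod z : `|complex.Re z| <= cmod z.
Proof.
rewrite -(@ler_pXn2r _ 2)// ?nnegrE ?cmod_ge0//.
by rewrite real_normK ?num_real// cmod_sqr lerDl sqr_ge0.
Qed.

Lemma le_Im_cmod z : `|complex.Im z| <= cmod z.
Proof.
rewrite -(@ler_pXn2r _ 2)// ?nnegrE ?cmod_ge0//.
by rewrite real_normK ?num_real// cmod_sqr lerDr sqr_ge0.
Qed.

Lemma cmod_le_ReIm z : cmod z <= `|complex.Re z| + `|complex.Im z|.
Proof.
rewrite -(@ler_pXn2r _ 2)// ?nnegrE ?cmod_ge0 ?addr_ge0//.
rewrite cmod_sqr sqrrD !real_normK ?num_real//.
by rewrite lerD2r lerDl mulrn_wge0// mulr_ge0.
Qed.

Lemma cReD z w : complex.Re (z + w) = complex.Re z + complex.Re w.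
Proof. by case: z w => [? ?] [? ?]. Qed.

Lemma cImD z w : complex.Im (z + w) = complex.Im z + complex.Im w.
Proof. by case: z w => [? ?] [? ?]. Qed.

Lemma cReB z w : complex.Re (z - w) = complex.Re z - complex.Re w.
Proof. by case: z w => [? ?] [? ?]. Qed.

Lemma cImB z w : complex.Im (z - w) = complex.Im z - complex.Im w.
Proof. by case: z w => [? ?] [? ?]. Qed.

Lemma cReM z w : complex.Re (z * w) =
  complex.Re z * complex.Re w - complex.Im z * complex.Im w.
Proof. by case: z w => [? ?] [? ?]. Qed.

Lemma cImM z w : complex.Im (z * w) =
  complex.Re z * complex.Im w + complex.Im z * complex.Re w.
Proof. by case: z w => [? ?] [? ?]. Qed.

Lemma complex_eqP z w : complex.Re z = complex.Re w -> complex.Im z = complex.Im w -> z = w.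
Proof. by case: z w => [? ?] [? ?] /= -> ->. Qed.

End ComplexModulus.

Section ComplexSegmentIntegral.
Context {R : realType}.
Local Notation mu := (@lebesgue_measure R).
Implicit Types (f g : R -> R[i]) (a b c : R) (A : set R).

Definition cwithin A f := {within A, continuous (fun x => complex.Re (f x))} /\
  {within A, continuous (fun x => complex.Im (f x))}.

Definition cint a b f : R[i] :=
  (\int[mu]_(x in `[a, b]) complex.Re (f x)) +i*
  (\int[mu]_(x in `[a, b]) complex.Im (f x)).

Lemma cwithinP A f : cwithin A f <->
  (forall x (e : R), A x -> 0 < e ->
     exists2 d : R, 0 < d & forall y, A y -> `|x - y| < d -> cmod (f x - f y) < e).
Proof.
rewrite /cwithin; split=> [[/within_continuousP hr /within_continuousP hi] x e Ax e0|H].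
  have e2 : 0 < e / 2 by rewrite divr_gt0.
  have [d1 d10 h1] := hr _ _ Ax e2; have [d2 d20 h2] := hi _ _ Ax e2.
  exists (Num.min d1 d2); first by rewrite lt_min d10.
  move=> y Ay; rewrite lt_min => /andP[y1 y2].
  rewrite (le_lt_trans (cmod_le_ReIm _))// cReB cImB (splitr e).
  by rewrite ltrD ?h1 ?h2.
split; apply/within_continuousP => x e Ax e0;
  have [d d0 h] := H x e Ax e0; exists d => // y Ay xy.
  by rewrite -cReB (le_lt_trans (le_Re_cmod _))// h.
by rewrite -cImB (le_lt_trans (le_Im_cmod _))// h.
Qed.

Lemma cwithinD A f g : cwithin A f -> cwithin A g -> cwithin A (fun x => f x + g x).
Proof.
move=> [h1 h2] [h3 h4]; split.
  by under eq_fun do rewrite cReD; exact: within_continuousD.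
by under eq_fun do rewrite cImD; exact: within_continuousD.
Qed.

Lemma cwithinB A f g : cwithin A f -> cwithin A g -> cwithin A (fun x => f x - g x).
Proof.
move=> [h1 h2] [h3 h4]; split.
  by under eq_fun do rewrite cReB; exact: within_continuousB.
by under eq_fun do rewrite cImB; exact: within_continuousB.
Qed.

Lemma cwithinM A f g : cwithin A f -> cwithin A g -> cwithin A (fun x => f x * g x).
Proof.
move=> [h1 h2] [h3 h4]; split.
  under eq_fun do rewrite cReM.
  by apply: within_continuousB; exact: within_continuousM.
under eq_fun do rewrite cImM.
by apply: within_continuousD; exact: within_continuousM.
Qed.

Lemma cwithin_cst A k : cwithin A (fun=> k).
Proof. by split; exact: within_continuous_cst. Qed.

Lemma cintB a b f g : cwithin `[a, b] f -> cwithin `[a, b] g ->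
  cint a b (fun x => f x - g x) = cint a b f - cint a b g.
Proof.
move=> [h1 h2] [h3 h4]; rewrite /cint.
under eq_Rintegral do rewrite cReB.
under [X in _ +i* X]eq_Rintegral do rewrite cImB.
by rewrite !segment_integralB.
Qed.

Lemma cint_cat a b c f : a <= c <= b -> cwithin `[a, b] f ->
  cint a b f = cint a c f + cint c b f.
Proof. by move=> h [h1 h2]; rewrite /cint !(segment_integral_cat h). Qed.

Lemma cint_cst a b k : a <= b -> cint a b (fun=> k) = k * (b - a)%:C.
Proof.
move=> ab; rewrite /cint !segment_integral_cst//.
by apply: complex_eqP; rewrite ?cReM ?cImM /= !mulr0 ?subr0 ?add0r.
Qed.

(** The factor 2 comes from estimating real and imaginary parts separately; the applications only
    need the order of magnitude. *)
Lemma cint_le a b f (M : R) : a <= b -> cwithin `[a, b] f ->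
  (forall x, a <= x <= b -> cmod (f x) <= M) -> cmod (cint a b f) <= 2 * M * (b - a).
Proof.
move=> ab [h1 h2] fM; rewrite (le_trans (cmod_le_ReIm _))//=.
rewrite mulr2n !mulrDl !mul1r lerD// segment_integral_le_norm// => x xab.
  by rewrite (le_trans (le_Re_cmod _))// fM.
by rewrite (le_trans (le_Im_cmod _))// fM.
Qed.

End ComplexSegmentIntegral.

(** * Goursat's theorem on rectangles *)

Section Goursat.
Context {R : realType}.
Implicit Types (H : R[i] -> R[i]) (a b c d x y : R) (z w : R[i]).

(** Complex differentiability in terms of the real-valued modulus, suited to estimates;
    [derivable_cdiff] and [cdiff_derivable] relate it to [derivable]. *)
Definition cdiff H z := exists l : R[i], forall e : R, 0 < e ->
  exists2 d : R, 0 < d & forall w, cmod (w - z) < d ->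
    cmod (H w - H z - l * (w - z)) <= e * cmod (w - z).

Lemma cdiff_continuous H z (e : R) : cdiff H z -> 0 < e ->
  exists2 d : R, 0 < d & forall w, cmod (w - z) < d -> cmod (H w - H z) < e.
Proof.
move=> [l hl] e0; have [d d0 hd] := hl 1 ltr01.
have l1 : 0 < 1 + cmod l by rewrite ltr_pwDl// cmod_ge0.
exists (Num.min d (e / (1 + cmod l))); first by rewrite lt_min d0 divr_gt0.
move=> w; rewrite lt_min => /andP[wd we].
rewrite -(subrK (l * (w - z)) (H w - H z)) (le_lt_trans (cmodD _ _))//.
rewrite cmodM (le_lt_trans (lerD (hd _ wd) (lexx _)))// -mulrDl mulrC.
by rewrite -ltr_pdivlMr.
Qed.

Definition on_rectangle (Q : R[i] -> Prop) a b c d :=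
  forall x y, a <= x <= b -> c <= y <= d -> Q (x +i* y).

(** The counterclockwise contour integral over the boundary of [a, b] x [c, d], with opposite sides
    paired. *)
Definition rect_integral H a b c d : R[i] :=
  cint a b (fun x => H (x +i* c) - H (x +i* d)) +
  'i * cint c d (fun y => H (b +i* y) - H (a +i* y)).

Lemma cwithin_horizontal H a b y : (forall x, a <= x <= b -> cdiff H (x +i* y)) ->
  cwithin `[a, b] (fun x => H (x +i* y)).
Proof.
move=> hH; apply/cwithinP => x e /=; rewrite in_itv/= => xab e0.
have [d d0 hd] := cdiff_continuous (hH _ xab) e0.
exists d => // x' _ xx'; rewrite cmodBC hd//.
have -> : (x' +i* y - (x +i* y)) = (x' - x)%:C.
  by apply: complex_eqP; rewrite ?cReB ?cImB/= ?subrr.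
by rewrite cmodr distrC.
Qed.

Lemma cwithin_vertical H c d x : (forall y, c <= y <= d -> cdiff H (x +i* y)) ->
  cwithin `[c, d] (fun y => H (x +i* y)).
Proof.
move=> hH; apply/cwithinP => y e /=; rewrite in_itv/= => xab e0.
have [r r0 hr] := cdiff_continuous (hH _ xab) e0.
exists r => // y' _ yy'; rewrite cmodBC hr//.
have -> : (x +i* y' - (x +i* y)) = 'i * (y' - y)%:C.
  by apply: complex_eqP; rewrite ?cReB ?cImB ?cReM ?cImM/=; ring.
by rewrite cmodM cmodi mul1r cmodr distrC.
Qed.

Lemma rect_integral_split H a m b c k d : a <= m <= b -> c <= k <= d ->
  on_rectangle (cdiff H) a b c d ->
  rect_integral H a b c d = rect_integral H a m c k + rect_integral H m b c k +
    rect_integral H a m k d + rect_integral H m b k d.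
Proof.
move=> /[dup] mab /andP[am mb] /[dup] kcd /andP[ck kd] hH.
have hh y p q : c <= y <= d -> a <= p -> q <= b -> cwithin `[p, q] (fun x => H (x +i* y)).
  move=> ycd ap qb; apply: cwithin_horizontal => x /andP[px xq]; apply: hH => //.
  by rewrite (le_trans ap)//= (le_trans xq).
have hv x p q : a <= x <= b -> c <= p -> q <= d -> cwithin `[p, q] (fun y => H (x +i* y)).
  move=> xab ap qb; apply: cwithin_vertical => y /andP[px xq]; apply: hH => //.
  by rewrite (le_trans ap)//= (le_trans xq).
have cd : c <= d by exact: le_trans kd.
have ab : a <= b by exact: le_trans mb.
rewrite /rect_integral !cintB; try by (apply: hh || apply: hv); rewrite ?lexx ?am ?mb ?ck ?kd ?ab ?cd.
rewrite (cint_cat mab (hh c _ _ _ _ _)) ?lexx ?cd//.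
rewrite (cint_cat mab (hh d _ _ _ _ _)) ?lexx ?cd//.
rewrite (cint_cat kcd (hv b _ _ _ _ _)) ?lexx ?ab//.
rewrite (cint_cat kcd (hv a _ _ _ _ _)) ?lexx ?ab//.
ring.
Qed.

(** An affine function differs by a constant between opposite sides, and the two contributions
    cancel; so H may be replaced by its first-order remainder at z. The constant 4 is 2 sides times
    the 2 of [cint_le]. *)
Lemma rect_integral_le H a b c d z (l : R[i]) (e : R) : a <= b -> c <= d ->
  on_rectangle (cdiff H) a b c d ->
  on_rectangle (fun w => cmod (H w - H z - l * (w - z)) <= e) a b c d ->
  cmod (rect_integral H a b c d) <= 4 * e * ((b - a) + (d - c)).
Proof.
move=> ab cd hH he.
pose r w := H w - H z - l * (w - z).
have ch y : c <= y <= d -> cwithin `[a, b] (fun x => H (x +i* y)).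
  by move=> ycd; apply: cwithin_horizontal => x xab; exact: hH.
have cv x : a <= x <= b -> cwithin `[c, d] (fun y => H (x +i* y)).
  by move=> xab; apply: cwithin_vertical => y ycd; exact: hH.
have caa : a <= a <= b by rewrite lexx.
have cbb : a <= b <= b by rewrite lexx ab.
have ccc : c <= c <= d by rewrite lexx.
have cdd : c <= d <= d by rewrite lexx cd.
have chr : cwithin `[a, b] (fun x => r (x +i* c) - r (x +i* d)).
  rewrite (_ : (fun _ => _) = (fun x => H (x +i* c) - H (x +i* d) - l * ('i * (c - d)%:C))).
    by apply: cwithinB; [apply: cwithinB; exact: ch|exact: cwithin_cst].
  apply/funext => x; rewrite /r.
  have -> : x +i* c = x +i* d + 'i * (c - d)%:C.
    by apply: complex_eqP; rewrite ?cReD ?cImD ?cReM ?cImM/=; ring.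
  ring.
have cvr : cwithin `[c, d] (fun y => r (b +i* y) - r (a +i* y)).
  rewrite (_ : (fun _ => _) = (fun y => H (b +i* y) - H (a +i* y) - l * (b - a)%:C)).
    by apply: cwithinB; [apply: cwithinB; exact: cv|exact: cwithin_cst].
  apply/funext => y; rewrite /r.
  have -> : b +i* y = a +i* y + (b - a)%:C.
    by apply: complex_eqP; rewrite ?cReD ?cImD ?cReM ?cImM/=; ring.
  ring.
have rE : rect_integral H a b c d = cint a b (fun x => r (x +i* c) - r (x +i* d)) +
    'i * cint c d (fun y => r (b +i* y) - r (a +i* y)).
  rewrite (_ : (fun x => r _ - r _) = (fun x => (H (x +i* c) - H (x +i* d)) - l * ('i * (c - d)%:C))); last first.
    apply/funext => x; rewrite /r.
    have -> : x +i* c = x +i* d + 'i * (c - d)%:C.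
      by apply: complex_eqP; rewrite ?cReD ?cImD ?cReM ?cImM/=; ring.
    ring.
  rewrite [X in _ + _ * cint _ _ X](_ : _ = (fun y => (H (b +i* y) - H (a +i* y)) - l * (b - a)%:C)); last first.
    apply/funext => y; rewrite /r.
    have -> : b +i* y = a +i* y + (b - a)%:C.
      by apply: complex_eqP; rewrite ?cReD ?cImD ?cReM ?cImM/=; ring.
    ring.
  rewrite (cintB (cwithinB (ch c _) (ch d _)))//; last exact: cwithin_cst.
  rewrite (cintB (cwithinB (cv b _) (cv a _)))//; last exact: cwithin_cst.
  rewrite !cint_cst// /rect_integral.
  have -> : (c - d)%:C = - (d - c)%:C :> R[i] by rewrite -rmorphN opprB.
  ring.
rewrite rE (le_trans (cmodD _ _))// cmodM cmodi mul1r mulrDr lerD//.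
  have -> : 4 * e * (b - a) = 2 * (2 * e) * (b - a) by ring.
  apply: cint_le => // x xab; rewrite mulr2n mulrDl mul1r.
  by rewrite (le_trans (cmodB _ _))// lerD//; exact: he.
have -> : 4 * e * (d - c) = 2 * (2 * e) * (d - c) by ring.
apply: cint_le => // x xab; rewrite mulr2n mulrDl mul1r.
by rewrite (le_trans (cmodB _ _))// lerD//; exact: he.
Qed.

Lemma on_rectangleS (Q : R[i] -> Prop) a b c d a' b' c' d' :
  a <= a' -> b' <= b -> c <= c' -> d' <= d ->
  on_rectangle Q a b c d -> on_rectangle Q a' b' c' d'.
Proof.
move=> aa bb cc dd hQ x y /andP[x1 x2] /andP[y1 y2]; apply: hQ.
  by rewrite (le_trans aa)//= (le_trans x2).
by rewrite (le_trans cc)//= (le_trans y2).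
Qed.

Lemma goursat H a b c d : a < b -> c < d -> on_rectangle (cdiff H) a b c d ->
  rect_integral H a b c d = 0.
Proof.
move=> ab cd hH; apply/eqP; rewrite -cmod_eq0; apply/negPn/negP => e0.
have {}e0 : 0 < cmod (rect_integral H a b c d) by rewrite lt_def e0 cmod_ge0.
set E := cmod _ in e0.
pose w n := (b - a) / 2 ^+ n; pose h n := (d - c) / 2 ^+ n.
have w0 n : 0 < w n by rewrite divr_gt0 ?exprn_gt0// subr_gt0.
have h0 n : 0 < h n by rewrite divr_gt0 ?exprn_gt0// subr_gt0.
have wS n : w n = w n.+1 + w n.+1.
  by rewrite /w exprS; field; rewrite expf_neq0.
have hS n : h n = h n.+1 + h n.+1.
  by rewrite /h exprS; field; rewrite expf_neq0.
(* A state is a level n and the lower left corner of a rectangle of size w n by h n; Q keeps at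
   least the fraction 4^-n of the original integral. *)
pose Q (s : nat * (R * R)) := let: (n, (x, y)) := s in
  [/\ a <= x, x + w n <= b, c <= y, y + h n <= d &
    E / 4 ^+ n <= cmod (rect_integral H x (x + w n) y (y + h n))].
pose N (s t : nat * (R * R)) := let: (n, (x, y)) := s in let: (m, (x', y')) := t in
  [/\ m = n.+1, x <= x', x' + w m <= x + w n, y <= y' & y' + h m <= y + h n].
(* The implication sits under the quantifier because dependent choice needs a successor of every
   state, including those violating Q. *)
have step s : exists t, Q s -> Q t /\ N s t.
  have [|nQ] := pselect (Q s); last by exists s => /nQ.
  move: s => [n [x y]] [ax xb cy yd Ele].
  have W := wS n; have W0 := w0 n.+1; have K := hS n; have K0 := h0 n.+1.
  have xm : x <= x + w n.+1 <= x + w n by lra.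
  have ym : y <= y + h n.+1 <= y + h n by lra.
  have Hn : on_rectangle (cdiff H) x (x + w n) y (y + h n).
    exact: on_rectangleS hH.
  have := rect_integral_split xm ym Hn.
  have E4 : E / 4 ^+ n = 4 * (E / 4 ^+ n.+1).
    by rewrite exprS; field; rewrite expf_neq0.
  have wE : x + w n = x + w n.+1 + w n.+1 by lra.
  have hE : y + h n = y + h n.+1 + h n.+1 by lra.
  have f1 : x + w n.+1 <= b by lra.
  have f2 : a <= x + w n.+1 by lra.
  have f3 : x + w n.+1 + w n.+1 <= b by rewrite -wE.
  have f4 : x <= x + w n.+1 by case/andP: xm.
  have f5 : x + w n.+1 <= x + w n by case/andP: xm.
  have f6 : x + w n.+1 + w n.+1 <= x + w n by rewrite -wE.
  have g1 : y + h n.+1 <= d by lra.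
  have g2 : c <= y + h n.+1 by lra.
  have g3 : y + h n.+1 + h n.+1 <= d by rewrite -hE.
  have g4 : y <= y + h n.+1 by case/andP: ym.
  have g5 : y + h n.+1 <= y + h n by case/andP: ym.
  have g6 : y + h n.+1 + h n.+1 <= y + h n by rewrite -hE.
  have [q1|q1] := leP (E / 4 ^+ n.+1)
      (cmod (rect_integral H x (x + w n.+1) y (y + h n.+1))).
    by exists (n.+1, (x, y)) => _; split; split.
  have [q2|q2] := leP (E / 4 ^+ n.+1)
      (cmod (rect_integral H (x + w n.+1) (x + w n) y (y + h n.+1))).
    by exists (n.+1, (x + w n.+1, y)) => _; split; split; rewrite -?wE.
  have [q3|q3] := leP (E / 4 ^+ n.+1)
      (cmod (rect_integral H x (x + w n.+1) (y + h n.+1) (y + h n))).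
    by exists (n.+1, (x, y + h n.+1)) => _; split; split; rewrite -?hE.
  have [q4|q4] := leP (E / 4 ^+ n.+1)
      (cmod (rect_integral H (x + w n.+1) (x + w n) (y + h n.+1) (y + h n))).
    exists (n.+1, (x + w n.+1, y + h n.+1)) => _.
    by split; split; rewrite -?hE -?wE.
  move=> eq; move: Ele; rewrite leNgt eq => /negP; case.
  rewrite E4 (le_lt_trans (cmodD _ _))//.
  rewrite (_ : 4 * _ = E / 4 ^+ n.+1 + E / 4 ^+ n.+1 + E / 4 ^+ n.+1 + E / 4 ^+ n.+1); last by ring.
  by rewrite ltrD// (le_lt_trans (cmodD _ _))// ltrD// (le_lt_trans (cmodD _ _))// ltrD.
have [s [s0 sS]] := dependent_choice (fun t => cid (step t)) (0%N, (a, c)).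
have Q0 : Q (s 0).
  rewrite s0; split; rewrite ?lexx//.
  - by rewrite /w expr0 divr1 subrKC.
  - by rewrite /h expr0 divr1 subrKC.
  - by rewrite /w /h !expr0 !divr1 !subrKC.
have QS n : Q (s n) by elim: n => // n IH; have [] := sS n IH.
pose X n := (s n).2.1; pose Y n := (s n).2.2.
have sE n : s n = (n, (X n, Y n)).
  rewrite [LHS]surjective_pairing [(s n).2]surjective_pairing; congr (_, _).
  elim: n => [|n IH]; first by rewrite s0.
  have [_] := sS n (QS n); rewrite /N; case: (s n) IH => m [x y] /= ->.
  by case: (s n.+1) => ? [? ?] [].
have NS n : [/\ X n <= X n.+1, X n.+1 + w n.+1 <= X n + w n,
   Y n <= Y n.+1 & Y n.+1 + h n.+1 <= Y n + h n].
  by have [_] := sS n (QS n); rewrite !sE => -[].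
have Qn n : [/\ a <= X n, X n + w n <= b, c <= Y n, Y n + h n <= d &
    E / 4 ^+ n <= cmod (rect_integral H (X n) (X n + w n) (Y n) (Y n + h n))].
  by have := QS n; rewrite sE.
have mono n k : [/\ X n <= X (n + k)%N, X (n + k)%N + w (n + k)%N <= X n + w n,
   Y n <= Y (n + k)%N & Y (n + k)%N + h (n + k)%N <= Y n + h n].
  elim: k => [|k [h1 h2 h3 h4]]; first by rewrite addn0; split.
  rewrite addnS; have [h5 h6 h7 h8] := NS (n + k)%N.
  split; [exact: le_trans h5|exact: (le_trans h6)|exact: le_trans h7|exact: (le_trans h8)].
have XX m n : X m <= X n + w n.
  have [/subnKC mn|/ltnW/subnKC nm] := leqP m n.
    have [k1 _ _ _] := mono m (n - m)%N; rewrite mn in k1.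
    by rewrite (le_trans k1)// lerDl ltW.
  have [_ k2 _ _] := mono n (m - n)%N; rewrite nm in k2.
  by rewrite (le_trans _ k2)// lerDl ltW.
have YY m n : Y m <= Y n + h n.
  have [/subnKC mn|/ltnW/subnKC nm] := leqP m n.
    have [_ _ k1 _] := mono m (n - m)%N; rewrite mn in k1.
    by rewrite (le_trans k1)// lerDl ltW.
  have [_ _ _ k2] := mono n (m - n)%N; rewrite nm in k2.
  by rewrite (le_trans _ k2)// lerDl ltW.
pose x0 := sup (range X); pose y0 := sup (range Y).
have bX : has_ubound (range X) by exists (X 0 + w 0) => _ [m _ <-].
have bY : has_ubound (range Y) by exists (Y 0 + h 0) => _ [m _ <-].
have x0n n : X n <= x0 <= X n + w n.
  apply/andP; split; first by apply: ub_le_sup => //; exists n.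
  by apply: ge_sup => [|_ [m _ <-]//]; exists (X 0), 0.
have y0n n : Y n <= y0 <= Y n + h n.
  apply/andP; split; first by apply: ub_le_sup => //; exists n.
  by apply: ge_sup => [|_ [m _ <-]//]; exists (Y 0), 0.
have abx : a <= x0 <= b.
  by have [h1 h2 _ _ _] := Qn 0; have := x0n 0; lra.
have cdy : c <= y0 <= d.
  by have [_ _ h1 h2 _] := Qn 0; have := y0n 0; lra.
have [l hl] := hH x0 y0 abx cdy.
pose S := (b - a) + (d - c).
have S0 : 0 < S by rewrite /S; lra.
(* This precision makes the upper bound for the integral at level n equal to half of E / 4^n,
   contradicting Q. *)
have eps0 : 0 < E / (8 * S ^+ 2) by rewrite divr_gt0// mulr_gt0// exprn_gt0.
have [r r0 hr] := hl _ eps0.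
have [n nr] : exists n : nat, S / 2 ^+ n < r.
  exists (Num.truncn (S / r)).+1; rewrite ltr_pdivrMr ?exprn_gt0//.
  rewrite mulrC -ltr_pdivrMr// (lt_le_trans (truncnS_gt _))//.
  by rewrite -natrX ler_nat ltnW// ltn_expl.
have [q1 q2 q3 q4 q5] := Qn n.
have near_z0 x y : X n <= x <= X n + w n -> Y n <= y <= Y n + h n ->
    cmod (x +i* y - (x0 +i* y0)) <= S / 2 ^+ n.
  move=> xn yn; rewrite (le_trans (cmod_le_ReIm _))//= /S mulrDl lerD//.
    by have := x0n n; rewrite -/(w n) ler_norml; lra.
  by have := y0n n; rewrite -/(h n) ler_norml; lra.
have : cmod (rect_integral H (X n) (X n + w n) (Y n) (Y n + h n)) <=
    4 * (E / (8 * S ^+ 2) * (S / 2 ^+ n)) * ((X n + w n - X n) + (Y n + h n - Y n)).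
  apply: (@rect_integral_le _ _ _ _ _ (x0 +i* y0) l).
  - by rewrite lerDl ltW.
  - by rewrite lerDl ltW.
  - exact: on_rectangleS hH.
  move=> x y xn yn; have hz := near_z0 _ _ xn yn.
  by rewrite (le_trans (hr _ (le_lt_trans hz nr)))// ler_pM2l.
move/(le_trans q5).
have -> : (X n + w n - X n) + (Y n + h n - Y n) = S / 2 ^+ n by rewrite /S /w /h; ring.
have -> : 4 * (E / (8 * S ^+ 2) * (S / 2 ^+ n)) * (S / 2 ^+ n) = (E / 4 ^+ n) / 2.
  have -> : (4 : R) ^+ n = 2 ^+ n * 2 ^+ n by rewrite -exprMn -natrM.
  by field; rewrite expf_neq0// gt_eqF.
have : 0 < E / 4 ^+ n by rewrite divr_gt0// exprn_gt0.
by lra.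
Qed.

End Goursat.

(** * Rules for complex differentiability *)

Section ComplexDerivable.
Context {R : realType}.
Implicit Types (f g : R[i] -> R[i]) (z w : R[i]).

Lemma derivable_cdiff f z : derivable (f : R[i]^o -> R[i]^o) z 1 -> cdiff f z.
Proof.
move=> df; exists ('D_1 (f : R[i]^o -> R[i]^o) z) => e e0.
have e0' : 0 < (e%:C : R[i]) by rewrite ltcR.
set l := 'D_1 (f : R[i]^o -> R[i]^o) z; have /cvgrPdist_lt/(_ _ e0') := df.
rewrite /= near_withinE -nbhs_ballE/= => -[d /= d0 H].
have dE : d = (complex.Re d)%:C.
  by move: d0; rewrite ltcE/= => /andP[/eqP h _]; apply: complex_eqP => //=.
have d0' : 0 < complex.Re d by rewrite -ltcR -dE.
exists (complex.Re d) => // w wd.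
have [->|wz] := eqVneq w z.
  by rewrite !subrr mulr0 subrr !Normc.normc0 mulr0.
have wz0 : w - z != 0 by rewrite subr_eq0.
have : cmod (l - (w - z)^-1 * (f w - f z)) < e.
  rewrite -ltcR -normE; have := H (w - z).
  rewrite /ball/= sub0r normrN {1}dE normE ltcR => /(_ wd wz0).
  by rewrite /GRing.scale/= mulr1 subrK.
move=> /ltW h1.
have -> : f w - f z - l * (w - z) = - ((l - (w - z)^-1 * (f w - f z)) * (w - z)).
  by rewrite mulrBl mulrAC mulVf// mul1r opprB.
by rewrite cmodN cmodM ler_wpM2r// cmod_ge0.
Qed.

Lemma cdiff_derivable f z : cdiff f z -> derivable (f : R[i]^o -> R[i]^o) z 1.
Proof.
move=> [l hl]; apply/cvg_ex; exists (l : R[i]^o).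
apply/cvgrPdist_le => e e0.
have eE : e = (complex.Re e)%:C.
  by move: e0; rewrite ltcE/= => /andP[/eqP h _]; apply: complex_eqP => //=.
have e0' : 0 < complex.Re e by rewrite -ltcR -eE.
have [d d0 hd] := hl _ e0'.
rewrite near_withinE -nbhs_ballE/=; exists d%:C; first by rewrite /= ltcR.
move=> h; rewrite /ball/= sub0r normrN normE ltcR => hd' h0.
rewrite /GRing.scale/= mulr1 eE normE lecR.
have := hd (h + z); rewrite addrK => /(_ hd') H.
have -> : l - h^-1 * (f (h + z) - f z) = - (f (h + z) - f z - l * h) * h^-1.
  by rewrite mulNr mulrBl -mulrA mulfV// mulr1 opprB mulrC.
by rewrite cmodM cmodN cmodV ler_pdivrMr// cmod_gt0.
Qed.

Lemma cdiffM f g z : cdiff f z -> cdiff g z -> cdiff (fun w => f w * g w) z.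
Proof.
move=> hf hg; have [l hl] := hf; have [m hm] := hg.
exists (l * g z + f z * m) => e e0.
have a0 : 0 < cmod (g z) + 1 by rewrite ltr_wpDl ?cmod_ge0.
have b0 : 0 < cmod l + 1 by rewrite ltr_wpDl ?cmod_ge0.
have c0 : 0 < cmod (f z) + 1 by rewrite ltr_wpDl ?cmod_ge0.
have e3 : 0 < e / 3 by rewrite divr_gt0.
have [d1 d10 h1] := hl _ (divr_gt0 e3 a0).
have [d2 d20 h2] := hm _ (divr_gt0 e3 c0).
have [d3 d30 h3] := cdiff_continuous hg (divr_gt0 e3 b0).
have [d4 d40 h4] := cdiff_continuous hg ltr01.
exists (Num.min (Num.min d1 d2) (Num.min d3 d4)).
  by rewrite !lt_min d10 d20 d30.
move=> w; rewrite !lt_min => /andP[/andP[/h1 k1 /h2 k2] /andP[/h3 k3 /h4 k4]].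
have -> : f w * g w - f z * g z - (l * g z + f z * m) * (w - z) =
   (f w - f z - l * (w - z)) * g w + l * (w - z) * (g w - g z) +
   f z * (g w - g z - m * (w - z)) by ring.
have gw : cmod (g w) <= cmod (g z) + 1.
  rewrite -(subrK (g z) (g w)) addrC (le_trans (cmodD _ _))//.
  by rewrite [leRHS]addrC [leLHS]addrC lerD2r ltW.
have W := cmod_ge0 (w - z).
have -> : e * cmod (w - z) = e / 3 * cmod (w - z) + e / 3 * cmod (w - z) + e / 3 * cmod (w - z).
  by field.
rewrite (le_trans (cmodD _ _))// lerD//.
  rewrite (le_trans (cmodD _ _))// lerD//.
    rewrite cmodM; apply: (le_trans (ler_pM (cmod_ge0 _) (cmod_ge0 _) k1 gw)).
    by rewrite mulrAC divfK// gt_eqF.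
  rewrite !cmodM mulrAC ler_wpM2r//.
  apply: (@le_trans _ _ ((cmod l + 1) * (e / 3 / (cmod l + 1)))).
    by rewrite ler_pM ?cmod_ge0 ?lerDl// ltW.
  by rewrite mulrC divfK// gt_eqF.
rewrite cmodM.
apply: (@le_trans _ _ ((cmod (f z) + 1) * (e / 3 / (cmod (f z) + 1) * cmod (w - z)))).
  by rewrite ler_pM ?cmod_ge0 ?lerDl.
by rewrite mulrA [X in X * _]mulrC divfK// gt_eqF.
Qed.

Lemma cdiffB f g z : cdiff f z -> cdiff g z -> cdiff (fun w => f w - g w) z.
Proof.
move=> /cdiff_derivable hf /cdiff_derivable hg; apply: derivable_cdiff.
exact: derivableB.
Qed.

Lemma cdiff_cst (k : R[i]) z : cdiff (fun=> k) z.
Proof. by apply: derivable_cdiff; exact: derivable_cst. Qed.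

Lemma cdiff_id z : cdiff id z.
Proof. by apply: derivable_cdiff; exact: derivable_id. Qed.

Lemma cdiffX f z n : cdiff f z -> cdiff (fun w => f w ^+ n) z.
Proof.
move=> hf; elim: n => [|n IH].
  by rewrite (_ : (fun w => f w ^+ 0) = (fun=> 1)); [exact: cdiff_cst|apply/funext => w; rewrite expr0].
by rewrite (_ : (fun w => f w ^+ n.+1) = (fun w => f w * f w ^+ n)); [exact: cdiffM|apply/funext => w; rewrite exprS].
Qed.

Lemma cdiffV f z : f z != 0 -> cdiff f z -> cdiff (fun w => (f w)^-1) z.
Proof.
move=> fz /cdiff_derivable hf; apply: derivable_cdiff.
exact: derivableV.
Qed.

Lemma cdiff_affine f (c d z : R[i]) : cdiff f (c + d * z) -> cdiff (fun w => f (c + d * w)) z.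
Proof.
move=> [l hl]; exists (l * d) => e e0.
have d1 : 0 < cmod d + 1 by rewrite ltr_wpDl// cmod_ge0.
have [r r0 hr] := hl _ (divr_gt0 e0 d1).
exists (r / (cmod d + 1)); first by rewrite divr_gt0.
move=> w; rewrite ltr_pdivlMr// => wz.
have dE : c + d * w - (c + d * z) = d * (w - z) by ring.
have wz1 : cmod d * cmod (w - z) <= cmod (w - z) * (cmod d + 1).
  by rewrite mulrC ler_wpM2l ?cmod_ge0// lerDl.
have := hr (c + d * w); rewrite dE cmodM => /(_ (le_lt_trans wz1 wz)).
rewrite mulrA => /le_trans; apply.
by rewrite mulrAC ler_pdivrMr// -!mulrA ler_wpM2l ?(ltW e0)// .
Qed.

End ComplexDerivable.

(** * Powers of a peaked kernel *)

Section PeakKernel.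
Context {R : realType}.
Local Notation mu := (@lebesgue_measure R).

(** Laplace's method, with P y = rho^2 / (rho^2 + y^2): the window |y| <= th/2, where k is at least
    k 0 / 2, contributes at least m th P(th/2)^n, while k can be negative only for |y| >= th,
    costing at most 2 B rho P(th)^n. Since th <= rho, P(th/2) exceeds P(th) and is at least P(rho/2)
    = 4/5 > 3/4. *)
Lemma peak_integral (rho K : R) (k : R -> R) : 0 < rho ->
  {within `[- rho, rho], continuous k} -> 0 < k 0 ->
  ~ (forall n, \int[mu]_(y in `[- rho, rho]) (k y * (rho ^+ 2 / (rho ^+ 2 + y ^+ 2)) ^+ n) <=
       K * (3 / 4) ^+ n).
Proof.
move=> r0 ck k0 H.
pose P (y : R) := rho ^+ 2 / (rho ^+ 2 + y ^+ 2).
have den y : 0 < rho ^+ 2 + y ^+ 2 by rewrite ltr_wpDr ?sqr_ge0 ?exprn_gt0.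
have P0 y : 0 < P y by rewrite divr_gt0 ?exprn_gt0.
have Pmono x y : `|x| <= `|y| -> P y <= P x.
  move=> xy; rewrite /P ler_pM2l ?exprn_gt0// lef_pV2 ?posrE// lerD2l.
  by rewrite -(real_normK (num_real x)) -(real_normK (num_real y)) lerXn2r ?nnegrE.
have cP n : continuous (fun y => P y ^+ n).
  move=> y; apply: (@continuous_comp _ _ _ P (fun x => x ^+ n)); last exact: exprn_continuous.
  apply: cvgMr; apply: cvgV; first by rewrite gt_eqF.
  by apply: cvgD; [exact: cvg_cst|exact: exprn_continuous].
have cg n : {within `[- rho, rho], continuous (fun y => k y * P y ^+ n)}.
  by apply: within_continuousM => //; apply: continuous_subspaceT; exact: cP.
have [B B0 hB] := segment_bounded ck.
have [th [th0 thr hth]] : exists th : R, [/\ 0 < th, th <= rho &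
    forall y, `|y| < th -> k 0 / 2 <= k y].
  have /within_continuousP/(_ 0 (k 0 / 2)) := ck.
  rewrite /= in_itv/= oppr_le0 (ltW r0) divr_gt0// => /(_ isT isT)[d d0 hd].
  exists (Num.min rho d); split; [by rewrite lt_min r0|by rewrite ge_min lexx|].
  move=> y; rewrite lt_min => /andP[yr yd].
  have := hd y; rewrite /= in_itv/= sub0r normrN -ler_norml ltW// => /(_ isT yd).
  by rewrite ltr_norml; lra.
set m := k 0 / 2 in hth.
have m0 : 0 < m by rewrite divr_gt0.
have low n y : - rho <= y <= rho -> - (B * P th ^+ n) <= k y * P y ^+ n.
  move=> yr; have [yt|yt] := ltP `|y| th.
    apply: (@le_trans _ _ 0); first by rewrite oppr_le0 mulr_ge0 ?exprn_ge0 ?ltW.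
    by rewrite mulr_ge0 ?exprn_ge0// ?(ltW (P0 _))// (le_trans _ (hth _ yt))// ltW.
  have : `|k y * P y ^+ n| <= B * P th ^+ n.
    rewrite normrM ler_pM// ?hB// ger0_norm ?exprn_ge0 ?(ltW (P0 _))//.
    rewrite lerXn2r ?nnegrE ?(ltW (P0 _))//.
    by apply: Pmono; rewrite gtr0_norm.
  by rewrite ler_norml => /andP[].
have main n : m * th * P (th / 2) ^+ n <= 2 * B * rho * P th ^+ n + K * (3 / 4) ^+ n.
  have s1 : - rho <= - (th / 2) <= rho by lra.
  have s2 : - (th / 2) <= th / 2 <= rho by lra.
  have := H n; rewrite (segment_integral_cat s1 (cg n)).
  have sub1 : {within `[- (th / 2), rho], continuous (fun y => k y * P y ^+ n)}.
    by apply: continuous_subspaceW (cg n); apply: subset_itv; rewrite bnd_simp; lra.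
  rewrite (segment_integral_cat s2 sub1).
  have sub2 : {within `[- (th / 2), th / 2], continuous (fun y => k y * P y ^+ n)}.
    by apply: continuous_subspaceW (cg n); apply: subset_itv; rewrite bnd_simp; lra.
  have sub3 : {within `[th / 2, rho], continuous (fun y => k y * P y ^+ n)}.
    by apply: continuous_subspaceW (cg n); apply: subset_itv; rewrite bnd_simp; lra.
  have sub4 : {within `[- rho, - (th / 2)], continuous (fun y => k y * P y ^+ n)}.
    by apply: continuous_subspaceW (cg n); apply: subset_itv; rewrite bnd_simp; lra.
  have i1 : - (B * P th ^+ n) * (- (th / 2) - - rho) <=
      \int[mu]_(y in `[- rho, - (th / 2)]) (k y * P y ^+ n).
    rewrite -segment_integral_cst; last lra.
    apply: le_segment_integral => //; first exact: within_continuous_cst.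
    by move=> y yr; apply: low; lra.
  have i2 : - (B * P th ^+ n) * (rho - th / 2) <=
      \int[mu]_(y in `[th / 2, rho]) (k y * P y ^+ n).
    rewrite -segment_integral_cst; last lra.
    apply: le_segment_integral => //; first exact: within_continuous_cst.
    by move=> y yr; apply: low; lra.
  have i3 : m * P (th / 2) ^+ n * (th / 2 - - (th / 2)) <=
      \int[mu]_(y in `[- (th / 2), th / 2]) (k y * P y ^+ n).
    rewrite -segment_integral_cst; last lra.
    apply: le_segment_integral => //; first exact: within_continuous_cst.
    move=> y yr; apply: ler_pM; rewrite ?exprn_ge0 ?(ltW (P0 _)) ?(ltW m0)//.
      by apply: hth; rewrite ltr_norml; lra.
    rewrite lerXn2r ?nnegrE ?(ltW (P0 _))//.
    by apply: Pmono; rewrite (gtr0_norm (x := th / 2)) ?divr_gt0// ler_norml; lra.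
  have Bp : 0 <= B * P th ^+ n by rewrite mulr_ge0 ?exprn_ge0 ?(ltW (P0 _)) ?ltW.
  have : 0 <= B * P th ^+ n * th by rewrite mulr_ge0// ltW.
  rewrite -/(P _) in i1 i2 i3 *; lra.
have q0 : 0 < P (th / 2) by [].
have hs : P th / P (th / 2) < 1.
  rewrite ltr_pdivrMr// mul1r /P ltr_pM2l ?exprn_gt0// ltf_pV2 ?posrE// ltrD2l.
  by rewrite ltrXn2r//; lra.
have hu : 3 / 4 / P (th / 2) < 1.
  rewrite ltr_pdivrMr// mul1r /P ltr_pdivlMr//.
  have : th ^+ 2 <= rho ^+ 2 by rewrite lerXn2r// nnegrE ltW.
  have : 0 < rho ^+ 2 by rewrite exprn_gt0.
  by rewrite !expr2; lra.
pose x n := 2 * B * rho * (P th / P (th / 2)) ^+ n + K * (3 / 4 / P (th / 2)) ^+ n.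
have : x n @[n --> \oo] --> (2 * B * rho * 0 + K * 0).
  have s0 : 0 <= P th / P (th / 2) by rewrite ltW// divr_gt0.
  have u0 : 0 <= 3 / 4 / P (th / 2) by rewrite ltW// divr_gt0.
  by apply: cvgD; apply: cvgMr; apply: cvg_expr; rewrite ger0_norm.
rewrite !mulr0 addr0 => /cvgrPdist_lt/(_ (m * th)).
rewrite mulr_gt0// => /(_ isT)[N _ /(_ N (leqnn _))]/=.
rewrite sub0r normrN ltNge => /negP; apply; rewrite (le_trans _ (ler_norm _))//.
have qn : 0 < P (th / 2) ^+ N by rewrite exprn_gt0.
rewrite -(ler_pM2r qn) (le_trans (main N))//.
have e1 : (P th / P (th / 2)) ^+ N * P (th / 2) ^+ N = P th ^+ N.
  by rewrite -exprMn divfK ?gt_eqF.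
have e2 : (3 / 4 / P (th / 2)) ^+ N * P (th / 2) ^+ N = (3 / 4) ^+ N.
  by rewrite -exprMn divfK ?gt_eqF.
by rewrite -e1 -e2 /x; rewrite -subr_le0 (_ : _ - _ = 0)//; ring.
Qed.

End PeakKernel.

(** * Unique continuation along chains of squares *)

Section UniqueContinuation.
Context {R : realType}.
Local Notation mu := (@lebesgue_measure R).
Implicit Types (h f : R[i] -> R[i]) (rho : R) (z w c : R[i]).

Lemma cwithin_bounded (a b : R) (f : R -> R[i]) : cwithin `[a, b] f ->
  exists2 M : R, 0 < M & forall x, a <= x <= b -> cmod (f x) <= M.
Proof.
move=> [/segment_bounded[M M0 hM] /segment_bounded[N N0 hN]].
exists (M + N); first by rewrite addr_gt0.
by move=> x xab; rewrite (le_trans (cmod_le_ReIm _))// lerD ?hM ?hN.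
Qed.

Lemma i_linear_solve (A T L : R[i]) : A + 'i * (T - L) = 0 -> T = L + 'i * A.
Proof.
move/eqP; rewrite addr_eq0 => /eqP ->.
by rewrite mulrN mulrA -expr2 sqr_i mulN1r opprK addrC subrK.
Qed.

(* On the side Re z = rho of the square the kernel rho^2 / (z (2 rho - z)) is
   rho^2 / (rho^2 + y^2), real and peaked at y = 0; on the other sides its
   modulus is at most 3/4, and its pole 0 is cancelled by h. *)
Lemma vanish_at_side h rho (r : R) : 0 < rho -> 0 < r ->
  on_rectangle (cdiff h) (- rho) rho (- rho) rho ->
  (forall z, cmod z < r -> h z = 0) -> h rho%:C = 0.
Proof.
move=> rho0 r0 dh hz; apply/eqP/negPn/negP => hrho.
pose p z : R[i] := (rho ^+ 2)%:C / (z * ((2 * rho)%:C - z)).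
pose H n z := h z * p z ^+ n.
have dH n : on_rectangle (cdiff (H n)) (- rho) rho (- rho) rho.
  move=> x y xr yr; set z := x +i* y.
  have [zr|zr] := ltP (cmod z) r.
    exists 0 => e e0; exists (r - cmod z); first by rewrite subr_gt0.
    move=> w wz; have wr : cmod w < r.
      rewrite -(subrK z w) (le_lt_trans (cmodD _ _))//.
      by rewrite -ltrBrDr.
    by rewrite /H !hz// !mul0r subrr subr0 Normc.normc0 mulr_ge0 ?cmod_ge0 ?ltW.
  have z0 : z != 0 by rewrite -cmod_gt0 (lt_le_trans r0).
  have z1 : (2 * rho)%:C - z != 0.
    apply/eqP => /(congr1 (@complex.Re R)); rewrite cReB/= => /eqP.
    by rewrite subr_eq0 => /eqP; lra.
  apply: cdiffM; first exact: dh.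
  apply: cdiffX; apply: cdiffM; first exact: cdiff_cst.
  apply: (@cdiffV _ (fun w => w * ((2 * rho)%:C - w))); first by rewrite mulf_neq0.
  apply: cdiffM; first exact: cdiff_id.
  by apply: cdiffB; [exact: cdiff_cst|exact: cdiff_id].
have rr : - rho <= rho by lra.
have rr1 : - rho <= - rho <= rho by lra.
have rr2 : - rho <= rho <= rho by lra.
have hor f y : on_rectangle (cdiff f) (- rho) rho (- rho) rho -> - rho <= y <= rho ->
    cwithin `[- rho, rho] (fun x => f (x +i* y)).
  by move=> hf yr; apply: cwithin_horizontal => x xr; exact: hf.
have ver f x : on_rectangle (cdiff f) (- rho) rho (- rho) rho -> - rho <= x <= rho ->
    cwithin `[- rho, rho] (fun y => f (x +i* y)).
  by move=> hf yr; apply: cwithin_vertical => y xr; exact: hf.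
have [B1 B10 hB1] := cwithin_bounded (hor h (- rho) dh rr1).
have [B2 B20 hB2] := cwithin_bounded (hor h rho dh rr2).
have [B3 B30 hB3] := cwithin_bounded (ver h (- rho) dh rr1).
have p34 z : rho ^+ 2 <= cmod z ^+ 2 -> 2 * rho ^+ 2 <= cmod ((2 * rho)%:C - z) ^+ 2 ->
    cmod (p z) <= 3 / 4.
  move=> h1 h2; have zz : 0 < cmod z ^+ 2 by rewrite (lt_le_trans _ h1)// exprn_gt0.
  have zw : 0 < cmod ((2 * rho)%:C - z) ^+ 2.
    by rewrite (lt_le_trans _ h2)// mulr_gt0// exprn_gt0.
  rewrite -(@ler_pXn2r _ 2)// ?nnegrE ?cmod_ge0//.
  rewrite /p cmodM cmodV cmodM cmodr normrX (gtr0_norm rho0) exprMn exprVn (exprMn _ (cmod z)).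
  rewrite ler_pdivrMr; last exact: mulr_gt0.
  have r2 : 0 < rho ^+ 2 by rewrite exprn_gt0.
  have := ler_pM (ltW r2) (ltW (mulr_gt0 (ltr0Sn _ 1) r2)) h1 h2.
  have : 0 < rho ^+ 2 ^+ 2 by rewrite exprn_gt0.
  by rewrite !expr2; lra.
have ptop x y : - rho <= x <= rho -> y ^+ 2 = rho ^+ 2 -> cmod (p (x +i* y)) <= 3 / 4.
  move=> xr yr; apply: p34; rewrite cmod_sqr ?cReB ?cImB/= ?sub0r ?sqrrN yr.
    by rewrite lerDr sqr_ge0.
  by rewrite mulr2n mulrDl mul1r lerD2r lerXn2r// ?nnegrE; lra.
have pleft y : - rho <= y <= rho -> cmod (p (- rho +i* y)) <= 3 / 4.
  move=> yr; have r2 : 0 < rho ^+ 2 by rewrite exprn_gt0.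
  apply: p34; rewrite cmod_sqr ?cReB ?cImB/= ?sub0r ?sqrrN.
    by rewrite lerDl sqr_ge0.
  have := sqr_ge0 y; move: r2; rewrite !expr2; lra.
have pright y : p (rho +i* y) = (rho ^+ 2 / (rho ^+ 2 + y ^+ 2))%:C.
  rewrite /p [RHS]rmorphM [X in _ = _ * X]fmorphV/=; congr (_ / _).
  by apply: complex_eqP; rewrite ?cReM ?cImM ?cReB ?cImB/=; ring.
have HB n z B : cmod (h z) <= B -> cmod (p z) <= 3 / 4 -> cmod (H n z) <= B * (3 / 4) ^+ n.
  move=> h1 h2; rewrite /H cmodM cmodX ler_pM ?cmod_ge0 ?exprn_ge0 ?cmod_ge0//.
  by rewrite lerXn2r// nnegrE ?cmod_ge0.
(* The conjugate factor rotates the value at the peak to |h rho|^2 > 0, so that the real lemma on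
   peaked kernels applies. *)
pose c := h rho%:C; pose k (y : R) := complex.Re (c^* * h (rho +i* y)).
have [hr hi] := ver h rho dh rr2.
apply: (@peak_integral R rho (cmod c * (4 * rho * (B1 + B2 + B3))) k) => //.
- rewrite (_ : k = (fun y => complex.Re c^* * complex.Re (h (rho +i* y)) - complex.Im c^* * complex.Im (h (rho +i* y)))); last by apply/funext => y; rewrite /k cReM.
  by apply: within_continuousB; apply: within_continuousM => //; exact: within_continuous_cst.
- rewrite /k -/c.
  have -> : complex.Re (c^* * c) = cmod c ^+ 2 by rewrite cmod_sqr; case: (c) => u v /=; ring.
  by rewrite exprn_gt0// cmod_gt0.
move=> n.
have G := goursat (_ : - rho < rho) (_ : - rho < rho) (dH n).
have {}G : rect_integral (H n) (- rho) rho (- rho) rho = 0 by apply: G; lra.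
have I1 := cint_le rr (hor _ _ (dH n) rr1) (fun x xr => HB n _ _ (hB1 x xr) (ptop _ _ xr (sqrrN _))).
have I2 := cint_le rr (hor _ _ (dH n) rr2) (fun x xr => HB n _ _ (hB2 x xr) (ptop _ _ xr erefl)).
have I3 := cint_le rr (ver _ _ (dH n) rr1) (fun y yr => HB n _ _ (hB3 y yr) (pleft _ yr)).
set T := cint (- rho) rho (fun y => H n (rho +i* y)).
have TB : cmod T <= 4 * rho * (B1 + B2 + B3) * (3 / 4) ^+ n.
  move: G; rewrite /rect_integral cintB; [|exact: hor..].
  rewrite cintB; [|exact: ver..].
  rewrite -/T => G.
  have -> : T = cint (- rho) rho (fun y => H n (- rho +i* y)) +
     'i * (cint (- rho) rho (fun x => H n (x -i* rho)) - cint (- rho) rho (fun x => H n (x +i* rho))).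
    exact: i_linear_solve.
  rewrite (le_trans (cmodD _ _))// cmodM cmodi mul1r.
  apply: (le_trans (lerD I3 (le_trans (cmodB _ _) (lerD I1 I2)))).
  by rewrite -subr_le0 (_ : _ - _ = 0)//; ring.
have kT : \int[mu]_(y in `[- rho, rho]) (k y * (rho ^+ 2 / (rho ^+ 2 + y ^+ 2)) ^+ n) =
    complex.Re (c^* * T).
  have [Hr Hi] := ver _ _ (dH n) rr2.
  rewrite cReM /T/= -!segment_integralZ// -segment_integralB; last 2 first.
  - by apply: within_continuousM => //; exact: within_continuous_cst.
  - by apply: within_continuousM => //; exact: within_continuous_cst.
  apply: eq_Rintegral => y _; rewrite -cReM /k /H pright -rmorphXn/= mulrA.
  by rewrite [in RHS]cReM/= mulr0 subr0.
rewrite kT (le_trans (ler_norm _))// (le_trans (le_Re_cmod _))// cmodM.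
have -> : cmod c^* = cmod c by case: (c) => u v /=; rewrite sqrrN.
by rewrite -[leRHS]mulrA ler_wpM2l// cmod_ge0.
Qed.

Definition vanishes_near h c := exists2 r : R, 0 < r & forall z, cmod (z - c) < r -> h z = 0.

(** Every z near c + d rho is the midpoint of a side of a square of half-width rho whose centre c +
    e is near c; the factor d rotates that side into the position required by [vanish_at_side]. The
    margin rho' - rho leaves room for the displacement e. *)
Lemma vanishes_near_step h c (d : R[i]) rho rho' : d = 1 \/ d = 'i \/ d = - 'i ->
  0 < rho < rho' ->
  (forall x y, - rho' <= x <= rho' -> - rho' <= y <= rho' -> cdiff h (c + (x +i* y))) ->
  vanishes_near h c -> vanishes_near h (c + d * rho%:C).
Proof.
move=> dE /andP[rho0 rr] hh [r r0 hr].
have d1 : cmod d = 1 by case: dE => [->|[]->]; rewrite ?cmodN ?cmodi ?Normc.normc1.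
exists (Num.min (r / 2) (rho' - rho)).
  by rewrite lt_min divr_gt0//= subr_gt0.
move=> z; rewrite lt_min => /andP[zr zrho].
pose e := z - (c + d * rho%:C).
have er := le_lt_trans (le_Re_cmod e) zrho.
have ei := le_lt_trans (le_Im_cmod e) zrho.
have -> : z = (c + e) + d * rho%:C by rewrite /e; ring.
apply: (@vanish_at_side (fun w => h ((c + e) + d * w)) rho (r / 2)) => //.
- by rewrite divr_gt0.
- move=> x y xr yr; apply: cdiff_affine.
  move: er ei; rewrite !ltr_norml => er ei.
  have -> : c + e + d * (x +i* y) = c + (e + d * (x +i* y)) by ring.
  case: dE => [->|[]->].
  + rewrite (_ : e + _ = (complex.Re e + x) +i* (complex.Im e + y)).
      by apply: hh; lra.
    by apply: complex_eqP; rewrite ?cReD ?cImD ?cReM ?cImM/=; ring.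
  + rewrite (_ : e + _ = (complex.Re e - y) +i* (complex.Im e + x)).
      by apply: hh; lra.
    by apply: complex_eqP; rewrite ?cReD ?cImD ?cReM ?cImM/=; ring.
  + rewrite (_ : e + _ = (complex.Re e + y) +i* (complex.Im e - x)).
      by apply: hh; lra.
    by apply: complex_eqP; rewrite ?cReD ?cImD ?cReM ?cImM/=; ring.
move=> w wr; apply: hr.
have -> : c + e + d * w - c = e + d * w by ring.
by rewrite (le_lt_trans (cmodD _ _))// cmodM d1 mul1r (splitr r) ltrD.
Qed.

Lemma off_cut (x y : R) : x < 1 \/ y != 0 -> ~~ (1 <= x +i* y :> R[i]).
Proof.
rewrite lecE/= => -[x1|y0]; last by rewrite negb_and y0.
by rewrite negb_and -ltNge x1 orbT.
Qed.

(* The path from 0 to x + i s y follows the imaginary axis up to a height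
   larger than x and y, then goes horizontally and back vertically. *)
Lemma vanish_off_cut h (s x y : R) : s = 1 \/ s = -1 ->
  (forall z, ~~ (1 <= z) -> cdiff h z) -> vanishes_near h 0 -> 0 < x -> 0 < y ->
  h (x +i* (s * y)) = 0.
Proof.
move=> sE hh h0 x0 y0.
have s0 : s != 0 by case: sE => ->; rewrite ?oppr_eq0 oner_neq0.
(* Steps of length 1/2, with squares of half-width 3/4 that stay in Re z < 1. *)
have up (k : nat) : vanishes_near h (0 +i* (s * (k%:R / 2))).
  elim: k => [|k IH]; first by rewrite mul0r mulr0.
  have -> : 0 +i* (s * (k.+1%:R / 2)) = 0 +i* (s * (k%:R / 2)) + (s%:C * 'i) * (2^-1)%:C.
    by apply: complex_eqP; rewrite ?cReD ?cImD ?cReM ?cImM/= -?natr1; field.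
  apply: (@vanishes_near_step h _ _ 2^-1 (3 / 4)) => //.
  - case: sE => ->; first by right; left; rewrite rmorph1 mul1r.
    by right; right; rewrite rmorphN1 mulN1r.
  - by lra.
  - move=> u v ur vr.
    rewrite (_ : 0 +i* _ + _ = u +i* (s * (k%:R / 2) + v)).
      by apply/hh/off_cut; left; lra.
    by apply: complex_eqP; rewrite ?cReD ?cImD/= ?add0r.
pose T : R := (Num.truncn (2 * (x + y))).+1%:R / 2.
have xyT : x + y < T.
  by rewrite /T ltr_pdivlMr// mulrC truncnS_gt.
have right_ : vanishes_near h (x +i* (s * T)).
  have -> : x +i* (s * T) = 0 +i* (s * T) + 1 * x%:C.
    by apply: complex_eqP; rewrite ?cReD ?cImD ?cReM ?cImM/=; ring.
  (* As x < T, the half-width (x + T)/2 is less than the height T, so the square misses the real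
     axis. *)
  apply: (@vanishes_near_step h _ _ x ((x + T) / 2)); [by left|lra| |exact: up].
  move=> u v ur vr.
  rewrite (_ : 0 +i* _ + _ = u +i* (s * T + v)).
    by apply/hh/off_cut; right; case: sE => ->; apply/eqP; lra.
  by apply: complex_eqP; rewrite ?cReD ?cImD/= ?add0r.
have [r r0 hr] : vanishes_near h (x +i* (s * y)).
  have -> : x +i* (s * y) = x +i* (s * T) + (- s%:C * 'i) * (T - y)%:C.
    by apply: complex_eqP; rewrite ?cReD ?cImD ?cReM ?cImM/=; ring.
  apply: (@vanishes_near_step h _ _ (T - y) (T - y / 2)) => //.
  - case: sE => ->; first by right; right; rewrite rmorph1 mulN1r.
    by right; left; rewrite rmorphN1 opprK mul1r.
  - by lra.
  move=> u v ur vr.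
  rewrite (_ : x +i* _ + _ = (x + u) +i* (s * T + v)).
    by apply/hh/off_cut; right; case: sE => ->; apply/eqP; lra.
  by apply: complex_eqP; rewrite ?cReD ?cImD/=.
by apply: hr; rewrite subrr Normc.normc0.
Qed.

End UniqueContinuation.

(** * The jump as a Poisson integral *)

Lemma complex_pairD (R : realType) (x1 x2 y1 y2 z1 z2 w1 w2 : R) :
  (x1 + x2 - (y1 + y2)) +i* (z1 + z2 + (w1 + w2)) =
  ((x1 - y1) +i* (z1 + w1)) + ((x2 - y2) +i* (z2 + w2)).
Proof. by apply: complex_eqP => /=; ring. Qed.

Lemma complex_pairZ (R : realType) (p q x y z w : R) :
  (p * x + - q * y - (p * w + q * z)) +i* (p * y + q * x + (p * z + - q * w)) =
  (p +i* q) * ((x - w) +i* (y + z)).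
Proof. by apply: complex_eqP => /=; ring. Qed.

Section ComplexLimitForm.
Context {R : realType}.
Local Notation mu := (@lebesgue_measure R).
Variables (a : nat -> R[i]) (u v : nat -> {poly R}) (C : R).
Hypothesis u_sqr : forall n, \int[mu]_(x in `[0, 1]) ((u n).[x] ^+ 2) <= C.
Hypothesis u_moment : forall k,
  \int[mu]_(x in `[0, 1]) ((u n).[x] * x ^+ k) @[n --> \oo] --> complex.Re (a k).
Hypothesis v_sqr : forall n, \int[mu]_(x in `[0, 1]) ((v n).[x] ^+ 2) <= C.
Hypothesis v_moment : forall k,
  \int[mu]_(x in `[0, 1]) ((v n).[x] * x ^+ k) @[n --> \oo] --> complex.Im (a k).
Implicit Types (h g : R -> R[i]) (z w : R[i]).

Let reh h x := complex.Re (h x).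
Let imh h x := complex.Im (h x).

(** The complex-linear extension of L_u + i L_v, where u and v carry the real and imaginary parts of
    the moments. *)
Definition climit_form h : R[i] :=
  (limit_form u (fun x => complex.Re (h x)) - limit_form v (fun x => complex.Im (h x))) +i*
  (limit_form u (fun x => complex.Im (h x)) + limit_form v (fun x => complex.Re (h x))).

Lemma climit_formD h g : cwithin `[0, 1] h -> cwithin `[0, 1] g ->
  climit_form (fun x => h x + g x) = climit_form h + climit_form g.
Proof.
move=> [h1 h2] [g1 g2]; rewrite /climit_form.
rewrite (_ : (fun x => complex.Re (h x + g x)) = (fun x => reh h x + reh g x)); last first.
  by apply/funext => x; rewrite cReD.
rewrite (_ : (fun x => complex.Im (h x + g x)) = (fun x => imh h x + imh g x)); last first.
  by apply/funext => x; rewrite cImD.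
rewrite !(limit_formD u_sqr u_moment)// !(limit_formD v_sqr v_moment)//.
exact: complex_pairD.
Qed.

Lemma climit_formZ (k : R[i]) h : cwithin `[0, 1] h ->
  climit_form (fun x => k * h x) = k * climit_form h.
Proof.
move=> [h1 h2]; rewrite /climit_form.
have hk (c : R) (f : R -> R) : {within `[0, 1], continuous f} ->
    {within `[0, 1], continuous (fun x => c * f x)}.
  by move=> cf; apply: within_continuousM => //; exact: within_continuous_cst.
rewrite (_ : (fun x => complex.Re (k * h x)) =
    (fun x => complex.Re k * reh h x + (- complex.Im k) * imh h x)); last first.
  by apply/funext => x; rewrite cReM mulNr.
rewrite (_ : (fun x => complex.Im (k * h x)) =
    (fun x => complex.Re k * imh h x + complex.Im k * reh h x)); last first.
  by apply/funext => x; rewrite cImM.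
rewrite !(limit_formD u_sqr u_moment) ?(limit_formD v_sqr v_moment); try exact: hk.
rewrite !(limit_formZ u_sqr u_moment)// !(limit_formZ v_sqr v_moment)//.
by rewrite complex_pairZ; case: (k).
Qed.

Lemma climit_formB h g : cwithin `[0, 1] h -> cwithin `[0, 1] g ->
  climit_form (fun x => h x - g x) = climit_form h - climit_form g.
Proof.
move=> ch cg.
have e : - climit_form g = climit_form (fun x => (-1) * g x).
  by rewrite climit_formZ// mulN1r.
have := climit_formD ch (cwithinM (cwithin_cst _ (-1)) cg); rewrite -e => <-.
by congr climit_form; apply/funext => x; rewrite mulN1r.
Qed.

Lemma climit_form_le h (e : R) : 0 <= e -> cwithin `[0, 1] h ->
  (forall x, 0 <= x <= 1 -> cmod (h x) <= e) ->
  cmod (climit_form h) <= 4 * (C + 1) * e.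
Proof.
move=> e0 [h1 h2] he.
have hr x : 0 <= x <= 1 -> `|complex.Re (h x)| <= e.
  by move=> x01; rewrite (le_trans (le_Re_cmod _))// he.
have hi x : 0 <= x <= 1 -> `|complex.Im (h x)| <= e.
  by move=> x01; rewrite (le_trans (le_Im_cmod _))// he.
have b1 := limit_form_le u_sqr u_moment e0 h1 hr.
have b2 := limit_form_le u_sqr u_moment e0 h2 hi.
have b3 := limit_form_le v_sqr v_moment e0 h1 hr.
have b4 := limit_form_le v_sqr v_moment e0 h2 hi.
rewrite (le_trans (cmod_le_ReIm _))//=.
rewrite (le_trans (lerD (ler_normB _ _) (ler_normD _ _)))//.
rewrite -mulrA; set K := (C + 1) * e.
have -> : 4 * K = (K + K) + (K + K) by ring.
exact: lerD (lerD b1 b4) (lerD b2 b3).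
Qed.

Lemma cwithin_cdiff (f : R[i] -> R[i]) (p q : R) :
  (forall x, p <= x <= q -> cdiff f x%:C) -> cwithin `[p, q] (fun x => f x%:C).
Proof. by move=> hf; exact: (@cwithin_horizontal R f p q 0). Qed.

Lemma cwithin_Xn (n : nat) (k : R[i]) : cwithin `[0, 1] (fun x : R => (k * x%:C) ^+ n).
Proof.
apply: (@cwithin_cdiff (fun z => (k * z) ^+ n)) => x _.
by apply: cdiffX; apply: cdiffM; [exact: cdiff_cst|exact: cdiff_id].
Qed.

Lemma climit_form_Xn n : climit_form (fun x => (x ^+ n)%:C) = a n.
Proof.
rewrite /climit_form/= !limit_form0.
rewrite (limit_form_Xn u_moment) (limit_form_Xn v_moment) subr0 add0r.
by case: (a n).
Qed.

Definition cauchy_transform z := climit_form (fun t => (1 - t%:C * z)^-1).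

Lemma slit_distance z : ~~ (1 <= z) -> exists2 d : R, 0 < d &
  forall t : R, 0 <= t <= 1 -> d <= cmod (1 - t%:C * z).
Proof.
case: z => x y; rewrite lecE => H.
have {}H : ~~ ((y == 0) && (1 <= x)) := H.
have [y0|y0] := eqVneq y 0.
  move: H; rewrite y0 eqxx andTb -ltNge => x1.
  exists (Num.min 1 (1 - x)); first by rewrite lt_min ltr01 subr_gt0.
  move=> t /andP[t0 t1]; apply: (le_trans _ (le_Re_cmod _)); rewrite cReB cReM/= mul0r subr0.
  rewrite (le_trans _ (ler_norm _))//.
  have [x0|x0] := leP x 0; first by rewrite ge_min; apply/orP; left; nra.
  by rewrite ge_min; apply/orP; right; nra.
have xy0 : 0 < x ^+ 2 + y ^+ 2.
  by rewrite ltr_wpDl ?sqr_ge0// exprn_even_gt0.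
(* Since |1 - t z|^2 |z|^2 - y^2 = (|z|^2 t - x)^2, this is a lower bound for every real t. *)
exists (`|y| / cmod (x +i* y)).
  by rewrite divr_gt0 ?normr_gt0// cmod_gt0 eq_complex/= negb_and y0 orbT.
move=> t t01; rewrite ler_pdivrMr; last first.
  by rewrite cmod_gt0 eq_complex/= negb_and y0 orbT.
rewrite -(@ler_pXn2r _ 2)// ?nnegrE ?mulr_ge0 ?cmod_ge0//.
rewrite exprMn !cmod_sqr real_normK ?num_real//= -subr_ge0.
rewrite (_ : _ - _ = ((x ^+ 2 + y ^+ 2) * t - x) ^+ 2) ?sqr_ge0//.
ring.
Qed.

Lemma cwithin_cauchy_kernel z : (forall t : R, 0 <= t <= 1 -> 1 - t%:C * z != 0) ->
  cwithin `[0, 1] (fun t : R => (1 - t%:C * z)^-1).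
Proof.
move=> hz; apply: (@cwithin_cdiff (fun t => (1 - t * z)^-1)) => t t01.
apply: (@cdiffV _ (fun t => 1 - t * z)); first exact: hz.
apply: cdiffB; first exact: cdiff_cst.
by apply: cdiffM; [exact: cdiff_id|exact: cdiff_cst].
Qed.

Let C0 : 0 <= C.
Proof.
rewrite (le_trans _ (u_sqr 0))// Rintegral_ge0// => x _; exact: sqr_ge0.
Qed.

(** The second-order remainder of w |-> 1/(1 - t w) at z is exactly (w - z)^2 t^2 / ((1 - t w)(1 - t
    z)^2), bounded uniformly in t by 2 |w - z|^2 / d^3; the sup-norm bound of the form transfers
    this to the transform. *)
Lemma cauchy_transform_cdiff z : ~~ (1 <= z) -> cdiff cauchy_transform z.
Proof.
move=> zc; have [d d0 hd] := slit_distance zc.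
pose K := 4 * (C + 1).
have K0 : 0 < K by rewrite mulr_gt0// ltr_wpDl.
have h3 : 0 < d ^+ 3 by rewrite exprn_gt0.
have nz t : 0 <= t <= 1 -> 1 - t%:C * z != 0.
  by move=> t01; rewrite -cmod_gt0 (lt_le_trans d0)// hd.
have ck := cwithin_cauchy_kernel nz.
have cX := cwithin_Xn 1 1.
have cl : cwithin `[0, 1] (fun t : R => t%:C * ((1 - t%:C * z)^-1 * (1 - t%:C * z)^-1)).
  apply: cwithinM; last exact: cwithinM.
  by apply: (@cwithin_cdiff id) => t _; exact: cdiff_id.
exists (climit_form (fun t => t%:C * ((1 - t%:C * z)^-1 * (1 - t%:C * z)^-1))) => e e0.
exists (Num.min (d / 2) (e * d ^+ 3 / (2 * K))).
  by rewrite lt_min divr_gt0//= divr_gt0 ?(mulr_gt0 e0 h3) ?(mulr_gt0 (ltr0Sn _ 1) K0).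
move=> w; rewrite lt_min => /andP[wd we].
have hw t : 0 <= t <= 1 -> d / 2 <= cmod (1 - t%:C * w).
  move=> t01; have := hd _ t01.
  have -> : 1 - t%:C * z = (1 - t%:C * w) + t%:C * (w - z) by ring.
  move=> /le_trans/(_ (cmodD _ _)).
  have : cmod (t%:C * (w - z)) <= d / 2.
    rewrite cmodM cmodr; case/andP: t01 => t0 t1; rewrite ger0_norm//.
    by rewrite (le_trans _ (ltW wd))// ler_piMl// cmod_ge0.
  by lra.
have nw t : 0 <= t <= 1 -> 1 - t%:C * w != 0.
  by move=> t01; rewrite -cmod_gt0 (lt_le_trans _ (hw _ t01))// divr_gt0.
have ckw := cwithin_cauchy_kernel nw.
have clw := cwithinM (cwithin_cst `[0, 1] (w - z)) cl.
rewrite /cauchy_transform -climit_formB// mulrC -climit_formZ// -climit_formB//; last exact: cwithinB.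
apply: (@le_trans _ _ (K * (cmod (w - z) ^+ 2 * (2 / d ^+ 3)))).
  apply: climit_form_le.
  - by rewrite mulr_ge0 ?sqr_ge0// divr_ge0// exprn_ge0// ltW.
  - by apply: cwithinB => //; exact: cwithinB.
  move=> t t01.
  have -> : (1 - t%:C * w)^-1 - (1 - t%:C * z)^-1 -
      (w - z) * (t%:C * ((1 - t%:C * z)^-1 * (1 - t%:C * z)^-1)) =
      (w - z) ^+ 2 * (t%:C ^+ 2 / ((1 - t%:C * w) * (1 - t%:C * z) ^+ 2)).
    by field; rewrite nz// nw.
  rewrite cmodM (cmodX (w - z)) ler_wpM2l ?sqr_ge0// (cmodM (t%:C ^+ 2)) cmodX cmodr cmodV.
  rewrite (cmodM (1 - t%:C * w)) cmodX.
  have -> : 2 / d ^+ 3 = 1 / (d / 2 * d ^+ 2) by field; rewrite gt_eqF.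
  apply: ler_pM.
  - by rewrite exprn_ge0.
  - by rewrite invr_ge0 mulr_ge0 ?exprn_ge0 ?cmod_ge0.
  - by case/andP: t01 => t0 t1; rewrite exprn_ile1 ?ger0_norm.
  rewrite lef_pV2 ?posrE.
  - apply: ler_pM; rewrite ?exprn_ge0 ?divr_ge0 ?(ltW d0)//; first exact: hw.
    by rewrite lerXn2r ?nnegrE ?cmod_ge0 ?(ltW d0)// hd.
  - by rewrite mulr_gt0 ?exprn_gt0// cmod_gt0; [exact: nw|exact: nz].
  - by rewrite mulr_gt0 ?exprn_gt0// divr_gt0.
have W := cmod_ge0 (w - z).
have -> : K * (cmod (w - z) ^+ 2 * (2 / d ^+ 3)) =
    (cmod (w - z) * (2 * K) / d ^+ 3) * cmod (w - z) by field; rewrite gt_eqF.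
rewrite ler_wpM2r// ler_pdivrMr// -ler_pdivlMr; first exact: ltW.
by rewrite mulr_gt0.
Qed.

(** The partial sum is the form applied to a finite geometric sum in t z, whose remainder (t z)^n /
    (1 - t z) is small uniformly in t. *)
Lemma cauchy_transform_series z (n : nat) : cmod z < 1 ->
  cmod (\sum_(i < n) a i * z ^+ i - cauchy_transform z) <=
  4 * (C + 1) * (cmod z ^+ n / (1 - cmod z)).
Proof.
move=> z1; have z1' : 0 < 1 - cmod z by rewrite subr_gt0.
have dz t : 0 <= t <= 1 -> 1 - cmod z <= cmod (1 - t%:C * z).
  move=> /andP[t0 t1]; rewrite lerBlDr -[leLHS]normr1 -cmodr.
  rewrite -[X in cmod X <= _](subrK (t%:C * z)) (le_trans (cmodD _ _))// lerD2l.
  by rewrite cmodM cmodr ger0_norm// ler_piMl// cmod_ge0.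
have nz t : 0 <= t <= 1 -> 1 - t%:C * z != 0.
  by move=> t01; rewrite -cmod_gt0 (lt_le_trans z1')// dz.
have cS m : cwithin `[0, 1] (fun t : R => \sum_(i < m) (z * t%:C) ^+ i).
  elim: m => [|m IH].
    rewrite (_ : (fun _ => _) = (fun=> 0)); first exact: cwithin_cst.
    by apply/funext => t; rewrite big_ord0.
  rewrite (_ : (fun _ => _) = (fun t : R => \sum_(i < m) (z * t%:C) ^+ i + (z * t%:C) ^+ m)); last first.
    by apply/funext => t; rewrite big_ord_recr.
  by apply: cwithinD => //; exact: cwithin_Xn.
have SE m : \sum_(i < m) a i * z ^+ i = climit_form (fun t => \sum_(i < m) (z * t%:C) ^+ i).
  elim: m => [|m IH].
    rewrite big_ord0 (_ : (fun _ => _) = (fun=> 0)); last first.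
      by apply/funext => t; rewrite big_ord0.
    by rewrite /climit_form/= !limit_form0 subr0 addr0.
  rewrite big_ord_recr/= IH.
  rewrite (_ : (fun t => \sum_(i < m.+1) _) =
    (fun t => \sum_(i < m) (z * t%:C) ^+ i + z ^+ m * (t ^+ m)%:C)); last first.
    by apply/funext => t; rewrite big_ord_recr/= exprMn rmorphXn.
  have cX : cwithin `[0, 1] (fun t : R => (t ^+ m)%:C : R[i]).
    rewrite (_ : (fun _ => _) = (fun t : R => (1 * t%:C) ^+ m)); first exact: cwithin_Xn.
    by apply/funext => t; rewrite mul1r rmorphXn.
  rewrite climit_formD//; last by apply: cwithinM => //; exact: cwithin_cst.
  by rewrite climit_formZ// climit_form_Xn mulrC.
rewrite SE -climit_formB//; last exact: cwithin_cauchy_kernel.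
apply: climit_form_le.
- by rewrite divr_ge0 ?exprn_ge0 ?cmod_ge0// ltW.
- by apply: cwithinB => //; exact: cwithin_cauchy_kernel.
move=> t t01.
have -> : \sum_(i < n) (z * t%:C) ^+ i - (1 - t%:C * z)^-1 =
    - ((z * t%:C) ^+ n / (1 - t%:C * z)).
  apply: (mulIf (nz _ t01)); rewrite mulrBl mulVf ?nz// mulNr divfK ?nz//.
  rewrite (mulrC t%:C z); set q := z * t%:C; set S := \sum_(i < n) _.
  have -> : q ^+ n = (q - 1) * S + 1 by rewrite -subrX1 subrK.
  ring.
rewrite cmodN cmodM cmodV cmodX cmodM cmodr.
apply: ler_pM; rewrite ?invr_ge0 ?exprn_ge0 ?mulr_ge0 ?cmod_ge0//.
  rewrite lerXn2r ?nnegrE ?mulr_ge0 ?cmod_ge0//; case/andP: t01 => t0 t1.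
  by rewrite ger0_norm// ler_piMr// cmod_ge0.
by rewrite lef_pV2 ?posrE ?dz// (lt_le_trans z1')// dz.
Qed.

Lemma series_cauchy_transform z l : cmod z < 1 ->
  [series ((2 * pi)^-1)%:C * (a n * z ^+ n)]_n @ \oo --> (l : R[i]^o) ->
  l = ((2 * pi)^-1)%:C * cauchy_transform z.
Proof.
move=> z1 /(cvgrPdist_lt (V := R[i]^o)) hl.
pose p : R := (2 * pi)^-1; have p0 : 0 < p by rewrite invr_gt0 mulr_gt0// pi_gt0.
apply/eqP; rewrite -subr_eq0 -cmod_eq0; apply/negPn/negP => e0.
have {}e0 : 0 < cmod (l - p%:C * cauchy_transform z) by rewrite lt_def e0 cmod_ge0.
set e := cmod _ in e0.
pose K := p * (4 * (C + 1)) / (1 - cmod z).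
have /hl[N1 _ h1] : 0 < ((e / 2)%:C : R[i]) by rewrite ltcR divr_gt0.
have : K * cmod z ^+ n @[n --> \oo] --> K * 0.
  by apply: cvgMr; apply: cvg_expr; rewrite ger0_norm// cmod_ge0.
rewrite mulr0 => /cvgrPdist_lt/(_ (e / 2)); rewrite divr_gt0// => /(_ isT)[N2 _ h2].
pose n := maxn N1 N2.
have := h1 n (leq_maxl _ _); have := h2 n (leq_maxr _ _).
rewrite /= sub0r normrN => k2; rewrite normE ltcR => k1.
have : e <= cmod (l - series (fun n => p%:C * (a n * z ^+ n)) n) +
    cmod (series (fun n => p%:C * (a n * z ^+ n)) n - p%:C * cauchy_transform z).
  by rewrite /e (le_trans _ (cmodD _ _))// addrA subrK.
have -> : series (fun n => p%:C * (a n * z ^+ n)) n - p%:C * cauchy_transform z =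
    p%:C * (\sum_(i < n) a i * z ^+ i - cauchy_transform z).
  by rewrite mulrBr /series/= big_mkord mulr_sumr.
have : cmod (p%:C * (\sum_(i < n) a i * z ^+ i - cauchy_transform z)) <= `|K * cmod z ^+ n|.
  rewrite cmodM cmodr gtr0_norm// (le_trans _ (ler_norm _))//.
  have -> : K * cmod z ^+ n = p * (4 * (C + 1) * (cmod z ^+ n / (1 - cmod z))).
    by rewrite /K; ring.
  by rewrite ler_wpM2l ?(ltW p0)// cauchy_transform_series.
rewrite -/p in k1 *; lra.
Qed.

(** For t > 0, t times this is the Cauchy density in x with centre 1/t and scale eta. *)
Definition poisson_kernel (x eta t : R) : R :=
  pi^-1 * (t * eta / ((1 - t * x) ^+ 2 + (t * eta) ^+ 2)).

Lemma poisson_denominator (x eta t : R) : eta != 0 ->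
  0 < (1 - t * x) ^+ 2 + (t * eta) ^+ 2.
Proof.
move=> e0; have [->|t0] := eqVneq t 0.
  by rewrite !mul0r subr0 expr1n expr0n addr0.
by rewrite ltr_wpDl ?sqr_ge0// exprn_even_gt0// mulf_neq0.
Qed.

Lemma continuous_poisson_kernel (x eta : R) : eta != 0 -> continuous (poisson_kernel x eta).
Proof.
move=> e0 t; apply: cvgMr; apply: cvgM; first by apply: cvgMl; exact: cvg_id.
apply: cvgV; first by rewrite gt_eqF// poisson_denominator.
have c1 : {for t, continuous (fun t : R => 1 - t * x)}.
  by apply: cvgB; [exact: cvg_cst|apply: cvgMl; exact: cvg_id].
have c2 : {for t, continuous (fun t : R => t * eta)}.
  by apply: cvgMl; exact: cvg_id.
by apply: cvgD; apply: cvgM.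
Qed.

(** The difference of 1/(1 - t z) at conjugate points is purely imaginary, so after the factor -i /
    (2 pi) the form acts on a real kernel and splits into its u and v parts. *)
Lemma jump_poisson (f : R[i] -> R[i]) (x eta : R) : 0 < x -> 0 < eta ->
  (forall z, cmod z < 1 ->
     [series ((2 * pi)^-1)%:C * (a n * z ^+ n)]_n @ \oo --> (f z : R[i]^o)) ->
  holomorphic_off_cut f ->
  - 'i * (f (x +i* eta) - f (x -i* eta)) =
  limit_form u (poisson_kernel x eta) +i* limit_form v (poisson_kernel x eta).
Proof.
move=> x0 eta0 fser fhol.
have pi0 : (pi : R) != 0 by rewrite gt_eqF// pi_gt0.
pose p : R := (2 * pi)^-1.
pose h z := f z - p%:C * cauchy_transform z.
have dh z : ~~ (1 <= z) -> cdiff h z.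
  move=> zc; apply: cdiffB; first by apply: derivable_cdiff; exact: fhol.
  by apply: cdiffM; [exact: cdiff_cst|exact: cauchy_transform_cdiff].
have h0 : vanishes_near h 0.
  exists 1 => // z; rewrite subr0 => z1; apply/eqP; rewrite subr_eq0; apply/eqP.
  by apply: series_cauchy_transform => //; exact: fser.
have fp : f (x +i* eta) = p%:C * cauchy_transform (x +i* eta).
  apply/eqP; rewrite -subr_eq0; apply/eqP.
  have := @vanish_off_cut R h 1 x eta (or_introl erefl) dh h0 x0 eta0.
  by rewrite mul1r.
have fm : f (x -i* eta) = p%:C * cauchy_transform (x -i* eta).
  apply/eqP; rewrite -subr_eq0; apply/eqP.
  have := @vanish_off_cut R h (-1) x eta (or_intror erefl) dh h0 x0 eta0.
  by rewrite mulN1r.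
have nz (s : R) t : s != 0 -> 1 - t%:C * (x +i* s) != 0.
  move=> s0; rewrite -cmod_gt0 -(@ltr_pXn2r _ 2)// ?nnegrE ?cmod_ge0//.
  rewrite expr0n cmod_sqr !(cReB, cImB, cReM, cImM)/= !mul0r subr0 sub0r addr0 sqrrN.
  exact: poisson_denominator.
have e0 : eta != 0 by rewrite gt_eqF.
have e1 : - eta != 0 by rewrite oppr_eq0.
have cp : cwithin `[0, 1] (fun t : R => (1 - t%:C * (x +i* eta))^-1).
  by apply: cwithin_cauchy_kernel => t _; exact: nz.
have cm : cwithin `[0, 1] (fun t : R => (1 - t%:C * (x -i* eta))^-1).
  by apply: cwithin_cauchy_kernel => t _; exact: nz.
rewrite fp fm -mulrBr -climit_formB// mulrA -climit_formZ//; last exact: cwithinB.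
rewrite (_ : (fun t => _) = (fun t => (poisson_kernel x eta t)%:C)).
  by rewrite /climit_form/= !limit_form0 subr0 add0r.
apply/funext => t.
have D0 := @poisson_denominator x eta t e0.
have E : (1 - t%:C * (x +i* eta)) * (1 - t%:C * (x -i* eta)) =
    ((1 - t * x) ^+ 2 + (t * eta) ^+ 2)%:C.
  by apply: complex_eqP; rewrite !(cReM, cImM, cReB, cImB, cReM, cImM)/=; ring.
have -> : (1 - t%:C * (x +i* eta))^-1 - (1 - t%:C * (x -i* eta))^-1 =
    (t%:C * (2 * eta)%:C * 'i) / ((1 - t * x) ^+ 2 + (t * eta) ^+ 2)%:C.
  rewrite -E; have n1 := nz _ t e0; have n2 := nz _ t e1.
  have -> : t%:C * (2 * eta)%:C * 'i = (1 - t%:C * (x -i* eta)) - (1 - t%:C * (x +i* eta)).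
    by apply: complex_eqP; rewrite !(cReM, cImM, cReB, cImB, cReM, cImM)/=; ring.
  by field; rewrite n1 n2.
have -> : poisson_kernel x eta t = p * (2 * eta * t) / ((1 - t * x) ^+ 2 + (t * eta) ^+ 2).
  rewrite /poisson_kernel /p; move: D0; move: (_ ^+ 2 + _ ^+ 2) => D /lt0r_neq0 D0.
  by move: pi0; move: (pi : R) => q q0; field; do ?(apply/andP; split).
set D := _ + (t * eta) ^+ 2.
have -> : (p * (2 * eta * t) / D)%:C = (p * (2 * eta * t))%:C * (D%:C)^-1 :> R[i].
  by rewrite (rmorphM _ _ D^-1) fmorphV.
rewrite [LHS]mulrA; congr (_ * _).
by apply: complex_eqP; rewrite !(cReM, cImM)/=; ring.
Qed.

(** For x < 1 the factor 1 - t x stays away from 0 on [0,1] and the kernel is of order eta. The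
    boundary values are thus those of F extended by 0 below 1. *)
Lemma poisson_below_one_cvg (x : R) (eta : nat -> R) : x < 1 ->
  (forall n, 0 < eta n) -> eta n @[n --> \oo] --> (0 : R) ->
  limit_form u (poisson_kernel x (eta n)) @[n --> \oo] --> (0 : R).
Proof.
move=> x1 e0 ecvg.
have [d d0 hd] : exists2 d : R, 0 < d & forall t : R, 0 <= t <= 1 -> d <= `|1 - t * x|.
  have [d d0 hd] := @slit_distance (x +i* 0) (off_cut (or_introl x1)).
  exists d => // t t01; have := hd t t01.
  have -> : 1 - t%:C * (x +i* 0) = (1 - t * x)%:C.
    by apply: complex_eqP; rewrite !(cReB, cImB, cReM, cImM)/=; ring.
  by rewrite cmodr.
have d2 : 0 < d ^+ 2 by rewrite exprn_gt0.
have b n : `|limit_form u (poisson_kernel x (eta n))| <= (C + 1) * (pi^-1 * (eta n / d ^+ 2)).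
  apply: (limit_form_le u_sqr u_moment).
  - by rewrite mulr_ge0 ?invr_ge0 ?pi_ge0// divr_ge0 ?ltW.
  - by apply: continuous_subspaceT; apply: continuous_poisson_kernel; rewrite gt_eqF.
  move=> t t01; have := hd t t01; have := e0 n; move: (eta n) => e ep dt.
  have den := @poisson_denominator x e t (lt0r_neq0 ep).
  rewrite /poisson_kernel normrM gtr0_norm ?invr_gt0 ?pi_gt0//.
  rewrite ler_pM2l ?invr_gt0 ?pi_gt0// ger0_norm; last first.
    by rewrite divr_ge0 ?mulr_ge0 ?(ltW ep) ?(ltW den)//; case/andP: t01.
  apply: ler_pM; rewrite ?invr_ge0 ?mulr_ge0 ?(ltW ep) ?(ltW den)//; first by case/andP: t01.
    by case/andP: t01 => t0 t1; rewrite ler_piMl// ltW.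
  rewrite lef_pV2 ?posrE// -(real_normK (num_real (1 - t * x))).
  by rewrite (le_trans (_ : _ <= `|1 - t * x| ^+ 2))// ?lerDl ?sqr_ge0// lerXn2r// nnegrE ltW.
apply: norm_cvg0.
apply: (@squeeze_cvgr _ _ _ _ (fun=> 0) (fun n => (C + 1) * (pi^-1 * (eta n / d ^+ 2)))).
- by apply: nearW => n; rewrite normr_ge0 b.
- exact: cvg_cst.
have -> : 0 = (C + 1) * (pi^-1 * (0 / d ^+ 2)) :> R by rewrite mul0r !mulr0.
by apply: cvgMr; apply: cvgMr; apply: cvgMl.
Qed.

End ComplexLimitForm.

(** * Square-integrable functions *)

Lemma real_dominated_convergence d (T : measurableType d) (R : realType)
    (mu : {measure set T -> \bar R}) (D : set T) (f_ : nat -> T -> R) (f g : T -> R) :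
  measurable D -> (forall n, measurable_fun D (f_ n)) -> measurable_fun D f ->
  {ae mu, forall x, D x -> f_ n x @[n --> \oo] --> f x} ->
  mu.-integrable D (EFin \o g) -> (forall n x, D x -> `|f_ n x| <= g x) ->
  \int[mu]_(x in D) f_ n x @[n --> \oo] --> \int[mu]_(x in D) f x.
Proof.
move=> mD mf_ mf fcvg ig fg.
have [||| | |i1 _ H] := @dominated_convergence _ _ _ mu D mD
   (fun n => EFin \o f_ n) (EFin \o f) (EFin \o g) => //.
- by move=> n; exact/measurable_EFinP.
- exact/measurable_EFinP.
- by apply: filterS fcvg => x H Dx; apply: cvg_EFin; [exact: nearW|exact: H].
- by apply/aeW => x n Dx /=; rewrite lee_fin fg.
apply: fine_cvg; rewrite fineK//; first exact: integrable_fin_num.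
Qed.

(** Either p q <= K p^2, or K p <= q and then p q <= q^2 / K. *)
Lemma product_truncation_le (R : realFieldType) (p q K : R) : 0 <= p -> 0 <= q -> 0 < K ->
  p * q <= Num.min (p * q) (K * p ^+ 2) + K^-1 * q ^+ 2.
Proof.
move=> p0 q0 K0; have Kq : 0 <= K^-1 * q ^+ 2 by rewrite mulr_ge0 ?sqr_ge0// invr_ge0 ltW.
case: (leP (p * q) (K * p ^+ 2)) => [_|/ltW pq]; first by rewrite lerDl.
have [->|pn0] := eqVneq p 0; first by rewrite mul0r expr0n mulr0 add0r.
have pp : 0 < p by rewrite lt_def pn0.
have Kp : K * p <= q by rewrite -(ler_pM2r pp) -mulrA -expr2 (le_trans pq)// mulrC.
have : p * q <= K^-1 * q ^+ 2 by rewrite expr2 mulrA ler_wpM2r// ler_pdivlMl.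
by move/le_trans; apply; rewrite lerDr mulr_ge0 ?sqr_ge0// ltW.
Qed.

Section SquareIntegrable.
Context d (T : measurableType d) (R : realType) (mu : {measure set T -> \bar R}).
Implicit Types (f g h : T -> R).

Definition sqint f := measurable_fun setT f /\
  mu.-integrable setT (EFin \o (fun x => f x ^+ 2)).

Definition ip f g : R := \int[mu]_x (f x * g x).

Lemma integrable_dominated f g : measurable_fun setT f ->
  mu.-integrable setT (EFin \o g) -> (forall x, `|f x| <= g x) ->
  mu.-integrable setT (EFin \o f).
Proof.
move=> mf ig fg; apply: le_integrable ig => //; first exact/measurable_EFinP.
by move=> x _ /=; rewrite lee_fin (le_trans (fg x))// ler_norm.
Qed.

Lemma integrableDr f g : mu.-integrable setT (EFin \o f) ->
  mu.-integrable setT (EFin \o g) -> mu.-integrable setT (EFin \o (fun x => f x + g x)).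
Proof.
move=> ig ih; rewrite (_ : _ \o _ = (EFin \o f) \+ (EFin \o g))%E; last exact/funext.
exact: integrableD.
Qed.

Lemma integrableBr f g : mu.-integrable setT (EFin \o f) ->
  mu.-integrable setT (EFin \o g) -> mu.-integrable setT (EFin \o (fun x => f x - g x)).
Proof.
move=> ig ih; rewrite (_ : _ \o _ = (EFin \o f) \- (EFin \o g))%E; last exact/funext.
exact: integrableB.
Qed.

Lemma integrableZr f (k : R) : mu.-integrable setT (EFin \o f) ->
  mu.-integrable setT (EFin \o (fun x => k * f x)).
Proof. by move=> ig; exact: (@integrableZl _ _ _ mu setT measurableT k (EFin \o f)). Qed.

Lemma sqintM f g : sqint f -> sqint g -> mu.-integrable setT (EFin \o (fun x => f x * g x)).
Proof.
move=> [mf f2] [mg g2]; apply: (@integrable_dominated _ (fun x => f x ^+ 2 + g x ^+ 2)).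
- exact: measurable_funM.
- exact: integrableDr.
move=> x; rewrite normrM -(real_normK (num_real (f x))) -(real_normK (num_real (g x))).
have := sqr_ge0 (`|f x| - `|g x|); have := normr_ge0 (f x); have := normr_ge0 (g x).
by move: `|f x| `|g x| => a b; rewrite !expr2; nra.
Qed.

Lemma sqintD f g : sqint f -> sqint g -> sqint (fun x => f x + g x).
Proof.
move=> sf sg; have [mf f2] := sf; have [mg g2] := sg; split.
  exact: measurable_funD.
rewrite (_ : (fun x => (f x + g x) ^+ 2) = (fun x => f x ^+ 2 + (2 * (f x * g x) + g x ^+ 2))).
  by apply: integrableDr => //; apply: integrableDr => //; apply: integrableZr; exact: sqintM.
by apply/funext => x; ring.
Qed.

Lemma sqintZ (k : R) f : sqint f -> sqint (fun x => k * f x).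
Proof.
move=> [mf f2]; split; first by apply: measurable_funM => //; exact: measurable_cst.
under [X in EFin \o X]eq_fun do rewrite exprMn.
exact: integrableZr.
Qed.

Lemma sqint0 : sqint (fun=> 0).
Proof.
split; first exact: measurable_cst.
under [X in EFin \o X]eq_fun do rewrite expr0n/=.
exact: integrable0.
Qed.

Lemma sqintB f g : sqint f -> sqint g -> sqint (fun x => f x - g x).
Proof.
move=> sf sg; under eq_fun do rewrite -[- _]mulN1r.
by apply: sqintD => //; exact: sqintZ.
Qed.

Lemma sqint_sum (n : nat) (F : nat -> T -> R) : (forall i, sqint (F i)) ->
  sqint (fun x => \sum_(i < n) F i x).
Proof.
move=> sF; elim: n => [|n IH].
  rewrite (_ : (fun _ => _) = (fun=> 0)); first exact: sqint0.
  by apply/funext => x; rewrite big_ord0.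
rewrite (_ : (fun _ => _) = (fun x => \sum_(i < n) F i x + F n x)).
  exact: sqintD.
by apply/funext => x; rewrite big_ord_recr.
Qed.

Lemma ipC f g : ip f g = ip g f.
Proof. by apply: eq_Rintegral => x _; rewrite mulrC. Qed.

Lemma ipDl f g h : sqint f -> sqint g -> sqint h ->
  ip (fun x => f x + g x) h = ip f h + ip g h.
Proof.
move=> sf sg sh; rewrite /ip -RintegralD//; [|exact: sqintM..].
by apply: eq_Rintegral => x _; rewrite mulrDl.
Qed.

Lemma ipZl (k : R) f h : sqint f -> sqint h ->
  ip (fun x => k * f x) h = k * ip f h.
Proof.
move=> sf sh; rewrite /ip -RintegralZl//; last exact: sqintM.
by apply: eq_Rintegral => x _; rewrite mulrA.
Qed.

Lemma ipBl f g h : sqint f -> sqint g -> sqint h ->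
  ip (fun x => f x - g x) h = ip f h - ip g h.
Proof.
move=> sf sg sh; rewrite /ip -RintegralB//; [|exact: sqintM..].
by apply: eq_Rintegral => x _; rewrite mulrBl.
Qed.

Lemma ip_suml (n : nat) (F : nat -> T -> R) h : (forall i, sqint (F i)) -> sqint h ->
  ip (fun x => \sum_(i < n) F i x) h = \sum_(i < n) ip (F i) h.
Proof.
move=> sF sh; elim: n => [|n IH].
  rewrite big_ord0 /ip; under eq_Rintegral do rewrite big_ord0 mul0r.
  by rewrite /Rintegral integral0.
rewrite (_ : (fun _ => _) = (fun x => \sum_(i < n) F i x + F n x)).
  by rewrite ipDl ?IH ?big_ord_recr//; exact: sqint_sum.
by apply/funext => x; rewrite big_ord_recr.
Qed.

Lemma ip_ge0 f : 0 <= ip f f.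
Proof. by apply: Rintegral_ge0 => x _; rewrite -expr2 sqr_ge0. Qed.

Lemma ip_sqrE f : ip f f = \int[mu]_x (f x ^+ 2).
Proof. by apply: eq_Rintegral => x _; rewrite expr2. Qed.

Lemma ip_sqrB f g : sqint f -> sqint g ->
  ip (fun x => f x - g x) (fun x => f x - g x) = ip f f - 2 * ip f g + ip g g.
Proof.
move=> sf sg; have sfg := sqintB sf sg.
rewrite (ipBl sf sg sfg) (ipC f) (ipBl sf sg sf) (ipC g (fun x => f x - g x)) (ipBl sf sg sg).
by rewrite (ipC g f); ring.
Qed.

Lemma ip_sqrB_le f g : sqint f -> sqint g ->
  ip (fun x => f x - g x) (fun x => f x - g x) <= 2 * ip f f + 2 * ip g g.
Proof.
move=> sf sg; have := ip_ge0 (fun x => f x - (-1) * g x).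
have sg' := sqintZ (-1) sg.
by rewrite !ip_sqrB// (ipC f (fun x => _ * g x)) !ipZl// (ipC g (fun x => _ * g x)) ipZl// (ipC g f); lra.
Qed.

(** Without a common majorant for the g_n, the product |psi (g_n - g)| is split by
    [product_truncation_le]: one part is dominated by K psi^2 and tends to 0, the other has integral
    at most B2 / K = e / 2 for all n. *)
Lemma weak_cvg (g_ : nat -> T -> R) g psi (B : R) :
  (forall n, sqint (g_ n)) -> (forall n, ip (g_ n) (g_ n) <= B) ->
  sqint g -> sqint psi -> {ae mu, forall x, g_ n x @[n --> \oo] --> g x} ->
  ip psi (g_ n) @[n --> \oo] --> ip psi g.
Proof.
move=> sg_ gB sg spsi gcvg.
have [mpsi ipsi] := spsi; have [mg ig] := sg.
pose B2 := 2 * B + 2 * ip g g + 1.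
have B0 : 0 <= B by exact: le_trans (ip_ge0 (g_ 0)) (gB 0).
have B20 : 0 < B2 by rewrite ltr_wpDl// addr_ge0// mulr_ge0// ip_ge0.
have dB n : ip (fun x => g_ n x - g x) (fun x => g_ n x - g x) <= B2.
  by rewrite (le_trans (ip_sqrB_le (sg_ n) sg))// /B2; have := gB n; lra.
apply/cvgrPdist_lt => e e0.
pose K := 2 * B2 / e.
have K0 : 0 < K by rewrite divr_gt0// mulr_gt0.
pose m n x := Num.min `|psi x * (g_ n x - g x)| (K * psi x ^+ 2).
have mm n : measurable_fun setT (m n).
  apply: measurable_minr.
    apply: measurableT_comp => //; apply: measurable_funM => //.
    by apply: measurable_funB => //; case: (sg_ n).
  by apply: measurable_funM; [exact: measurable_cst|exact: measurable_funX].
have m0 n x : 0 <= m n x by rewrite le_min normr_ge0 mulr_ge0 ?sqr_ge0// ltW.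
have idom : mu.-integrable setT (EFin \o (fun x => K * psi x ^+ 2)) by exact: integrableZr.
have mcvg : \int[mu]_x m n x @[n --> \oo] --> \int[mu]_(x in setT) (0 : R).
  apply: (real_dominated_convergence measurableT mm (measurable_cst _) _ idom).
    apply: filterS gcvg => x gx _.
    apply: (@squeeze_cvgr _ _ _ _ (fun=> 0) (fun n => `|psi x * (g_ n x - g x)|)).
    - by apply: nearW => n; rewrite m0 ge_min lexx.
    - exact: cvg_cst.
    suff : `|psi x * (g_ n x - g x)| @[n --> \oo] --> `|psi x * (g x - g x)|.
      by rewrite subrr mulr0 normr0.
    by apply: cvg_norm; apply: cvgMr; apply: cvgB => //; exact: cvg_cst.
  by move=> n x _; rewrite ger0_norm// ge_min lexx orbT.
have {}mcvg : \int[mu]_x m n x @[n --> \oo] --> (0 : R).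
  by move: mcvg; rewrite /Rintegral integral0.
have im n : mu.-integrable setT (EFin \o m n).
  apply: integrable_dominated idom _ => // x.
  by rewrite ger0_norm// ge_min lexx orbT.
have /cvgrPdist_lt/(_ (e / 2)) := mcvg.
rewrite divr_gt0// => /(_ isT); apply: filterS => n /=.
rewrite sub0r normrN ger0_norm; last by apply: Rintegral_ge0.
move=> mn; rewrite distrC.
have sgn := sqintB (sg_ n) sg.
rewrite (ipC psi (g_ n)) (ipC psi g) -(ipBl (sg_ n) sg spsi).
apply: (@le_lt_trans _ _ (\int[mu]_x (m n x + K^-1 * (g_ n x - g x) ^+ 2))).
  rewrite (le_trans (le_normr_Rintegral measurableT _))//; first exact: sqintM.
  apply: le_Rintegral => //.
  - by apply/integrable_norm/sqintM.
  - by apply: integrableDr => //; apply: integrableZr; case: sgn.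
  move=> x _; rewrite /m mulrC.
  rewrite -(real_normK (num_real (psi x))) -(real_normK (num_real (g_ n x - g x))) normrM.
  exact: product_truncation_le.
rewrite RintegralD//; last by apply: integrableZr; case: sgn.
rewrite RintegralZl//; last by case: sgn.
rewrite -ip_sqrE (splitr e) ltr_leD//.
rewrite ler_pdivrMl//; have -> : K * (e / 2) = B2 by rewrite /K; field; rewrite gt_eqF.
exact: dB.
Qed.

Lemma sqint_of_le f (B : R) : measurable_fun setT f ->
  (\int[mu]_x (f x ^+ 2)%:E <= B%:E)%E -> sqint f /\ ip f f <= B.
Proof.
move=> mf fB.
have ig : mu.-integrable setT (EFin \o (fun x => f x ^+ 2)).
  apply/integrableP; split; first by apply/measurable_EFinP; exact: measurable_funX.
  rewrite (_ : (fun x => _) = (fun x => (f x ^+ 2)%:E)).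
    by rewrite (le_lt_trans fB)// ltry.
  by apply/funext => x /=; rewrite ger0_norm// sqr_ge0.
split; first by split.
by rewrite ip_sqrE -lee_fin /Rintegral fineK//; exact: integrable_fin_num.
Qed.

Lemma fatou_sqint (g_ : nat -> T -> R) g (B : R) :
  (forall n, sqint (g_ n)) -> (forall n, ip (g_ n) (g_ n) <= B) ->
  (forall x, g_ n x @[n --> \oo] --> g x) ->
  sqint g /\ ip g g <= B.
Proof.
move=> sg_ gB gcvg.
have mg : measurable_fun setT g.
  apply: (measurable_fun_cvg (h := g_)); first by move=> n; case: (sg_ n).
  by move=> x _; exact: gcvg.
have gE n : (\int[mu]_x (g_ n x ^+ 2)%:E = (ip (g_ n) (g_ n))%:E)%E.
  by rewrite ip_sqrE /Rintegral fineK//; apply: integrable_fin_num => //; case: (sg_ n).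
have F : (\int[mu]_x (g x ^+ 2)%:E <= B%:E)%E.
  have gl x : limn_einf (fun n => (g_ n x ^+ 2)%:E) = (g x ^+ 2)%:E.
    have h : (g_ n x ^+ 2)%:E @[n --> \oo] --> (g x ^+ 2)%:E.
      by apply: cvg_EFin; [exact: nearW|apply: cvgM; exact: gcvg].
    by rewrite is_cvg_limn_einfE ?(cvg_lim _ h)//; apply/cvg_ex; exists (g x ^+ 2)%:E.
  under eq_integral do rewrite -gl.
  apply: (le_trans (fatou mu measurableT _ _)).
  - move=> n; apply/measurable_EFinP; apply: measurable_funX; by case: (sg_ n).
  - by move=> n x _; rewrite lee_fin sqr_ge0.
  rewrite limn_einf_lim; apply: lime_le; first exact: is_cvg_einfs.
  apply: nearW => n; apply: (@le_trans _ _ (\int[mu]_x (g_ n x ^+ 2)%:E)%E).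
    by apply: ereal_inf_lbound; exists n => /=.
  by rewrite gE lee_fin.
exact: sqint_of_le.
Qed.

End SquareIntegrable.

(** * Boundary values of Poisson integrals *)

Section ParameterIntegral.
Context {R : realType}.
Local Notation mu := (@lebesgue_measure R).

(** Tonelli's theorem speaks of nonnegative functions, so the positive and negative parts are
    integrated separately. *)
Lemma measurable_Rintegral_snd (D : set R) (f : R * R -> R) : measurable D ->
  measurable_fun setT f ->
  measurable_fun setT (fun x => \int[mu]_(t in D) f (x, t)).
Proof.
move=> mD mf.
pose F (p : R * R) : \bar R := (f p * \1_D p.2)%:E.
have mF : measurable_fun setT F.
  apply/measurable_EFinP; apply: measurable_funM => //.
  by apply: measurableT_comp => //; exact: measurable_snd.
have mp := @measurable_fun_fubini_tonelli_F _ _ _ _ R mu F^\+%E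
  (measurable_funepos mF) (@funepos_ge0 _ _ F).
have mn := @measurable_fun_fubini_tonelli_F _ _ _ _ R mu F^\-%E
  (measurable_funeneg mF) (@funeneg_ge0 _ _ F).
rewrite (_ : (fun x => _) = fine \o (fubini_F mu F^\+%E \- fubini_F mu F^\-%E)%E).
  apply: measurableT_comp; first exact: fine_measurable.
  exact: emeasurable_funB.
apply/funext => x /=; rewrite /Rintegral; congr fine.
rewrite integral_mkcond integralE; congr (_ - _)%E.
  apply: eq_integral => t _; rewrite /F !funeposE patchE/= indicE.
  by case: ifPn => _; rewrite ?mulr1 ?mulr0.
apply: eq_integral => t _; rewrite /F !funenegE patchE/= indicE.
by case: ifPn => _; rewrite ?mulr1 ?mulr0.
Qed.

Lemma measurable_Rintegral_fst (f : R * R -> R) :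
  measurable_fun setT f ->
  measurable_fun setT (fun t => \int[mu]_x f (x, t)).
Proof.
move=> mf; apply: (@measurable_Rintegral_snd setT (fun p => f (p.2, p.1))) => //.
by apply: (measurableT_comp mf); exact: measurable_swap.
Qed.

End ParameterIntegral.

(** * The Poisson kernel as a function of x *)

Section PoissonKernel.
Context {R : realType}.
Local Notation mu := (@lebesgue_measure R).
Implicit Types (x t eta : R).
Local Notation k := (@poisson_kernel R).

Let den x eta t := (1 - t * x) ^+ 2 + (t * eta) ^+ 2.

Lemma measurable_poisson_kernel eta : 0 < eta ->
  measurable_fun setT (fun p : R * R => k p.1 eta p.2).
Proof.
move=> e0.
have m1 : measurable_fun setT (fun p : R * R => p.1) by exact: measurable_fst.
have m2 : measurable_fun setT (fun p : R * R => p.2) by exact: measurable_snd.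
have md : measurable_fun setT (fun p : R * R => den p.1 eta p.2).
  apply: measurable_funD; apply: measurable_funX.
    by apply: measurable_funB => //; exact: measurable_funM.
  by apply: measurable_funM.
rewrite (_ : (fun p => _) = (fun p : R * R => pi^-1 * (p.2 * eta * (den p.1 eta p.2 `^ (-1))))).
  apply: measurable_funM => //; apply: measurable_funM; first exact: measurable_funM.
  by apply: (measurableT_comp (measurable_powR (-1))).
apply/funext => p; rewrite powR_inv1 //.
by apply/ltW/poisson_denominator; rewrite gt_eqF.
Qed.

Lemma poisson_kernel_ge0 x eta t : 0 < eta -> 0 <= t -> 0 <= k x eta t.
Proof.
move=> e0 t0; rewrite mulr_ge0 ?invr_ge0 ?pi_ge0// divr_ge0//.
  by rewrite mulr_ge0// ltW.
by apply/ltW/poisson_denominator; rewrite gt_eqF.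
Qed.

Lemma continuous_fst_poisson_kernel eta t : 0 < eta -> continuous (fun x => k x eta t).
Proof.
move=> e0 x; apply: cvgMr; apply: cvgMr.
apply: cvgV; first by rewrite gt_eqF// poisson_denominator// gt_eqF.
have c1 : {for x, continuous (fun x : R => 1 - t * x)}.
  by apply: cvgB; [exact: cvg_cst|apply: cvgMr; exact: cvg_id].
by apply: cvgD; [apply: cvgM|exact: cvg_cst].
Qed.

Lemma integral_oneDsqrV : (\int[mu]_x (oneDsqr x)^-1%:E = (pi : R)%:E)%E.
Proof.
rewrite ge0_symfun_integralT.
- rewrite -set_itvcy integral0y_oneDsqr -EFinM; congr EFin; by field.
- by move=> x; rewrite invr_ge0 (le_trans _ (oneDsqr_ge1 x)).
- exact: continuous_oneDsqrV.
- by move=> x /=; rewrite /oneDsqr sqrrN.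
Qed.

Lemma poisson_kernel_oneDsqr x eta t : 0 < eta -> 0 < t ->
  t * k x eta t = pi^-1 * ((oneDsqr (x / eta - (t * eta)^-1))^-1 * eta^-1).
Proof.
move=> e0 t0; have d0 : den x eta t != 0 by rewrite gt_eqF// poisson_denominator// gt_eqF.
have -> : oneDsqr (x / eta - (t * eta)^-1) = den x eta t / (t * eta) ^+ 2.
  by rewrite /oneDsqr /den; field; rewrite (gt_eqF e0) (gt_eqF t0).
rewrite /poisson_kernel -/(den _ _ _); move: (den _ _ _) d0 => d d0.
have pi0 : (pi : R) != 0 by rewrite gt_eqF// pi_gt0.
by move: (pi : R) pi0 => p p0; field; rewrite p0 d0 (gt_eqF e0) (gt_eqF t0).
Qed.

Lemma poisson_mass eta t : 0 < eta -> 0 < t ->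
  (\int[mu]_x (t * k x eta t)%:E = 1)%E.
Proof.
move=> e0 t0.
have te : 0 < t * eta by rewrite mulr_gt0.
pose F (x : R) : R := x / eta - (t * eta)^-1.
have isF x : is_derive x 1 F (eta^-1).
  have -> : F = (fun x => eta^-1 *: x - (t * eta)^-1) by apply/funext => y; rewrite /F mulrC.
  by apply: is_derive_eq; rewrite subr0 scaler1.
have F' : derive1 F = cst eta^-1.
  by apply/funext => x; rewrite derive1E; apply: derive_val.
have dF x : derivable F x 1 by apply: ex_derive.
have pi0 : (pi : R) != 0 by rewrite gt_eqF// pi_gt0.
have Fy (A x : R) : (F x <= A) = (x <= (A + (t * eta)^-1) * eta).
  by rewrite lerBlDr ler_pdivrMr.
have yF (A x : R) : (A <= F x) = ((A + (t * eta)^-1) * eta <= x).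
  by rewrite lerBrDr ler_pdivlMr.
have := @increasing_ge0_integration_by_substitutionT R F (fun x => (oneDsqr x)^-1).
rewrite F' integral_oneDsqrV => H.
have {H} H : (pi%:E = \int[mu]_x ((((fun x => (oneDsqr x)^-1) \o F) * cst eta^-1)%R x)%:E)%E.
  apply: H.
  - by move=> x y xy; rewrite ltrD2r ltr_pM2r ?invr_gt0.
  - by move=> x; exact: cvg_cst.
  - exact: is_cvg_cst.
  - exact: is_cvg_cst.
  - exact: dF.
  - apply/cvgrNyPle => A; near=> x; rewrite Fy.
    by near: x; apply: nbhs_ninfty_le; rewrite num_real.
  - apply/cvgryPge => A; near=> x; rewrite yF.
    by near: x; apply: nbhs_pinfty_ge; rewrite num_real.
  - exact: continuous_oneDsqrV.
  - by move=> x; rewrite invr_ge0 (le_trans _ (oneDsqr_ge1 x)).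
transitivity (pi^-1%:E * \int[mu]_x ((((fun x => (oneDsqr x)^-1) \o F) * cst eta^-1)%R x)%:E)%E.
  rewrite -ge0_integralZl_EFin//=.
  - apply: eq_integral => x _; rewrite -EFinM; congr EFin.
    exact: poisson_kernel_oneDsqr.
  - by move=> x _; rewrite lee_fin mulr_ge0 ?invr_ge0 ?(ltW e0)// (le_trans _ (oneDsqr_ge1 _)).
  - apply/measurable_EFinP; apply: measurable_funM => //.
    apply: measurableT_comp.
      by apply: continuous_measurable_fun; exact: continuous_oneDsqrV.
    apply: continuous_measurable_fun => x.
    exact/differentiable_continuous/derivable1_diffP/dF.
  - by rewrite invr_ge0 pi_ge0.
by rewrite -H -EFinM mulVf.
Unshelve. all: by end_near. Qed.

(** Comparison with the kernel of scale 1, whose mass is known, replaces a tail integral: at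
    distance at least s from 1/t, (x - 1/t)^2 + 1 <= (1 + s^-2) (x - 1/t)^2. *)
Lemma le_poisson_kernel_distant x eta t s : 0 < t -> 0 < eta <= 1 -> 0 < s ->
  s <= `|x - t^-1| -> k x eta t <= eta * (1 + s ^- 2) * k x 1 t.
Proof.
move=> t0 /andP[e0 e1] s0 sx.
have s2 : s ^+ 2 <= (x - t^-1) ^+ 2.
  by rewrite -(real_normK (num_real (x - _))) lerXn2r ?nnegrE ?(ltW s0).
have d0 : 0 < den x eta t by apply: poisson_denominator; rewrite gt_eqF.
have d1 : 0 < den x 1 t by apply: poisson_denominator; rewrite oner_eq0.
suff h : den x 1 t <= (1 + s ^- 2) * den x eta t.
  rewrite /poisson_kernel -!/(den _ _ _) mulr1.
  rewrite [leRHS](_ : _ = (pi^-1 * t * eta) * ((1 + s ^- 2) / den x 1 t)); last by ring.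
  rewrite [leLHS](_ : _ = (pi^-1 * t * eta) * (den x eta t)^-1); last by ring.
  rewrite ler_wpM2l ?mulr_ge0 ?invr_ge0 ?pi_ge0 ?(ltW e0) ?(ltW t0)//.
  by rewrite ler_pdivlMr// mulrC ler_pdivrMr.
have E z : den x z t = t ^+ 2 * ((x - t^-1) ^+ 2 + z ^+ 2).
  by rewrite /den; field; rewrite gt_eqF.
rewrite !E mulrCA ler_pM2l ?exprn_gt0// expr1n.
have ss : 1 <= s ^- 2 * (x - t^-1) ^+ 2 by rewrite mulrC ler_pdivlMr ?exprn_gt0// mul1r.
have : 0 <= (1 + s ^- 2) * eta ^+ 2 by rewrite mulr_ge0 ?sqr_ge0// addr_ge0// invr_ge0 sqr_ge0.
by rewrite mulrDr; lra.
Qed.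

End PoissonKernel.

(** * Poisson transforms and their L^2 bound *)

Section PoissonTransform.
Context {R : realType}.
Local Notation mu := (@lebesgue_measure R).
Implicit Types (x t eta : R) (w : R -> R).
Local Notation k := (@poisson_kernel R).

(** In t this is the Cauchy density with centre x / (x^2 + eta^2) and scale eta / (x^2 + eta^2). *)
Definition conjugate_kernel x eta t : R := pi^-1 * (eta / ((1 - t * x) ^+ 2 + (t * eta) ^+ 2)).
Local Notation Q := conjugate_kernel.

Lemma poisson_kernelE x eta t : k x eta t = t * Q x eta t.
Proof. by rewrite /poisson_kernel /conjugate_kernel; ring. Qed.

Lemma conjugate_kernel_ge0 x eta t : 0 < eta -> 0 <= Q x eta t.
Proof.
move=> e0; rewrite mulr_ge0 ?invr_ge0 ?pi_ge0// divr_ge0 ?(ltW e0)//.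
by apply/ltW/poisson_denominator; rewrite gt_eqF.
Qed.

Lemma continuous_conjugate_kernel x eta : 0 < eta -> continuous (Q x eta).
Proof.
move=> e0 t; apply: cvgMr; apply: cvgMr.
apply: cvgV; first by rewrite gt_eqF// poisson_denominator// gt_eqF.
have c1 : {for t, continuous (fun t : R => 1 - t * x)}.
  by apply: cvgB; [exact: cvg_cst|apply: cvgMl; exact: cvg_id].
have c2 : {for t, continuous (fun t : R => t * eta)}.
  by apply: cvgMl; exact: cvg_id.
by apply: cvgD; [exact: (cvgM c1 c1)|exact: (cvgM c2 c2)].
Qed.

(** The primitive pi^-1 atan((s t - x) / eta), with s = x^2 + eta^2, takes values in an interval of
    length 1. *)
Lemma conjugate_kernel_mass x eta : 0 < eta ->
  \int[mu]_(t in `[0, 1]) Q x eta t <= 1.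
Proof.
move=> e0.
pose s := x ^+ 2 + eta ^+ 2.
have s0 : 0 < s by rewrite ltr_wpDl ?sqr_ge0// exprn_gt0.
pose G (t : R) : R := pi^-1 * atan ((s * t - x) / eta).
have isG t : is_derive t 1 G (Q x eta t).
  rewrite (_ : G = (fun t => pi^-1 *: (atan \o (fun t => eta^-1 *: (s *: t - x))) t)); last first.
    by apply/funext => y; rewrite /G /=; congr (_ * atan _); rewrite mulrC.
  have h1 : is_derive t 1 (fun t : R => eta^-1 *: (s *: t - x)) (eta^-1 * s).
    by apply: is_derive_eq; rewrite subr0 scaler1.
  have h2 := @is_derive1_comp _ (@atan R) (fun t => eta^-1 *: (s *: t - x)) t _ _
    (is_derive1_atan (eta^-1 *: (s *: t - x))) h1.
  have h3 : is_derive t 1 (fun t => pi^-1 *: (atan \o (fun t => eta^-1 *: (s *: t - x))) t)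
    (pi^-1 *: ((1 + (eta^-1 *: (s *: t - x)) ^+ 2)^-1 * (eta^-1 * s))).
    by apply: is_deriveZ.
  apply: (is_derive_eq h3); rewrite /conjugate_kernel; congr (_ * _).
  have d0 : (1 - t * x) ^+ 2 + (t * eta) ^+ 2 != 0.
    by rewrite gt_eqF// poisson_denominator// gt_eqF.
  have -> : 1 + (eta^-1 *: (s *: t - x)) ^+ 2 =
     s * ((1 - t * x) ^+ 2 + (t * eta) ^+ 2) / eta ^+ 2.
    by rewrite /s /GRing.scale /=; field; rewrite (gt_eqF e0).
  move: d0; set d := _ + _ => d0; rewrite /GRing.scale/=.
  by field; rewrite d0 (gt_eqF e0) (gt_eqF s0).
have cG t : {for t, continuous G}.
  by apply/differentiable_continuous/derivable1_diffP; apply: ex_derive.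
rewrite /Rintegral (@continuous_FTC2 _ _ G)//.
- rewrite -EFinB /= -mulrBr mulrC ler_pdivrMr ?pi_gt0// mul1r.
  have := atan_ltpi2 ((s * 1 - x) / eta); have := atan_gtNpi2 ((s * 0 - x) / eta).
  lra.
- by apply: continuous_subspaceT; exact: continuous_conjugate_kernel.
- split.
  + by move=> t _; apply: ex_derive.
  + by apply: cvg_at_right_filter; exact: cG.
  + by apply: cvg_at_left_filter; exact: cG.
- by move=> t _; rewrite derive1E; apply: derive_val.
Qed.

Definition poisson_transform w eta x : R := \int[mu]_(t in `[0, 1]) (w t * k x eta t).
Local Notation J := poisson_transform.

Lemma measurable_poisson_transform w eta : 0 < eta -> measurable_fun setT w ->
  measurable_fun setT (J w eta).
Proof.
move=> e0 mw.
apply: (@measurable_Rintegral_snd R `[0, 1]%classic (fun p => w p.2 * k p.1 eta p.2)) => //.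
apply: measurable_funM; last exact: measurable_poisson_kernel.
by apply: measurableT_comp => //; exact: measurable_snd.
Qed.

(* Jensen's inequality: [t] times the conjugate kernel is the Poisson kernel, and
   the conjugate kernel has mass at most 1 on [0,1]. *)
Lemma poisson_transform_sqr_le w eta x : 0 < eta -> continuous w ->
  J w eta x ^+ 2 <= \int[mu]_(t in `[0, 1]) (w t ^+ 2 * (t * k x eta t)).
Proof.
move=> e0 cw.
have cQ := continuous_conjugate_kernel (x := x) e0.
have ck : continuous (k x eta) by apply: continuous_poisson_kernel; rewrite gt_eqF.
set j := J w eta x.
have c1 : continuous (fun t => w t * k x eta t) by move=> t; exact: (cvgM (cw t) (ck t)).
have c2 : continuous (fun t => 2 * j * (w t * k x eta t)).
  by move=> t; apply: cvgMr; exact: c1.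
have c3 : continuous (fun t => j ^+ 2 * Q x eta t).
  by move=> t; apply: cvgMr; exact: cQ.
have c4 : continuous (fun t => w t ^+ 2 * (t * k x eta t)).
  move=> t; apply: cvgM; first exact: (cvgM (cw t) (cw t)).
  by apply: cvgM; [exact: cvg_id|exact: ck].
have H : \int[mu]_(t in `[0, 1]) (2 * j * (w t * k x eta t) - j ^+ 2 * Q x eta t) <=
   \int[mu]_(t in `[0, 1]) (w t ^+ 2 * (t * k x eta t)).
  apply: le_segment_integral.
  - by apply: within_continuousB; exact: continuous_subspaceT.
  - exact: continuous_subspaceT.
  move=> t _; rewrite poisson_kernelE.
  have h := mulr_ge0 (sqr_ge0 (w t * t - j)) (conjugate_kernel_ge0 x t e0).
  rewrite -subr_ge0 (_ : _ - _ = (w t * t - j) ^+ 2 * Q x eta t)//.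
  by move: (Q x eta t) => q; ring.
move: H; rewrite segment_integralB; [|exact: continuous_subspaceT..].
rewrite (@segment_integralZ R (fun t => w t * k x eta t)); last exact: continuous_subspaceT.
rewrite (@segment_integralZ R (Q x eta)); last exact: continuous_subspaceT.
rewrite -/(J w eta x) -/j; apply: le_trans.
have := ler_wpM2l (sqr_ge0 j) (conjugate_kernel_mass x e0); rewrite mulr1.
by move: (j ^+ 2 * _) => z; rewrite expr2; lra.
Qed.

(** Integrating Jensen's bound in x and exchanging the integrals leaves the mass of t k, which is 1
    for t > 0. The bound does not depend on eta, which is what weak convergence as eta tends to 0
    requires. *)
Lemma poisson_transform_sqint w eta : 0 < eta -> continuous w ->
  sqint mu (J w eta) /\
  ip mu (J w eta) (J w eta) <= \int[mu]_(t in `[0, 1]) (w t ^+ 2).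
Proof.
move=> e0 cw.
have mw : measurable_fun setT w by exact: continuous_measurable_fun.
have mJ := measurable_poisson_transform e0 mw.
pose f (p : R * R) : R := (w p.2) ^+ 2 * (p.2 * k p.1 eta p.2) * \1_`[0, 1] p.2.
have f0 p : 0 <= f p.
  rewrite /f indicE; case: (boolP (p.2 \in _)) => [|_]; last by rewrite mulr0.
  rewrite inE/= in_itv/= => /andP[t0 t1].
  by rewrite mulr1 mulr_ge0 ?sqr_ge0// mulr_ge0// poisson_kernel_ge0.
have mf : measurable_fun setT (EFin \o f).
  apply/measurable_EFinP; apply: measurable_funM; last first.
    by apply: measurableT_comp; [exact: measurable_indic|exact: measurable_snd].
  have m2 : measurable_fun setT (fun p : R * R => p.2) by exact: measurable_snd.
  apply: measurable_funM; first by apply: measurable_funX; exact: measurableT_comp.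
  by apply: measurable_funM => //; exact: measurable_poisson_kernel.
have cf x : {within `[0, 1], continuous (fun t => w t ^+ 2 * (t * k x eta t))}.
  apply: continuous_subspaceT => t; apply: cvgM; first exact: (cvgM (cw t) (cw t)).
  apply: cvgM; [exact: cvg_id|]; apply: continuous_poisson_kernel; by rewrite gt_eqF.
have cw2 : {within `[0, 1], continuous (fun t => w t ^+ 2)}.
  by apply: continuous_subspaceT => t; exact: (cvgM (cw t) (cw t)).
have fE x : (\int[mu]_t (f (x, t))%:E =
    (\int[mu]_(t in `[0%R, 1%R]) (w t ^+ 2 * (t * k x eta t)))%:E)%E.
  rewrite /Rintegral fineK; last first.
    by apply: integrable_fin_num => //; exact: within_continuous_integrable.
  rewrite [RHS]integral_mkcond; apply: eq_integral => t _.
  rewrite /f patchE indicE/=; case: ifPn => _; by rewrite ?mulr1 ?mulr0.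
have H : (\int[mu]_x (J w eta x ^+ 2)%:E <= (\int[mu]_(t in `[0%R, 1%R]) (w t ^+ 2))%:E)%E.
  apply: (@le_trans _ _ (\int[mu]_x \int[mu]_t (f (x, t))%:E)%E).
    apply: ge0_le_integral => //.
    - by move=> x _; rewrite lee_fin sqr_ge0.
    - by apply/measurable_EFinP; exact: measurable_funX.
    - exact: (measurable_fun_fubini_tonelli_F (m2 := mu) (EFin \o f)).
    - by move=> x _; rewrite fE lee_fin poisson_transform_sqr_le.
  rewrite (fubini_tonelli (m1 := mu) (m2 := mu) (EFin \o f))//=.
  rewrite /Rintegral fineK; last first.
    by apply: integrable_fin_num => //; exact: within_continuous_integrable.
  rewrite [leRHS]integral_mkcond; apply: ge0_le_integral => //.
  - by move=> t _; apply: integral_ge0 => x _; rewrite lee_fin f0.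
  - exact: (measurable_fun_fubini_tonelli_G (m1 := mu) (EFin \o f)).
  - apply/(measurable_restrictT _ _).1 => //.
    by apply/measurable_EFinP; apply: measurable_funTS; exact: measurable_funX.
  move=> t _; rewrite patchE /f/= indicE.
  case: (boolP (t \in _)) => [|_]; last first.
    by rewrite (eq_integral (fun=> 0%E)) ?integral0// => x _; rewrite mulr0.
  rewrite inE/= in_itv/= => /andP[t0 t1].
  have [->|tn0] := eqVneq t 0.
    rewrite (eq_integral (fun=> 0%E)) ?integral0 ?lee_fin ?sqr_ge0// => x _.
    by rewrite mul0r mulr0 mul0r.
  have tp : 0 < t by rewrite lt_def tn0.
  under eq_integral do rewrite mulr1 EFinM.
  rewrite ge0_integralZl_EFin ?sqr_ge0//.
  - by rewrite poisson_mass// mule1.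
  - by move=> x _; rewrite lee_fin mulr_ge0// poisson_kernel_ge0.
  - apply/measurable_EFinP; apply: measurable_funM => //.
    by apply: continuous_measurable_fun; exact: continuous_fst_poisson_kernel.
exact: sqint_of_le.
Qed.

End PoissonTransform.

(** * Averages of a test function against the Poisson kernel *)

Section PoissonAverage.
Context {R : realType}.
Local Notation mu := (@lebesgue_measure R).
Implicit Types (x t eta : R) (w : R -> R).
Local Notation k := (@poisson_kernel R).
Variable psi : R -> R.
Hypothesis psi_measurable : measurable_fun setT psi.
Hypothesis psi_ge0 : forall x, 0 <= psi x.
Hypothesis psi_le1 : forall x, psi x <= 1.
Hypothesis psi_integrable : mu.-integrable setT (EFin \o psi).

(** As t k is an approximate identity at 1/t, t times the average tends to psi(1/t); when psi(1/t) =
    t^(n+2) the average tends to t^(n+1). *)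
Definition poisson_average eta t : R := \int[mu]_x (psi x * k x eta t).
Local Notation avg := poisson_average.

Let measurable_k eta t : 0 < eta -> measurable_fun setT (fun x => k x eta t).
Proof. by move=> e0; apply: continuous_measurable_fun; exact: continuous_fst_poisson_kernel. Qed.

Lemma integrable_poisson_kernel eta t : 0 < eta -> 0 <= t ->
  mu.-integrable setT (EFin \o (fun x => t * k x eta t)).
Proof.
move=> e0 t0; apply/integrableP; split.
  by apply/measurable_EFinP; apply: measurable_funM => //; exact: measurable_k.
rewrite (_ : (fun x => _) = (fun x => (t * k x eta t)%:E)); last first.
  by apply/funext => x /=; rewrite ger0_norm// mulr_ge0// poisson_kernel_ge0.
have [->|tn0] := eqVneq t 0.
  by under eq_integral do rewrite mul0r; rewrite integral0.
by rewrite poisson_mass ?ltry// lt_def tn0.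
Qed.

Lemma integrable_psi_poisson_kernel eta t : 0 < eta -> 0 <= t ->
  mu.-integrable setT (EFin \o (fun x => psi x * k x eta t)).
Proof.
move=> e0 t0; have [->|tn0] := eqVneq t 0.
  rewrite (_ : _ \o _ = cst 0%E); first exact: integrable0.
  by apply/funext => x /=; rewrite /poisson_kernel !mul0r mulr0 mulr0.
have tp : 0 < t by rewrite lt_def tn0.
apply: (@integrable_dominated _ _ R mu (fun x => psi x * k x eta t)
  (fun x => t^-1 * (t * k x eta t))).
- by apply: measurable_funM => //; exact: measurable_k.
- by apply: integrableZr; exact: integrable_poisson_kernel.
move=> x; rewrite mulKf ?gt_eqF// ger0_norm; last by rewrite mulr_ge0// poisson_kernel_ge0.
by rewrite -[leRHS]mul1r ler_wpM2r// poisson_kernel_ge0.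
Qed.

Lemma poisson_average_ge0 eta t : 0 < eta -> 0 <= t -> 0 <= avg eta t.
Proof. by move=> e0 t0; apply: Rintegral_ge0 => x _; rewrite mulr_ge0// poisson_kernel_ge0. Qed.

Lemma measurable_poisson_average eta : 0 < eta -> measurable_fun setT (avg eta).
Proof.
move=> e0; apply: (@measurable_Rintegral_fst R (fun p => psi p.1 * k p.1 eta p.2)).
apply: measurable_funM; last exact: measurable_poisson_kernel.
by apply: measurableT_comp => //; exact: measurable_fst.
Qed.

(** Fubini's theorem; the bound c on the average provides integrability on the product. *)
Lemma ip_poisson_transform w eta (c : R) : 0 < eta -> continuous w ->
  (forall t, 0 <= t <= 1 -> avg eta t <= c) ->
  ip mu psi (poisson_transform w eta) = \int[mu]_(t in `[0, 1]) (w t * avg eta t).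
Proof.
move=> e0 cw hc.
have mw : measurable_fun setT w by exact: continuous_measurable_fun.
have [B B0 hB] := @segment_bounded R w 0 1 (continuous_subspaceT cw).
have c0 : 0 <= c by rewrite (le_trans _ (hc 0 _)) ?poisson_average_ge0 ?lexx ?ler01.
pose f (p : R * R) : R := psi p.1 * (w p.2 * k p.1 eta p.2) * \1_`[0, 1] p.2.
have mf : measurable_fun setT (EFin \o f).
  apply/measurable_EFinP; apply: measurable_funM; last first.
    by apply: measurableT_comp; [exact: measurable_indic|exact: measurable_snd].
  apply: measurable_funM; first by apply: measurableT_comp => //; exact: measurable_fst.
  apply: measurable_funM; last exact: measurable_poisson_kernel.
  by apply: measurableT_comp => //; exact: measurable_snd.
have avgE t : 0 <= t -> (\int[mu]_x (psi x * k x eta t)%:E = (avg eta t)%:E)%E.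
  move=> t0; rewrite /poisson_average /Rintegral fineK//.
  by apply: integrable_fin_num => //; exact: integrable_psi_poisson_kernel.
have intf : (mu \x mu)%E.-integrable setT (EFin \o f).
  apply/integrable21ltyP => //.
  apply: (@le_lt_trans _ _ (\int[mu]_(t in `[0%R, 1%R]) (B * c)%:E)%E); last first.
    by rewrite integral_cst//= lebesgue_measure_itv/= lte_fin ltr01 -EFinB -EFinM ltry.
  rewrite [leRHS]integral_mkcond; apply: ge0_le_integral => //.
  - by move=> t _; exact: integral_ge0.
  - apply: (measurable_fun_fubini_tonelli_G (m1 := mu) (abse \o (EFin \o f))).
      exact: measurableT_comp.
    by move=> p; exact: abse_ge0.
  - apply/(measurable_restrictT _ _).1 => //; exact: measurable_cst.
  move=> t _; rewrite patchE /f/= indicE.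
  case: (boolP (t \in _)) => [|_]; last first.
    by under eq_integral do rewrite mulr0 normr0; rewrite integral0.
  rewrite inE/= in_itv/= => t01; have /andP[t0 t1] := t01.
  under eq_integral do rewrite mulr1.
  rewrite (_ : (fun x => _) = (fun x => `|w t|%:E * (psi x * k x eta t)%:E)%E); last first.
    apply/funext => x; rewrite -EFinM mulrCA normrM; congr ((_ * _)%:E).
    by rewrite ger0_norm// mulr_ge0// poisson_kernel_ge0.
  rewrite ge0_integralZl_EFin//.
  - by rewrite avgE// -EFinM lee_fin ler_pM ?poisson_average_ge0 ?hB ?hc.
  - by move=> x _; rewrite lee_fin mulr_ge0// poisson_kernel_ge0.
  - by apply/measurable_EFinP; apply: measurable_funM => //; exact: measurable_k.
have h1 : (\int[mu]_x \int[mu]_t (f (x, t))%:E = \int[mu]_x (psi x * poisson_transform w eta x)%:E)%E.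
  apply: eq_integral => x _.
  have ci : mu.-integrable `[0, 1] (EFin \o (fun t => w t * k x eta t)).
    apply: within_continuous_integrable; apply: continuous_subspaceT => t.
    by apply: cvgM; [exact: cw|apply: continuous_poisson_kernel; rewrite gt_eqF].
  rewrite /poisson_transform -RintegralZl// /Rintegral fineK; last first.
    apply: integrable_fin_num => //.
    exact: (@integrableZl _ _ _ mu `[0, 1]%classic _ (psi x) _ ci).
  rewrite [RHS]integral_mkcond; apply: eq_integral => t _.
  by rewrite patchE /f/= indicE; case: (t \in _); rewrite ?mulr1 ?mulr0.
have h2 : (\int[mu]_t \int[mu]_x (f (x, t))%:E = \int[mu]_(t in `[0%R, 1%R]) (w t * avg eta t)%:E)%E.
  rewrite [RHS]integral_mkcond; apply: eq_integral => t _.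
  rewrite patchE /f/= indicE.
  case: (boolP (t \in _)) => [|_]; last first.
    by under eq_integral do rewrite mulr0; rewrite integral0.
  rewrite inE/= in_itv/= => /andP[t0 t1].
  under eq_integral do rewrite mulr1 mulrCA EFinM.
  by rewrite integralZl ?avgE//; exact: integrable_psi_poisson_kernel.
by rewrite /ip /Rintegral -h1 -h2 (Fubini intf).
Qed.

Variables (L A : R) (n : nat).
Hypothesis L_gt0 : 0 < L.
Hypothesis psi_lipschitz : forall x y, `|psi x - psi y| <= L * `|x - y|.
Hypothesis psi_decay : forall x t, 0 < t <= 1 -> 1 <= 2 * t * `|x| -> psi x <= 4 * t ^+ 2.
Hypothesis psi_inv : forall t, 0 < t <= 1 -> psi t^-1 = t ^+ n.+2.
Hypothesis psi_mass : \int[mu]_x psi x <= A.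

(** Where 2 t |x| >= 1, decay gives psi <= 4 t^2, hence psi k <= 4 t (t k). Elsewhere 1 - t x >=
    1/2, so that k <= 4 t. Integration uses the masses 1 of t k and at most A of psi. *)
Lemma le_poisson_average eta t : 0 < eta <= 1 -> 0 <= t <= 1 -> avg eta t <= (4 + 4 * A) * t.
Proof.
move=> /andP[e0 e1] /andP[t0 t1].
have [->|tn0] := eqVneq t 0.
  rewrite mulr0 /poisson_average /poisson_kernel.
  by under eq_Rintegral do rewrite !mul0r mulr0 mulr0; rewrite /Rintegral integral0.
have tp : 0 < t by rewrite lt_def tn0.
have i1 := integrable_poisson_kernel e0 t0.
apply: (@le_trans _ _ (\int[mu]_x (4 * t * (t * k x eta t) + 4 * t * psi x))).
  apply: le_Rintegral => //; first exact: integrable_psi_poisson_kernel.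
    by apply: integrableDr; exact: integrableZr.
  move=> x _.
  have k0 : 0 <= k x eta t by rewrite poisson_kernel_ge0.
  have [h|h] := leP 1 (2 * t * `|x|).
    apply: (@le_trans _ _ (4 * t ^+ 2 * k x eta t)).
      by rewrite ler_wpM2r// psi_decay// tp.
    rewrite (_ : 4 * t ^+ 2 * k x eta t = 4 * t * (t * k x eta t)); last by ring.
    by rewrite lerDl !mulr_ge0.
  have kle : k x eta t <= 4 * t.
    rewrite /poisson_kernel.
    have den : 4^-1 <= (1 - t * x) ^+ 2 + (t * eta) ^+ 2.
      have h2 : t * x <= 2^-1.
        have := ler_wpM2l t0 (ler_norm x); move: h; nra.
      have := sqr_ge0 (t * eta); have : (1 - t * x) ^+ 2 >= 4^-1; last by lra.
      by rewrite expr2; nra.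
    rewrite mulrC ler_pdivrMr ?pi_gt0// ler_pdivrMr; last by rewrite (lt_le_trans _ den).
    have pi1 : 1 <= (pi : R) by rewrite (le_trans _ (pi_ge2 _))// ler1n.
    have := ler_wpM2l t0 den; have := ler_wpM2l t0 e1; rewrite mulr1.
    set d := _ + _ => p1 p2.
    have p3 : 0 <= t * d by rewrite (le_trans _ p2)// mulr_ge0.
    have := ler_wpM2r p3 pi1; rewrite mul1r.
    rewrite (_ : 4 * t * pi * d = 4 * (pi * (t * d))); last by ring.
    by lra.
  apply: (@le_trans _ _ (4 * t * psi x)); last first.
    by rewrite lerDr (mulr_ge0 (mulr_ge0 _ t0) (mulr_ge0 t0 k0)).
  by rewrite mulrC ler_wpM2r.
rewrite RintegralD//; [|exact: integrableZr..].
rewrite (RintegralZl (4 * t) measurableT i1) (RintegralZl (4 * t) measurableT psi_integrable).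
have -> : \int[mu]_x (t * k x eta t) = 1 by rewrite /Rintegral poisson_mass.
by have := ler_wpM2l t0 psi_mass; lra.
Qed.

(** Within distance s of 1/t the Lipschitz bound applies; further away |psi x - psi(1/t)| <= 1 and
    [le_poisson_kernel_distant] makes the kernel of order eta. *)
Lemma poisson_average_dist eta t s : 0 < eta <= 1 -> 0 < t <= 1 -> 0 < s ->
  t * `|avg eta t - t ^+ n.+1| <= L * s + eta * (1 + s ^- 2).
Proof.
move=> e01 t01 s0; have /andP[e0 e1] := e01; have /andP[t0 t1] := t01.
have ts := ltW t0.
have i1 := integrable_poisson_kernel e0 ts.
have i2 := integrable_psi_poisson_kernel e0 ts.
have i3 := integrable_poisson_kernel (@ltr01 R) ts.
have m1 z : 0 < z -> \int[mu]_x (t * k x z t) = 1 by move=> z0; rewrite /Rintegral poisson_mass.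
have i4 : mu.-integrable setT (EFin \o (fun x => t * (psi x * k x eta t))) by exact: integrableZr.
have i5 : mu.-integrable setT (EFin \o (fun x => t ^+ n.+2 * (t * k x eta t))) by exact: integrableZr.
have -> : t * `|avg eta t - t ^+ n.+1| =
    `|\int[mu]_x (t * (psi x * k x eta t) - t ^+ n.+2 * (t * k x eta t))|.
  rewrite RintegralB// (RintegralZl t measurableT i2) (RintegralZl (t ^+ n.+2) measurableT i1).
  rewrite m1// mulr1 -[X in X * _](ger0_norm ts) -normrM mulrBr.
  by rewrite -exprS.
rewrite (le_trans (le_normr_Rintegral measurableT _))//.
  exact: integrableBr.
set c := eta * _.
have c0 : 0 <= c by rewrite mulr_ge0 ?(ltW e0)// addr_ge0// invr_ge0 sqr_ge0.
have Ls0 : 0 <= L * s by rewrite mulr_ge0// ltW.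
apply: (@le_trans _ _ (\int[mu]_x (L * s * (t * k x eta t) + c * (t * k x 1 t)))).
  apply: le_Rintegral => //.
  - by apply/integrable_norm/integrableBr.
  - by apply: integrableDr; exact: integrableZr.
  move=> x _.
  have kx : 0 <= k x eta t by rewrite poisson_kernel_ge0.
  have k1 : 0 <= k x 1 t by rewrite poisson_kernel_ge0.
  rewrite -psi_inv//.
  rewrite (_ : _ - _ = (psi x - psi t^-1) * (t * k x eta t)); last by ring.
  rewrite normrM [`|t * _|]ger0_norm; last by rewrite mulr_ge0.
  have tk : 0 <= t * k x eta t by rewrite mulr_ge0.
  have [h|h] := leP s `|x - t^-1|.
    apply: (@le_trans _ _ (c * (t * k x 1 t))); last first.
      by rewrite lerDr (mulr_ge0 Ls0 tk).
    rewrite mulrCA [leRHS]mulrCA ler_wpM2l// -[leRHS]mul1r ler_pM//.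
      rewrite ler_norml; have := psi_ge0 x; have := psi_le1 x.
      by have := psi_ge0 t^-1; have := psi_le1 t^-1; lra.
    exact: le_poisson_kernel_distant.
  apply: (@le_trans _ _ (L * s * (t * k x eta t))); last first.
    by rewrite lerDl (mulr_ge0 c0 (mulr_ge0 ts k1)).
  by rewrite ler_wpM2r// (le_trans (psi_lipschitz _ _))// ler_pM2l// ltW.
rewrite RintegralD//; [|exact: integrableZr..].
by rewrite (RintegralZl (L * s) measurableT i1) (RintegralZl c measurableT i3) !m1// !mulr1.
Qed.

(** Uniformity down to t = 0 is essential, since the densities are controlled only against the sup
    norm. For t <= tau both terms are O(t); for t > tau the previous estimate may be divided by t.
    The choice of s makes L s = e tau / 2, and eta is taken small enough for the other half. *)
Lemma poisson_average_uniform (e : R) : 0 < e -> exists2 eta0 : R, 0 < eta0 &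
  forall eta t, 0 < eta <= eta0 -> 0 <= t <= 1 -> `|avg eta t - t ^+ n.+1| <= e.
Proof.
move=> e0.
have A0 : 0 <= A by rewrite (le_trans _ psi_mass)//; exact: Rintegral_ge0.
pose c := 4 + 4 * A; pose tau := e / (c + 1).
have c1 : 0 < c + 1 by rewrite /c; lra.
have tau0 : 0 < tau by rewrite divr_gt0.
pose s := e * tau / (2 * L).
have s0 : 0 < s by rewrite divr_gt0 ?(mulr_gt0 e0 tau0) ?(mulr_gt0 _ L_gt0).
have d0 : 0 < 1 + s ^- 2 by rewrite ltr_pwDl// invr_ge0 sqr_ge0.
pose eta1 := e * tau / (2 * (1 + s ^- 2)).
have h0 : 0 < eta1 by rewrite divr_gt0 ?(mulr_gt0 e0 tau0) ?(mulr_gt0 _ d0).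
exists (Num.min 1 eta1); first by rewrite lt_min ltr01.
move=> eta t /andP[eta0]; rewrite le_min => /andP[eta_1 eta_s] t01.
have e01 : 0 < eta <= 1 by rewrite eta0.
have /andP[t0 t1] := t01.
have [ht|ht] := leP t tau.
  have hb := le_poisson_average e01 t01.
  have hp := poisson_average_ge0 eta0 t0.
  have tn : t ^+ n.+1 <= t by rewrite exprS -[leRHS]mulr1 ler_wpM2l// exprn_ile1.
  have tn0 : 0 <= t ^+ n.+1 by rewrite exprn_ge0.
  have ct : (c + 1) * t <= e by rewrite -ler_pdivlMl// mulrC.
  rewrite -/c in hb.
  by rewrite ler_norml; apply/andP; split; nra.
have tp : 0 < t by rewrite (lt_trans tau0).
have H := @poisson_average_dist eta t s e01 _ s0.
rewrite -(ler_pM2l tp) (le_trans (H _)) ?tp//.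
have -> : L * s = e * tau / 2 by rewrite /s; field; rewrite gt_eqF.
have : eta * (1 + s ^- 2) <= e * tau / 2.
  rewrite (le_trans (ler_wpM2r (ltW d0) eta_s))// /eta1.
  move: (1 + s ^- 2) d0 => d d0.
  by rewrite (_ : _ / _ * d = e * tau / 2)//; field; rewrite gt_eqF.
by have := ler_wpM2l (ltW e0) (ltW ht); lra.
Qed.

End PoissonAverage.

(** * Test functions: inverse powers cut off at 1 *)

Section InversePower.
Context {R : realType}.
Local Notation mu := (@lebesgue_measure R).
Implicit Types (x y t : R).

(* Agrees with x^-n on [1, +oo); cutting it off at 1 makes it square integrable
   on the whole line. *)
Definition inv_power (n : nat) x : R := (Num.max 1 `|x|) ^- n.

Let m x : R := (Num.max 1 `|x|)^-1.

Let inv_powerE n x : inv_power n x = m x ^+ n.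
Proof. by rewrite /inv_power /m exprVn. Qed.

Let max_ge1 x : 1 <= Num.max 1 `|x|. Proof. by rewrite le_max lexx. Qed.

Let max_gt0 x : 0 < Num.max 1 `|x|. Proof. exact: lt_le_trans (max_ge1 x). Qed.

Let m_ge0 x : 0 <= m x. Proof. by rewrite invr_ge0 ltW. Qed.

Let m_le1 x : m x <= 1. Proof. by rewrite invf_le1. Qed.

Lemma inv_power_ge0 n x : 0 <= inv_power n x.
Proof. by rewrite inv_powerE exprn_ge0. Qed.

Lemma inv_power_le1 n x : inv_power n x <= 1.
Proof. by rewrite inv_powerE exprn_ile1. Qed.

Lemma inv_power_V n t : 0 < t <= 1 -> inv_power n t^-1 = t ^+ n.
Proof.
move=> /andP[t0 t1]; rewrite inv_powerE /m gtr0_norm ?invr_gt0// max_r ?invrK//.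
by rewrite invf_ge1.
Qed.

Lemma inv_power_ge1 n x : 1 <= x -> inv_power n x = x ^- n.
Proof. by move=> x1; rewrite /inv_power ger0_norm ?(le_trans _ x1)// max_r. Qed.

Lemma inv_power_decay n x t : 0 < t <= 1 -> 1 <= 2 * t * `|x| -> inv_power n.+2 x <= 4 * t ^+ 2.
Proof.
move=> /andP[t0 t1] h; rewrite inv_powerE -addn2 exprD.
have mt : m x <= 2 * t.
  rewrite /m invf_ple ?posrE ?mulr_gt0// (le_trans _ (_ : `|x| <= _))//; last by rewrite le_max lexx orbT.
  by rewrite -div1r ler_pdivrMr ?mulr_gt0// mulrC.
apply: (@le_trans _ _ (m x ^+ 2)); first by rewrite ler_piMl ?exprn_ge0// exprn_ile1.
rewrite (_ : 4 * t ^+ 2 = (2 * t) ^+ 2); last by ring.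
by rewrite lerXn2r// nnegrE; [exact: m_ge0|rewrite mulr_ge0// ltW].
Qed.

Let m_lipschitz x y : `|m x - m y| <= `|x - y|.
Proof.
have -> : m x - m y = m x * m y * (Num.max 1 `|y| - Num.max 1 `|x|).
  by rewrite /m; field; rewrite !gt_eqF.
rewrite normrM ger0_norm; last by rewrite mulr_ge0.
rewrite -[leRHS]mul1r ler_pM ?mulr_ge0// ?mulr_ile1//.
rewrite (le_trans (_ : _ <= `|(`|y| - `|x|)|))//; last by rewrite distrC ler_dist_dist.
move: `|x| `|y| => p q; rewrite !maxEle.
by case: (leP 1 p) => p1; case: (leP 1 q) => q1 //; rewrite ?subrr ?normr0//;
  rewrite !ler_norml; case: (ler0P (q - p)) => ?; apply/andP; split; lra.
Qed.

Lemma inv_power_lipschitz n x y : `|inv_power n x - inv_power n y| <= n%:R * `|x - y|.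
Proof.
rewrite !inv_powerE; elim: n => [|n IH]; first by rewrite !expr0 subrr normr0 mul0r.
rewrite !exprS.
have -> : m x * m x ^+ n - m y * m y ^+ n =
  m x * (m x ^+ n - m y ^+ n) + m y ^+ n * (m x - m y) by ring.
rewrite (le_trans (ler_normD _ _))// !normrM -natr1 mulrDl mul1r lerD//.
  by rewrite (le_trans _ IH)// ler_piMl// ger0_norm.
by rewrite (le_trans _ (m_lipschitz x y))// ler_piMl// ger0_norm ?exprn_ge0// exprn_ile1.
Qed.

Lemma measurable_inv_power n : measurable_fun setT (inv_power n).
Proof.
apply: continuous_measurable_fun => x; apply/cvgrPdist_lt => e e0.
have n1 : 0 < n.+1%:R :> R by rewrite ltr0n.
near=> y; apply: (@le_lt_trans _ _ (n.+1%:R * `|x - y|)).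
  by rewrite (le_trans (inv_power_lipschitz _ _ _))// ler_wpM2r// ler_nat.
rewrite mulrC -ltr_pdivlMr//.
by near: y; apply: (@cvgr_dist_lt _ _ _ _ _ id x) => //; exact: divr_gt0.
Unshelve. all: by end_near. Qed.

Lemma integrable_inv_power n : mu.-integrable setT (EFin \o inv_power n.+2).
Proof.
apply: (@integrable_dominated _ _ R mu _ (fun x => 2 * (oneDsqr x)^-1)).
- exact: measurable_inv_power.
- apply: integrableZr; apply/integrableP; split.
    by apply/measurable_EFinP; apply: continuous_measurable_fun; exact: continuous_oneDsqrV.
  rewrite (_ : (fun x => _) = (fun x => (oneDsqr x)^-1%:E)); last first.
    by apply/funext => x /=; rewrite ger0_norm// invr_ge0 (le_trans _ (oneDsqr_ge1 x)).
  by rewrite integral_oneDsqrV ltry.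
move=> x; rewrite ger0_norm ?inv_power_ge0// inv_powerE -addn2 exprD.
apply: (@le_trans _ _ (m x ^+ 2)); first by rewrite ler_piMl ?exprn_ge0// exprn_ile1.
have d0 : 0 < oneDsqr x by rewrite (lt_le_trans _ (oneDsqr_ge1 x)).
rewrite /m exprVn ler_pdivlMr// ler_pdivrMl ?exprn_gt0// /oneDsqr.
have h1 := max_ge1 x.
have h2 : `|x| <= Num.max 1 `|x| by rewrite le_max lexx orbT.
rewrite -(real_normK (num_real x)); have := normr_ge0 x.
by move: (Num.max _ _) h1 h2 => M h1 h2 h3; rewrite !expr2; nra.
Qed.

Lemma sqint_inv_power n : sqint mu (inv_power n.+1).
Proof.
split; first exact: measurable_inv_power.
apply: (integrable_dominated _ (integrable_inv_power 0)).
  by apply: measurable_funX; exact: measurable_inv_power.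
move=> x; rewrite ger0_norm ?sqr_ge0// !inv_powerE [m x ^+ n.+1]exprS exprMn.
by rewrite ler_piMr ?exprn_ge0// exprn_ile1 ?exprn_ge0// exprn_ile1.
Qed.

End InversePower.

Lemma cvg_norm_le_near (R : realType) (u : nat -> R) (l e : R) : u n @[n --> \oo] --> l ->
  (\forall n \near \oo, `|u n| <= e) -> `|l| <= e.
Proof.
move=> ul ue; have /cvg_lim <- : `|u n| @[n --> \oo] --> `|l| by apply: cvg_norm.
  by apply: limr_le => //; apply/cvg_ex; exists `|l|; exact: cvg_norm.
exact: norm_hausdorff.
Qed.

(** * Moments of the boundary values *)

Section BoundaryMoments.
Context {R : realType}.
Local Notation mu := (@lebesgue_measure R).
Variables (a : nat -> R) (v : nat -> {poly R}) (C : R).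
Hypothesis C_ge0 : 0 <= C.
Hypothesis v_sqr : forall n, \int[mu]_(x in `[0, 1]) ((v n).[x] ^+ 2) <= C.
Hypothesis v_moment : forall k,
  \int[mu]_(x in `[0, 1]) ((v n).[x] * x ^+ k) @[n --> \oo] --> a k.

Lemma integrable_continuous_bounded (f h : R -> R) (e : R) : {within `[0, 1], continuous f} ->
  measurable_fun setT h -> (forall x, 0 <= x <= 1 -> `|h x| <= e) ->
  mu.-integrable `[0, 1] (EFin \o (fun x => f x * h x)).
Proof.
move=> cf mh he.
have i1 := within_continuous_integrable (within_continuous_norm cf).
have i2 := @integrableZl _ _ R mu `[0, 1]%classic (measurable_itv _) e _ i1.
apply: le_integrable i2 => //.
  apply/measurable_EFinP; apply: measurable_funM; last exact: measurable_funTS.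
  by apply/measurable_EFinP; apply: measurable_int (within_continuous_integrable cf).
move=> x /=; rewrite in_itv/= => x01; rewrite lee_fin normrM mulrC.
have e0 : 0 <= e by rewrite (le_trans _ (he _ x01)).
by rewrite [leRHS]ger0_norm ?mulr_ge0// ler_wpM2r// he.
Qed.

(** Variant of [density_integral_le] for measurable h: the averages t |-> avg eta t are known here
    only to be measurable. *)
Lemma density_integral_measurable_le n (h : R -> R) (e : R) : 0 <= e -> measurable_fun setT h ->
  (forall x, 0 <= x <= 1 -> `|h x| <= e) ->
  `|\int[mu]_(x in `[0, 1]) ((v n).[x] * h x)| <= (C + 1) * e.
Proof.
move=> e0 mh he.
have cv : {within `[0, 1], continuous (fun x => (v n).[x])} by exact: within_continuous_horner.
have ivh := integrable_continuous_bounded cv mh he.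
rewrite (le_trans (le_normr_Rintegral _ _))//.
have cv2 : {within `[0, 1], continuous (fun x : R => (v n).[x] ^+ 2)}.
  exact: (within_continuousM cv cv).
have c1 : {within `[0, 1], continuous (fun x : R => (v n).[x] ^+ 2 + 1)}.
  by apply: within_continuousD => //; exact: within_continuous_cst.
apply: (@le_trans _ _ (\int[mu]_(x in `[0, 1]) (e * ((v n).[x] ^+ 2 + 1)))).
  apply: le_Rintegral => //.
  - exact/integrable_norm.
  - apply: within_continuous_integrable.
    by apply: within_continuousM => //; exact: within_continuous_cst.
  move=> x /=; rewrite in_itv/= => x01; rewrite normrM mulrC.
  have h1 := he _ x01; apply: ler_pM => //.
  rewrite -(real_normK (num_real (v n).[x])).
  by have := normr_ge0 (v n).[x]; set y := `|_|; nra.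
rewrite segment_integralZ// segment_integralD//; last exact: within_continuous_cst.
by rewrite segment_integral_cst// subr0 mulr1 mulrC ler_wpM2r// lerD2r.
Qed.

Variable G : R -> R.
Hypothesis G_sqint : sqint mu G.
Hypothesis G_limit : {ae mu, forall x,
  limit_form v (poisson_kernel x j.+1%:R^-1) @[j --> \oo] --> G x}.

Let eta (j : nat) : R := j.+1%:R^-1.
Let eta_gt0 j : 0 < eta j. Proof. by rewrite invr_gt0 ltr0n. Qed.

Let J j x : R := limit_form v (poisson_kernel x (eta j)).
Let Jn n j x : R := poisson_transform (horner (v n)) (eta j) x.

Let Jn_cvg j x : Jn n j x @[n --> \oo] --> J j x.
Proof.
apply: (@limit_form_cvg R a v C v_sqr v_moment (poisson_kernel x (eta j))).
by apply: continuous_subspaceT; apply: continuous_poisson_kernel; rewrite gt_eqF.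
Qed.

Let Jn_sqint n j : sqint mu (Jn n j) /\ ip mu (Jn n j) (Jn n j) <= C.
Proof.
have [s1 s2] := @poisson_transform_sqint R (horner (v n)) (eta j) (eta_gt0 j)
  (@continuous_horner _ (v n)).
by split => //; exact: le_trans (v_sqr n).
Qed.

Let J_sqint j : sqint mu (J j) /\ ip mu (J j) (J j) <= C.
Proof.
apply: (@fatou_sqint _ _ R mu (fun n => Jn n j) (J j) C).
- by move=> n; case: (Jn_sqint n j).
- by move=> n; case: (Jn_sqint n j).
- exact: Jn_cvg.
Qed.

(** For fixed eta, Fubini writes <psi, J_n> as the integral of v_n against the average of psi, which
    is uniformly close to t^(n+1); the error is therefore small uniformly in the index of the
    density. Letting that index grow gives |<psi, J> - a_(n+1)| <= e for small eta, and then eta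
    tends to 0, both times by weak convergence. *)
Lemma boundary_moment n : ip mu (inv_power n.+2) G = a n.+1.
Proof.
set psi := inv_power n.+2.
have spsi : sqint mu psi by exact: sqint_inv_power.
have unif e : 0 < e -> exists2 eta0 : R, 0 < eta0 & forall eta, 0 < eta <= eta0 ->
    (forall t, 0 <= t <= 1 -> `|poisson_average psi eta t - t ^+ n.+1| <= e).
  move=> e0.
  have [eta0 h0 H] := @poisson_average_uniform R psi (measurable_inv_power _) (@inv_power_ge0 R _)
    (@inv_power_le1 R _) (integrable_inv_power n) n.+2%:R (\int[mu]_x psi x) n
    (ltr0Sn _ _) (@inv_power_lipschitz R _) (@inv_power_decay R n)
    (@inv_power_V R n.+2) (lexx _) e e0.
  by exists eta0 => // y h t t01; exact: H.
have J1 j : ip mu psi (Jn n j) @[n --> \oo] --> ip mu psi (J j).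
  apply: (@weak_cvg _ _ R mu (fun k => Jn k j) (J j) psi C) => //.
  - by move=> k; case: (Jn_sqint k j).
  - by move=> k; case: (Jn_sqint k j).
  - by case: (J_sqint j).
  - by apply: nearW => x; exact: Jn_cvg.
have J2 : ip mu psi (J j) @[j --> \oo] --> ip mu psi G.
  apply: (@weak_cvg _ _ R mu J G psi C) => //.
  - by move=> k; case: (J_sqint k).
  - by move=> k; case: (J_sqint k).
have C1 : 0 < C + 1 by rewrite ltr_wpDl.
apply/eqP; rewrite -subr_eq0 -normr_le0; apply/ler_addgt0Pr => e e0; rewrite add0r.
have [eta0 h0 H] := unif (e / (C + 1)) (divr_gt0 e0 C1).
have near_eta : \forall j \near \oo, eta j <= eta0.
  near=> j; rewrite /eta invf_ple ?posrE// -natr1.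
  rewrite (@le_trans _ _ j%:R)// ?lerDl//.
  by near: j; exact: nbhs_infty_ger.
have step j : eta j <= eta0 -> `|ip mu psi (J j) - a n.+1| <= e.
  move=> hj; have hu := H (eta j); rewrite eta_gt0 hj in hu; have {}hu := hu isT.
  have mh : measurable_fun setT (fun t => poisson_average psi (eta j) t - t ^+ n.+1).
    apply: measurable_funB; last exact: measurable_funX.
    by apply: measurable_poisson_average => //; exact: measurable_inv_power.
  apply: (@cvg_norm_le R (fun k => ip mu psi (Jn k j) -
     \int[mu]_(x in `[0, 1]) ((v k).[x] * x ^+ n.+1))).
    by apply: cvgB; [exact: J1|exact: v_moment].
  move=> k; have ce : (C + 1) * (e / (C + 1)) = e by field; rewrite gt_eqF.
  rewrite -[leRHS]ce.
  have e1 : 0 <= e / (C + 1) by rewrite ltW// divr_gt0.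
  apply: le_trans (density_integral_measurable_le k e1 mh hu).
  have avg1 t : 0 <= t <= 1 -> `|poisson_average psi (eta j) t| <= 1 + e / (C + 1).
    move=> t01; have /andP[t0 t1] := t01.
    rewrite -[poisson_average _ _ _](subrK (t ^+ n.+1)) addrC (le_trans (ler_normD _ _))//.
    by rewrite lerD ?hu// ger0_norm ?exprn_ge0// exprn_ile1.
  rewrite (@ip_poisson_transform R psi (measurable_inv_power _) (@inv_power_ge0 R _)
    (@inv_power_le1 R _) (horner (v k)) (eta j) (1 + e / (C + 1)))//; last 2 first.
  - exact: continuous_horner.
  - by move=> t t01; exact: le_trans (ler_norm _) (avg1 t t01).
  have cv : {within `[0, 1], continuous (fun x => (v k).[x])} by exact: within_continuous_horner.
  have cx : {within `[0, 1], continuous (fun x : R => x ^+ n.+1)}.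
    by apply: continuous_subspaceT; exact: exprn_continuous.
  rewrite -RintegralB//; last 2 first.
  - apply: (@integrable_continuous_bounded (horner (v k)) _ (1 + e / (C + 1))) => //.
    by apply: measurable_poisson_average => //; exact: measurable_inv_power.
  - by apply: within_continuous_integrable; exact: within_continuousM.
  by under eq_Rintegral do rewrite -mulrBr.
apply: (@cvg_norm_le_near R (fun j => ip mu psi (J j) - a n.+1)).
  by apply: cvgB => //; exact: cvg_cst.
by apply: filterS near_eta => j; exact: step.
Unshelve. all: by end_near. Qed.

End BoundaryMoments.

(** * The moments of the jump function *)

Section Moments.
Context {R : realType}.
Local Notation mu := (@lebesgue_measure R).

Lemma sqr_le1D_powR (z p : R) : 0 <= z -> 2 <= p -> z ^+ 2 <= 1 + z `^ p.
Proof.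
move=> z0 p2; have [z1|z1] := leP z 1.
  by rewrite (le_trans (exprn_ile1 _ z0 z1))// lerDl powR_ge0.
rewrite -powR_mulrn// (le_trans (ler_powR (ltW z1) p2))// lerDr//.
Qed.

(** With N = n + 1, N sum y_i^2 = sum N^-1 (N y_i)^2, and z^2 <= 1 + z^(2+delta) bounds this by 1
    plus the sum in the Hausdorff condition. *)
Lemma moment_energy_le (a : nat -> R[i]) (b : nat -> R) (delta M : R) n : 0 < delta ->
  (forall i m, `|rdiff i b m| <= cmod (fdiff i a m)) ->
  n.+1%:R `^ (1 + delta) *
      (\sum_(i < n.+1) 'C(n, i)%:R `^ (2 + delta) *
                       cmod (fdiff i a (n - i)) `^ (2 + delta)) < M ->
  moment_energy b n <= 1 + M.
Proof.
move=> d0 ba H; set N := n.+1%:R in H.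
have N0 : 0 < N by rewrite ltr0n.
pose y i : R := 'C(n, i)%:R * cmod (fdiff i a (n - i)).
have y0 i : 0 <= y i by rewrite mulr_ge0// cmod_ge0.
have p2 : 2 <= 2 + delta by rewrite lerDl ltW.
have pN : N * N `^ (1 + delta) = N `^ (2 + delta).
  rewrite -(@mulr_powRB1 _ N (2 + delta)) ?ltW//; last by rewrite (lt_le_trans _ p2).
  by congr (_ * _ `^ _); lra.
apply: (@le_trans _ _ (N * \sum_(i < n.+1) y i ^+ 2)).
  rewrite /moment_energy ler_wpM2l// (reindex_inj rev_ord_inj)/=.
  apply: ler_sum => -[i iN] _ /=; rewrite subSS moment_form_bernstein//.
  rewrite -(real_normK (num_real (_ * _))) lerXn2r// ?nnegrE//.
  by rewrite normrM normrX normrN1 expr1n mul1r normrM normr_nat ler_wpM2l.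
apply: (@le_trans _ _ (\sum_(i < n.+1) (N^-1 + N `^ (1 + delta) * y i `^ (2 + delta)))).
  rewrite mulr_sumr; apply: ler_sum => i _.
  have /(ler_wpM2l (_ : 0 <= N^-1)) := @sqr_le1D_powR (N * y i) (2 + delta) (mulr_ge0 (ltW N0) (y0 i)) p2.
  rewrite invr_ge0 ltW// => /(_ isT).
  rewrite (powRM _ (ltW N0) (y0 i)) -pN mulrDr mulr1 -!mulrA mulKf ?gt_eqF//.
  by rewrite exprMn expr2 -!mulrA mulKf ?gt_eqF.
rewrite big_split/= sumr_const card_ord -[N^-1 *+ n.+1]mulr_natl -/N divff ?gt_eqF// lerD2l.
apply/ltW.
rewrite -mulr_sumr; apply: le_lt_trans H; rewrite ler_wpM2l ?powR_ge0//.
by apply: ler_sum => i _; rewrite powRM// cmod_ge0.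
Qed.

Lemma rdiff_Re (a : nat -> R[i]) i m : rdiff i (fun n => complex.Re (a n)) m = complex.Re (fdiff i a m).
Proof.
rewrite /fdiff (big_morph (fun z : R[i] => complex.Re z) (@cReD R) (erefl : complex.Re 0 = 0)).
apply: eq_bigr => j _.
have -> : ((-1) ^+ j * 'C(i, j)%:R : R[i]) = ((-1) ^+ j * 'C(i, j)%:R)%:C.
  by rewrite rmorphM rmorphXn/= rmorphN1 rmorph_nat.
by rewrite cReM/= mul0r subr0.
Qed.

Lemma rdiff_Im (a : nat -> R[i]) i m : rdiff i (fun n => complex.Im (a n)) m = complex.Im (fdiff i a m).
Proof.
rewrite /fdiff (big_morph (fun z : R[i] => complex.Im z) (@cImD R) (erefl : complex.Im 0 = 0)).
apply: eq_bigr => j _.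
have -> : ((-1) ^+ j * 'C(i, j)%:R : R[i]) = ((-1) ^+ j * 'C(i, j)%:R)%:C.
  by rewrite rmorphM rmorphXn/= rmorphN1 rmorph_nat.
by rewrite cImM/= mul0r addr0.
Qed.

Lemma hausdorff_moment_energy (a : nat -> R[i]) : hausdorff_condition a ->
  exists2 C : R, 0 <= C & forall n,
    moment_energy (fun n => complex.Re (a n)) n <= C /\
    moment_energy (fun n => complex.Im (a n)) n <= C.
Proof.
move=> [delta [M [d0 M0 H]]]; exists (1 + M); first by rewrite addr_ge0// ltW.
move=> n; split; apply: (moment_energy_le d0 _ (H n)) => i m.
  by rewrite rdiff_Re le_Re_cmod.
by rewrite rdiff_Im le_Im_cmod.
Qed.

Section BoundedEnergy.
Variables (a : nat -> R) (C : R).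
Hypothesis C_ge0 : 0 <= C.
Hypothesis energy_le : forall n, moment_energy a n <= C.

Let v := durrmeyer a.

Lemma energy_sqr n : \int[mu]_(x in `[0, 1]) ((v n).[x] ^+ 2) <= C.
Proof. exact: le_trans (durrmeyer_sqr _ _) _. Qed.

(** The form on (1 - X)^n is a single term of the energy, so (n + 1) times its square is at most C.
    This excludes a point mass at 0, which the moments of index at least 1 cannot detect. *)
Lemma top_difference_cvg : moment_form a (bernstein n 0) @[n --> \oo] --> (0 : R).
Proof.
apply/cvgrPdist_lt => e e0.
near=> n; rewrite sub0r normrN.
have N0 : 0 < n.+1%:R :> R by rewrite ltr0n.
have h : n.+1%:R * moment_form a (bernstein n 0) ^+ 2 <= C.
  apply: le_trans (energy_le n); rewrite /moment_energy (ler_wpM2l (ltW N0))//.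
  by rewrite big_ord_recl/= lerDl sumr_ge0// => i _; rewrite sqr_ge0.
have : C < n.+1%:R * e ^+ 2.
  rewrite -ltr_pdivrMr ?exprn_gt0// (@lt_trans _ _ n%:R)// ?ltr_nat//.
  by near: n; exact: nbhs_infty_gtr.
move=> /(le_lt_trans h); rewrite ltr_pM2l// -(real_normK (num_real (moment_form _ _))).
by rewrite ltr_sqr// nnegrE ltW.
Unshelve. all: by end_near. Qed.

Variable G : R -> R.
Hypothesis G_sqint : sqint mu G.
Hypothesis G_limit : {ae mu, forall x,
  limit_form v (poisson_kernel x j.+1%:R^-1) @[j --> \oo] --> G x}.

Let m (x : R) : R := (Num.max 1 `|x|)^-1.
Let b k : R := ip mu (inv_power k.+1) G.

Let b_horner (p : {poly R}) : moment_form b p = \int[mu]_x (m x * p.[m x] * G x).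
Proof.
rewrite /moment_form /b.
transitivity (\sum_(i < size p) ip mu (fun x => p`_i * inv_power i.+1 x) G).
  by apply: eq_bigr => i _; rewrite ipZl//; exact: sqint_inv_power.
rewrite -(@ip_suml _ _ R mu (size p) (fun i x => p`_i * inv_power i.+1 x) G)//.
  apply: eq_Rintegral => x _; congr (_ * _).
  rewrite horner_coef mulr_sumr; apply: eq_bigr => i _.
  by rewrite mulrCA -exprS /inv_power /m exprVn.
by move=> i; apply: sqintZ; exact: sqint_inv_power.
Qed.

(** For index 0, let b be the moments of G. Since a and b agree from index 1 on, their forms on (1 -
    X)^n differ by the constant b 0 - a 0; both forms tend to 0, for b by dominated convergence
    because 0 <= 1 - m < 1. *)
Lemma boundary_moments n : ip mu (inv_power n.+1) G = a n.
Proof.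
case: n => [|n]; last exact: (boundary_moment C_ge0 energy_sqr (@durrmeyer_moment_cvg R a) G_sqint G_limit).
apply/eqP; rewrite -subr_eq0; apply/eqP.
have bS k : b k.+1 = a k.+1.
  exact: (boundary_moment C_ge0 energy_sqr (@durrmeyer_moment_cvg R a) G_sqint G_limit).
have m0 x : 0 < m x by rewrite invr_gt0 lt_max ltr01.
have m1 x : m x <= 1 by rewrite invf_le1 ?le_max ?lexx// lt_max ltr01.
have bern_coef n : (bernstein n 0)`_0 = 1 :> R.
  rewrite /bernstein bin0 expr0 mul1r mulr1n subn0 -horner_coef0.
  by rewrite horner_exp !hornerE subr0 expr1n.
have d n : moment_form b (bernstein n 0) - moment_form a (bernstein n 0) = b 0 - a 0.
  rewrite /moment_form; have := bern_coef n.
  case hs: (size (bernstein n 0)) => [|s] p0.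
    by move: p0; rewrite nth_default ?hs// => /eqP; rewrite eq_sym oner_eq0.
  rewrite !big_ord_recl p0 !mul1r opprD addrACA -sumrB big1 ?addr0// => i _.
  by rewrite lift0 bS subrr.
have bcvg : moment_form b (bernstein n 0) @[n --> \oo] --> \int[mu]_(x in setT) (0 : R).
  rewrite (_ : (fun n => _) = (fun n => \int[mu]_x (m x * (1 - m x) ^+ n * G x))); last first.
    apply/funext => n; rewrite b_horner; apply: eq_Rintegral => x _.
    by rewrite /bernstein bin0 expr0 mul1r mulr1n subn0 horner_exp !hornerE.
  have mm : measurable_fun setT m.
    exact: (@measurable_inv_power R 1).
  have [mG _] := G_sqint.
  apply: (@real_dominated_convergence _ _ R mu setT _ _ (fun x => `|m x * G x|)) => //.
  - move=> n; apply: measurable_funM => //; apply: measurable_funM => //.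
    by apply: measurable_funX; exact: measurable_funB.
  - apply: nearW => x _.
    have : m x * (1 - m x) ^+ n * G x @[n --> \oo] --> m x * 0 * G x.
      apply: cvgMl; apply: cvgMr; apply: cvg_expr.
      by rewrite ger0_norm ?subr_ge0// ltrBlDr ltrDl.
    by rewrite mulr0 mul0r.
  - apply/integrable_norm; have := sqintM (@sqint_inv_power R 0) G_sqint.
    exact.
  move=> n x _; rewrite !normrM ler_wpM2r// ler_piMr//.
  by rewrite ger0_norm ?exprn_ge0 ?subr_ge0// exprn_ile1 ?subr_ge0// lerBlDr lerDl ltW.
have {}bcvg : moment_form b (bernstein n 0) @[n --> \oo] --> (0 : R).
  by move: bcvg; rewrite /Rintegral integral0.
have := cvgB bcvg top_difference_cvg; rewrite subr0.
rewrite (_ : (fun n => _) - (fun n => _) = cst (b 0 - a 0)); last first.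
  by apply/funext => n /=; exact: d.
by move=> /(_ _) /cvg_lim <-//; rewrite lim_cst.
Qed.

End BoundedEnergy.

Definition cutoff (f : R -> R) : R -> R := f \_ `[1, +oo[.

Lemma cutoff_in f x : 1 <= x -> cutoff f x = f x.
Proof. by move=> x1; rewrite /cutoff patchE mem_set//= in_itv/= x1. Qed.

Lemma cutoff_out f x : x < 1 -> cutoff f x = 0.
Proof. by move=> x1; rewrite /cutoff patchE memNset//= in_itv/= leNgt x1. Qed.

Lemma cutoffP f x : cutoff f x = if 1 <= x then f x else 0.
Proof. by case: leP => h; [rewrite cutoff_in|rewrite cutoff_out]. Qed.

Lemma measurable_cutoff (f : R -> R) : measurable_fun `[1%R : R, +oo[ f -> measurable_fun setT (cutoff f).
Proof. by move=> mf; apply/(measurable_restrictT _ _).1. Qed.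

Lemma L2norm_sqrE (F : R -> R[i]) : (L2norm F ^+ 2 =
  \int[mu]_x (cutoff (fun x => complex.Re (F x)) x ^+ 2 + cutoff (fun x => complex.Im (F x)) x ^+ 2)%:E)%E.
Proof.
have -> : (L2norm F ^+ 2 = L2norm F `^ 2)%E.
  have : (0 <= L2norm F)%E by exact: Lnorm_ge0.
  case: (L2norm F) => [z| |]//; last by rewrite poweRyr.
  by rewrite lee_fin => z0; rewrite poweR_EFin powR_mulrn.
rewrite /L2norm poweR_Lnorm//; apply: eq_integral => x _.
rewrite patchE; case: (boolP (x \in _)) => [|xn].
  rewrite inE/= in_itv/= andbT => x1; rewrite !cutoff_in// -cmod_sqr.
  by rewrite /= powR_mulrn ?normr_ge0// ger0_norm ?cmod_ge0.
move: xn; rewrite notin_setE/= in_itv/= andbT => /negP; rewrite -ltNge => x1.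
by rewrite !cutoff_out// expr0n/= addr0 normr0 powR0.
Qed.

Lemma in_L2_sqint (F : R -> R[i]) : in_L2 F ->
  sqint mu (cutoff (fun x => complex.Re (F x))) /\ sqint mu (cutoff (fun x => complex.Im (F x))).
Proof.
move=> [/measurable_cutoff mr /measurable_cutoff mi F2].
have H : (\int[mu]_x (cutoff (fun x => complex.Re (F x)) x ^+ 2 + cutoff (fun x => complex.Im (F x)) x ^+ 2)%:E < +oo)%E.
  rewrite -L2norm_sqrE.
  by rewrite -(@fineK _ (L2norm F)) ?EFin_expe ?ltry// ge0_fin_numE// Lnorm_ge0.
move: mr mi H; set r := cutoff _; set i := cutoff _ => mr mi H.
split; split=> //; apply/integrableP; split.
- by apply/measurable_EFinP; exact: measurable_funX.
- apply: le_lt_trans H; apply: ge0_le_integral => //.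
  + by apply/measurable_EFinP; apply: measurableT_comp => //; exact: measurable_funX.
  + by apply/measurable_EFinP; apply: measurable_funD; exact: measurable_funX.
  + by move=> x _ /=; rewrite lee_fin ger0_norm ?sqr_ge0// lerDl sqr_ge0.
- by apply/measurable_EFinP; exact: measurable_funX.
- apply: le_lt_trans H; apply: ge0_le_integral => //.
  + by apply/measurable_EFinP; apply: measurableT_comp => //; exact: measurable_funX.
  + by apply/measurable_EFinP; apply: measurable_funD; exact: measurable_funX.
  + by move=> x _ /=; rewrite lee_fin ger0_norm ?sqr_ge0// lerDr sqr_ge0.
Qed.

Lemma inv_succn_cvg_at_right : ((j.+1%:R^-1 : R) @[j --> \oo] --> (0 : R)^'+).
Proof.
move=> A [e /= e0 he]; have /cvgrPdist_lt/(_ e e0) := @cvg_harmonic R.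
apply: filterS => j /= hj; exact: he.
Qed.

Lemma jump_moments (a : nat -> R[i]) (F : R -> R[i]) :
  hausdorff_condition a -> is_jump_function a F -> in_L2 F ->
  forall n, ip mu (inv_power n.+1) (cutoff (fun x => complex.Re (F x))) = complex.Re (a n) /\
            ip mu (inv_power n.+1) (cutoff (fun x => complex.Im (F x))) = complex.Im (a n).
Proof.
move=> /hausdorff_moment_energy[C C0 aC] [f [fseries fhol fjump]] /in_L2_sqint[sr si] n.
pose u := durrmeyer (fun n => complex.Re (a n)); pose v := durrmeyer (fun n => complex.Im (a n)).
have u2 := energy_sqr (fun n => (aC n).1); have v2 := energy_sqr (fun n => (aC n).2).
have um := @durrmeyer_moment_cvg R (fun n => complex.Re (a n)).
have vm := @durrmeyer_moment_cvg R (fun n => complex.Im (a n)).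
pose eta (j : nat) : R := j.+1%:R^-1.
have e0 j : 0 < eta j by rewrite invr_gt0.
have eR : eta j @[j --> \oo] --> (0 : R)^'+ by exact: inv_succn_cvg_at_right.
have ecvg : eta j @[j --> \oo] --> (0 : R) by apply: cvg_trans eR _; exact: cvg_within.
(* The jump relation is known for x > 1 and the decay of the Poisson integrals for x < 1; the point
   1 is a null set. *)
have one_null : {ae mu, forall x : R, x != 1}.
  exists [set 1]; split => //; first exact: lebesgue_measure_set1.
  by move=> x /=; move/negP; rewrite negbK => /eqP ->.
have aeF : Filter (almost_everywhere mu) by exact: ae_filter_ringOfSetsType.
have lim_re : {ae mu, forall x, limit_form u (poisson_kernel x (eta j)) @[j --> \oo] -->
    cutoff (fun x => complex.Re (F x)) x} /\ {ae mu, forall x,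
    limit_form v (poisson_kernel x (eta j)) @[j --> \oo] -->
    cutoff (fun x => complex.Im (F x)) x}.
  suff H : {ae mu, forall x, limit_form u (poisson_kernel x (eta j)) @[j --> \oo] -->
    cutoff (fun x => complex.Re (F x)) x /\
    limit_form v (poisson_kernel x (eta j)) @[j --> \oo] -->
    cutoff (fun x => complex.Im (F x)) x}.
    by split; apply: (@filterS _ _ aeF _ _ _ H) => x [].
  apply: (@filterS2 _ _ aeF _ _ _ _ one_null fjump) => x x1 Hx.
  have [xlt|xge] := ltP x 1.
    rewrite !cutoff_out//; split; first exact: (poisson_below_one_cvg u2 um xlt e0 ecvg).
    (* The lemma speaks of the real parts of a complex sequence; the imaginary parts are fed to it
       as such a sequence. *)
    have := @poisson_below_one_cvg R (fun n => (complex.Im (a n))%:C) v C v2 vm x eta xlt e0 ecvg.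
    exact.
  have {x1 xge}xgt : 1 < x by rewrite lt_def x1.
  have [fp [fm [hp hm Fx]]] := Hx xgt.
  rewrite !cutoff_in ?(ltW xgt)// Fx.
  have x0 : 0 < x by rewrite (lt_trans _ xgt).
  have J j := jump_poisson u2 um v2 vm x0 (e0 j) fseries fhol.
  have hp' : f (x +i* eta j) @[j --> \oo] --> (fp : R[i]^o) 
    by exact: (@cvg_comp _ _ _ eta (fun e => f (x +i* e)) _ _ _ eR hp).
  have hm' : f (x -i* eta j) @[j --> \oo] --> (fm : R[i]^o) 
    by exact: (@cvg_comp _ _ _ eta (fun e => f (x -i* e)) _ _ _ eR hm).
  have H e : 0 < e -> \forall j \near \oo, cmod ((- 'i * (fp - fm)) -
     (limit_form u (poisson_kernel x (eta j)) +i* limit_form v (poisson_kernel x (eta j)))) < e.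
    move=> e00; have e20 : 0 < (e / 2)%:C :> R[i] by rewrite ltcR divr_gt0.
    move/(cvgrPdist_lt (V := R[i]^o)): hp' => /(_ _ e20) Hp.
    move/(cvgrPdist_lt (V := R[i]^o)): hm' => /(_ _ e20) Hm.
    near=> j; rewrite -J -mulrBr cmodM.
    have -> : cmod (- 'i : R[i]) = 1 by rewrite cmodN cmodi.
    rewrite mul1r (_ : _ - _ = (fp - f (x +i* eta j)) - (fm - f (x -i* eta j))); last by ring.
    rewrite (le_lt_trans (cmodB _ _))// (splitr e) ltrD// -ltcR.
      by near: j.
    by near: j.
  split; apply/cvgrPdist_lt => e /H; apply: filterS => j; apply: le_lt_trans.
    by apply: le_trans (le_Re_cmod _); rewrite cReB.
  by apply: le_trans (le_Im_cmod _); rewrite cImB.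
split; [have := lim_re.1|have := lim_re.2] => H.
  exact: (boundary_moments C0 (fun n => (aC n).1) sr H).
exact: (boundary_moments C0 (fun n => (aC n).2) si H).
Unshelve. all: by end_near. Qed.

End Moments.

(** * Laguerre functions *)

Section InverseExponential.
Context {R : realType}.
Local Notation mu := (@lebesgue_measure R).
Implicit Types (x c d : R) (k : nat).

(* Extended by 0 to x <= 0, so that inner products over the line are those of
   L^2(0, +oo). *)
Definition inv_exp c k x : R := if 0 < x then x^-1 ^+ k * expR (- (c / x)) else 0.

Lemma inv_exp_pos c k x : 0 < x -> inv_exp c k x = x^-1 ^+ k * expR (- (c / x)).
Proof. by rewrite /inv_exp => ->. Qed.

Lemma inv_exp_npos c k x : x <= 0 -> inv_exp c k x = 0.
Proof. by rewrite /inv_exp leNgt => /negbTE ->. Qed.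

Lemma inv_exp_ge0 c k x : 0 <= inv_exp c k x.
Proof.
rewrite /inv_exp; case: ifP => // x0.
by rewrite mulr_ge0 ?expR_ge0// exprn_ge0// invr_ge0 ltW.
Qed.

Lemma inv_expM c d k l x : inv_exp c k x * inv_exp d l x = inv_exp (c + d) (k + l) x.
Proof.
rewrite /inv_exp; case: ifP => // _; last by rewrite mulr0.
by rewrite mulrACA -expRD -exprD; congr (_ * expR _); ring.
Qed.

(** From e^y >= y^(k+1) / (k+1)! at y = c/x; the bound linear in x yields the limit 0 at the
    origin. *)
Lemma inv_exp_le c k x : 0 < c -> 0 <= x -> inv_exp c k x <= k.+1`!%:R / c ^+ k.+1 * x.
Proof.
move=> c0; rewrite le_eqVlt => /predU1P[<-|x0]; first by rewrite inv_exp_npos ?lexx// mulr0.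
rewrite inv_exp_pos// expRN.
have cx : 0 < c / x by rewrite divr_gt0.
have h := expR_ge1Dxn k (ltW cx).
have f0 : 0 < (k.+1)`!%:R :> R by rewrite ltr0n fact_gt0.
have h2 : (c / x) ^+ k.+1 / k.+1`!%:R <= expR (c / x) by apply: le_trans h; rewrite lerDr.
rewrite ler_pdivrMr ?expR_gt0//.
have p0 : 0 <= k.+1`!%:R / c ^+ k.+1 * x by rewrite mulr_ge0 ?ltW// divr_gt0 ?exprn_gt0.
apply: le_trans (ler_wpM2l p0 h2); rewrite le_eqVlt; apply/orP; left; apply/eqP.
rewrite [(c / x) ^+ _]exprMn [c ^+ _]exprS [x^-1 ^+ k.+1]exprS.
have cn : c ^+ k != 0 by rewrite expf_neq0 ?gt_eqF.
move: (x^-1 ^+ k) (c ^+ k) cn => X D D0.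
by field; rewrite D0 !gt_eqF.
Qed.

Lemma is_derive_inv_exp c k x : 0 < x ->
  is_derive x 1 (inv_exp c k) (c * inv_exp c k.+2 x - k%:R * inv_exp c k.+1 x).
Proof.
move=> x0.
have xn0 : x != 0 by rewrite gt_eqF.
pose F (x : R) := x^-1 ^+ k * expR (- c * x^-1).
have near_eq : {near x, F =1 inv_exp c k}.
  near=> y; rewrite /F inv_exp_pos ?mulNr//.
  by near: y; exact: lt_nbhsr.
apply: near_eq_is_derive near_eq _ => //.
pose V (x : R) : R := x^-1.
have hV : is_derive x 1 V (- x ^- 2).
  by have := is_deriveV xn0 (is_derive_id x 1); rewrite /GRing.scale/= mulr1.
have h1 := is_deriveX k hV.
have hW : is_derive x 1 (fun x => - c *: V x) (- c *: - x ^- 2) by exact: is_deriveZ.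
have h2 := @is_derive1_comp _ expR (fun x => - c *: V x) x _ _ (is_derive_expR _) hW.
have VE y : (V ^+ k) y = y^-1 ^+ k.
  by elim: (k) => // l IH; rewrite !exprS -IH.
have FE : F = V ^+ k * (expR \o (fun x => - c *: V x)).
  apply/funext => y; rewrite /F /GRing.mul/= /GRing.scale/=; by rewrite -VE.
rewrite FE; apply: (is_derive_eq (is_deriveM h1 h2)).
rewrite VE !inv_exp_pos// /GRing.scale/= /V -mulNr.
move: (expR _) => E; rewrite -exprVn.
move: {hV hW h1 h2 FE VE} (x^-1) => y.
case: (k) => [|l] /=; first by rewrite expr0 mul0r; ring.
by rewrite !exprS; move: (y ^+ l) => Y; ring.
Unshelve. all: by end_near. Qed.

Lemma inv_exp_cvg0 c k : 0 < c -> inv_exp c k x @[x --> (0 : R)^'+] --> (0 : R).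
Proof.
move=> c0; pose K : R := k.+1`!%:R / c ^+ k.+1.
apply: (@squeeze_cvgr _ _ _ _ (fun=> 0) (fun x => K * x)).
- near=> x; rewrite inv_exp_ge0 inv_exp_le// ltW//.
- exact: cvg_cst.
rewrite -[X in _ --> X](mulr0 K); apply: cvgMr.
by apply: cvg_at_right_filter; exact: cvg_id.
Unshelve. all: by end_near. Qed.

Lemma cvgy_inv : ((x : R)^-1 @[x --> +oo%R] --> (0 : R)).
Proof.
by apply/gtr0_cvgV0; [exists 0; split => //|exact: cvg_id].
Qed.

Lemma inv_exp_cvgy c k : inv_exp c k x @[x --> +oo%R] --> ((k == 0)%:R : R).
Proof.
have h1 : x^-1 ^+ k * expR (- c * x^-1) @[x --> +oo%R] --> (0 : R) ^+ k * expR (- c * 0).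
  apply: cvgM; first by apply: (@cvg_comp _ _ _ _ (fun y : R => y ^+ k) _ _ _ cvgy_inv); exact: exprn_continuous.
  apply: (@cvg_comp _ _ _ (fun x : R => - c * x^-1) expR _ (nbhs (- c * 0))).
    by apply: cvgMr; exact: cvgy_inv.
  exact: continuous_expR.
rewrite mulr0 expR0 mulr1 expr0n in h1.
apply: cvg_trans h1; apply: near_eq_cvg; near=> x; rewrite inv_exp_pos ?mulNr//.
Unshelve. all: by end_near. Qed.

(** The substitution u = 1/x would give a Gamma integral; the primitive is instead built by
    recursion, since x^-(k+1) e^(-c/x) has derivative c x^-(k+3) e^(-c/x) - (k+1) x^-(k+2)
    e^(-c/x). *)
Lemma inv_exp_primitive c k : 0 < c -> exists A : R -> R,
  [/\ forall x, 0 < x -> is_derive x 1 A (inv_exp c k.+2 x),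
      A x @[x --> +oo%R] --> k`!%:R / c ^+ k.+1, A 0 = 0 &
      A x @[x --> (0 : R)^'+] --> (0 : R)].
Proof.
move=> c0; have cn0 : c != 0 by rewrite gt_eqF.
elim: k => [|k [A [A1 A2 A3 A4]]].
  exists (fun x => c^-1 *: inv_exp c 0 x); split.
  - move=> x x0; apply: (is_derive_eq (is_deriveZ _ (is_derive_inv_exp c 0 x0))).
    by rewrite /GRing.scale/= mul0r subr0 mulKf.
  - by rewrite fact0 expr1; rewrite mulrC; apply: cvgMr; exact: inv_exp_cvgy.
  - by rewrite inv_exp_npos// scaler0.
  - by rewrite -[X in _ --> X](mulr0 c^-1); apply: cvgMr; exact: inv_exp_cvg0.
exists (fun x => c^-1 *: (inv_exp c k.+1 x + k.+1%:R *: A x)); split.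
- move=> x x0.
  apply: (is_derive_eq (is_deriveZ _ (is_deriveD (is_derive_inv_exp c k.+1 x0) (is_deriveZ _ (A1 x x0))))).
  by rewrite /GRing.scale/= subrK mulKf.
- have -> : (k.+1)`!%:R / c ^+ k.+2 = c^-1 * (0 + k.+1%:R * (k`!%:R / c ^+ k.+1)) :> R.
    by rewrite factS natrM exprS; field; rewrite cn0 expf_neq0.
  by apply: cvgMr; apply: cvgD; [exact: inv_exp_cvgy|apply: cvgMr].
- by rewrite inv_exp_npos// A3 !scaler0 addr0 scaler0.
- rewrite -[X in _ --> X](mulr0 c^-1); apply: cvgMr; rewrite -[X in _ --> X](addr0 0); apply: cvgD.
    exact: inv_exp_cvg0.
  by rewrite -[X in _ --> X](mulr0 k.+1%:R); apply: cvgMr.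
Qed.

Lemma inv_exp_patch c k : (fun x => (inv_exp c k x)%:E) = (fun x => (inv_exp c k x)%:E) \_ `[0, +oo[.
Proof.
apply/funext => x; rewrite patchE; case: ifPn => //.
rewrite notin_setE/= in_itv/= andbT => /negP; rewrite -ltNge => /ltW x0.
by rewrite inv_exp_npos.
Qed.

Lemma integral_inv_exp c k : 0 < c ->
  (\int[mu]_x (inv_exp c k.+2 x)%:E = (k`!%:R / c ^+ k.+1)%:E)%E.
Proof.
move=> c0; have [A [A1 A2 A3 A4]] := inv_exp_primitive k c0.
rewrite inv_exp_patch -integral_mkcond (@ge0_continuous_FTC2y _ _ A _ (k`!%:R / c ^+ k.+1)).
- by rewrite A3 sube0.
- by move=> x _; exact: inv_exp_ge0.
- apply/continuous_within_itvcyP; split.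
    move=> x; rewrite in_itv/= andbT => x0.
    apply/differentiable_continuous/derivable1_diffP.
    by case: (is_derive_inv_exp c k.+2 x0).
  by rewrite inv_exp_npos//; exact: inv_exp_cvg0.
- exact: A2.
- by move=> x x0; case: (A1 x x0).
- by rewrite A3.
- by move=> x; rewrite in_itv/= andbT => x0; rewrite derive1E; case: (A1 x x0).
Qed.

Lemma measurable_inv_exp c k : measurable_fun setT (inv_exp c k).
Proof.
rewrite (_ : inv_exp c k = inv_exp c k \_ `]0, +oo[).
  apply/(measurable_restrictT _ _).1 => //.
  apply: open_continuous_measurable_fun; first exact: interval_open.
  move=> x; rewrite inE/= in_itv/= andbT => x0.
  apply/differentiable_continuous/derivable1_diffP.
  by case: (is_derive_inv_exp c k x0).
apply/funext => x; rewrite patchE; case: ifPn => //.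
rewrite notin_setE/= in_itv/= andbT => /negP; rewrite -leNgt => x0.
by rewrite inv_exp_npos.
Qed.

Lemma integrable_inv_exp c k : 0 < c -> mu.-integrable setT (EFin \o inv_exp c k.+2).
Proof.
move=> c0; apply/integrableP; split; first by apply/measurable_EFinP; exact: measurable_inv_exp.
rewrite (_ : (fun x => _) = (fun x => (inv_exp c k.+2 x)%:E)).
  by rewrite integral_inv_exp// ltry.
by apply/funext => x /=; rewrite ger0_norm// inv_exp_ge0.
Qed.

Lemma sqint_inv_exp c k : 0 < c -> sqint mu (inv_exp c k.+1).
Proof.
move=> c0; split; first exact: measurable_inv_exp.
rewrite (_ : (fun x => _) = inv_exp (c + c) (k + k).+2).
  by apply: integrable_inv_exp; rewrite addr_gt0.
by apply/funext => x; rewrite expr2 inv_expM addSn addnS.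
Qed.

Lemma ip_inv_exp c d j k : 0 < c -> 0 < d ->
  ip mu (inv_exp c j.+1) (inv_exp d k.+1) = (j + k)`!%:R / (c + d) ^+ (j + k).+1.
Proof.
move=> c0 d0; rewrite /ip; under eq_Rintegral do rewrite inv_expM addSn addnS.
by rewrite /Rintegral integral_inv_exp// addr_gt0.
Qed.

End InverseExponential.

(** * Finite differences of binomial coefficients *)

Section BinomialDifference.
Context {R : comRingType}.

Lemma binomial_difference_succ (f : nat -> R) m :
  \sum_(k < m.+2) (-1) ^+ k * 'C(m.+1, k)%:R * f k =
  \sum_(k < m.+1) (-1) ^+ k * 'C(m, k)%:R * (f k - f k.+1).
Proof.
rewrite big_ord_recl/= bin0.
under eq_bigr => i _ do rewrite /bump/= add1n binS natrD mulrDr mulrDl.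
rewrite big_split/= addrA expr0 !mul1r.
have -> : f 0 + \sum_(i < m.+1) (-1) ^+ i.+1 * 'C(m, i.+1)%:R * f i.+1 =
   \sum_(k < m.+1) (-1) ^+ k * 'C(m, k)%:R * f k.
  rewrite big_ord_recr/= bin_small// mulr0 mul0r addr0 [RHS]big_ord_recl bin0 expr0 !mul1r.
  by congr (_ + _); apply: eq_bigr => i _; rewrite /bump/= add1n.
rewrite -big_split/=; apply: eq_bigr => i _; rewrite exprS; ring.
Qed.

(** By Pascal's rule each difference in the upper index lowers j by one; after more than j
    differences nothing is left. *)
Lemma binomial_difference_bin m a j :
  \sum_(k < m.+1) (-1) ^+ k * 'C(m, k)%:R * 'C(a + k, j)%:R =
  (if (m <= j)%N then (-1) ^+ m * 'C(a, j - m)%:R else 0) :> R.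
Proof.
elim: m a j => [|m IH] a j.
  by rewrite big_ord1 bin0 expr0 !mul1r addn0 subn0.
rewrite (@binomial_difference_succ (fun k => 'C(a + k, j)%:R)).
case: j => [|j].
  by rewrite big1// => k _; rewrite !bin0 subrr mulr0.
transitivity (- \sum_(k < m.+1) (-1) ^+ k * 'C(m, k)%:R * 'C(a + k, j)%:R : R).
  rewrite -sumrN; apply: eq_bigr => k _; rewrite addnS binS natrD; ring.
by rewrite IH ltnS subSS exprS; case: ifP => _; rewrite ?oppr0// mulN1r mulNr.
Qed.

End BinomialDifference.

(** * Orthonormality and Parseval's identity for the Laguerre functions *)

Section LaguerreFunctions.
Context {R : realType}.
Local Notation mu := (@lebesgue_measure R).
Implicit Types (G H : R -> R) (m n k : nat).

Definition laguerre_fn m (x : R) : R := Num.sqrt 2 * (laguerre m).[2 / x] * inv_exp 1 1 x.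
Local Notation psi := laguerre_fn.

Let lcoef m k : R := Num.sqrt 2 * ((-1) ^+ k * 'C(m, k)%:R / k`!%:R) * 2 ^+ k.

Lemma laguerre_fnE m x : psi m x = \sum_(k < m.+1) lcoef m k * inv_exp 1 k.+1 x.
Proof.
rewrite /laguerre_fn; have [x0|x0] := leP x 0.
  by rewrite inv_exp_npos// mulr0 big1// => k _; rewrite inv_exp_npos// mulr0.
rewrite (horner_coef_wide _ (size_poly _ _)) mulr_sumr mulr_suml.
apply: eq_bigr => k _; rewrite coef_poly ltn_ord !inv_exp_pos// exprMn /lcoef expr1 exprS.
move: (expR (- (1 / x))) => E; move: (x^-1) => y; ring.
Qed.

Lemma sqint_laguerre_fn m : sqint mu (psi m).
Proof.
rewrite (_ : psi m = fun x => \sum_(k < m.+1) lcoef m k * inv_exp 1 k.+1 x); last first.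
  by apply/funext => x; exact: laguerre_fnE.
apply: (@sqint_sum _ _ R mu m.+1 (fun k x => lcoef m k * inv_exp 1 k.+1 x)) => k.
by apply: sqintZ; exact: sqint_inv_exp.
Qed.

Lemma ip_laguerre_fnl m G : sqint mu G ->
  ip mu (psi m) G = \sum_(k < m.+1) lcoef m k * ip mu (inv_exp 1 k.+1) G.
Proof.
move=> sG; rewrite (_ : psi m = fun x => \sum_(k < m.+1) lcoef m k * inv_exp 1 k.+1 x); last first.
  by apply/funext => x; exact: laguerre_fnE.
rewrite (@ip_suml _ _ R mu m.+1 (fun k x => lcoef m k * inv_exp 1 k.+1 x))//.
  by apply: eq_bigr => k _; rewrite ipZl//; exact: sqint_inv_exp.
by move=> k; apply: sqintZ; exact: sqint_inv_exp.
Qed.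

(** The Gamma integrals turn the sum into the m-th difference of k |-> C(j + k, j). The factor C(j,
    m) expresses orthogonality to the powers j < m. *)
Lemma ip_laguerre_fn_power m j : ip mu (psi m) (inv_exp 1 j.+1) =
  Num.sqrt 2 * j`!%:R / 2 ^+ j.+1 * (-1) ^+ m * 'C(j, m)%:R.
Proof.
rewrite ip_laguerre_fnl; last exact: sqint_inv_exp.
have f0 k : (k`!%:R : R) != 0 by rewrite pnatr_eq0 -lt0n fact_gt0.
have p0 k : (2 : R) ^+ k != 0 by rewrite expf_neq0.
transitivity (Num.sqrt 2 * j`!%:R / 2 ^+ j.+1 *
   \sum_(k < m.+1) (-1) ^+ k * 'C(m, k)%:R * 'C(j + k, j)%:R : R).
  rewrite mulr_sumr; apply: eq_bigr => k _; rewrite ip_inv_exp// /lcoef.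
  have -> : ((k + j)`!%:R : R) = 'C(j + k, j)%:R * (j`!%:R * k`!%:R).
    by rewrite -!natrM addnC -(bin_fact (leq_addr k j)) addKn.
  rewrite (_ : 1 + 1 = 2 :> R)// -addnS exprD.
  move: (p0 k) (f0 k) (p0 j.+1); move: (2 ^+ k) (2 ^+ j.+1) ((-1) ^+ k) => x y z x0 k0 y0.
  by field; rewrite x0 y0 k0.
rewrite binomial_difference_bin; case: leqP => mj; last by rewrite bin_small// !mulr0.
by rewrite bin_sub// mulrA.
Qed.

(** Expanding the function of smaller index l, only its top power j = l can meet psi_m, and only
    when m = l. *)
Lemma ip_laguerre_fn m l : ip mu (psi m) (psi l) = (m == l)%:R.
Proof.
wlog lm : m l / (l <= m)%N.
  move=> W; have [/W//|/ltnW/W] := leqP l m.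
  by rewrite ipC eq_sym.
rewrite ipC ip_laguerre_fnl; last exact: sqint_laguerre_fn.
have f0 k : (k`!%:R : R) != 0 by rewrite pnatr_eq0 -lt0n fact_gt0.
have p0 k : (2 : R) ^+ k != 0 by rewrite expf_neq0.
have termE (j : nat) : lcoef l j * ip mu (inv_exp 1 j.+1) (psi m) =
   (-1) ^+ j * 'C(l, j)%:R * ((-1) ^+ m * 'C(j, m)%:R).
  rewrite ipC ip_laguerre_fn_power /lcoef exprS.
  have s2 : Num.sqrt 2 * Num.sqrt 2 = 2 :> R by rewrite -expr2 sqr_sqrtr.
  move: s2 (p0 j) (f0 j); move: (Num.sqrt 2) (2 ^+ j) ((-1) ^+ j) ((-1) ^+ m) => s x z w s2 x0 j0.
  rewrite [LHS](_ : _ = (s * s / 2) * (z * 'C(l, j)%:R * (w * 'C(j, m)%:R))).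
    by rewrite s2 divff// mul1r.
  by field; rewrite x0 j0.
under eq_bigr do rewrite termE.
rewrite big_ord_recr/= big1 ?add0r; last first.
  by move=> j _; rewrite (@bin_small j) ?mulr0// (leq_trans _ lm).
rewrite binn mulr1; have [->|ml] := eqVneq m l.
  by rewrite binn mulr1 -exprD addnn -mul2n exprM sqrrN !expr1n.
by rewrite bin_small ?mulr0// ltn_neqAle eq_sym ml.
Qed.

(** Binomial theorem. The coefficients are geometric in m, so that the Parseval sum can be evaluated
    in closed form. *)
Lemma ip_laguerre_fn_exp m c : 0 < c -> ip mu (inv_exp c 1) (psi m) =
  Num.sqrt 2 / (1 + c) * (1 - 2 / (1 + c)) ^+ m.
Proof.
move=> c0; rewrite ipC ip_laguerre_fnl; last exact: sqint_inv_exp.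
have d0 : 1 + c != 0 by rewrite gt_eqF// addr_gt0.
rewrite exprBn mulr_sumr; apply: eq_bigr => k _.
rewrite ip_inv_exp// addn0 expr1n mulr1 /lcoef -[_ *+ 'C(m, k)]mulr_natr exprMn exprVn exprS.
have f0 : (k`!%:R : R) != 0 by rewrite pnatr_eq0 -lt0n fact_gt0.
have dk : (1 + c) ^+ k != 0 by rewrite expf_neq0.
move: d0 dk; move: ((1 + c) ^+ k) (2 ^+ k) ((-1) ^+ k) => x y z; move: (1 + c) => w w0 x0.
by field; rewrite w0 x0 f0.
Qed.

Definition projection n G (x : R) : R := \sum_(m < n) ip mu G (psi m) * psi m x.
(** By [defectE] this is the squared distance of G from the span of the first n Laguerre
    functions. *)
Definition defect n G : R := ip mu G G - \sum_(m < n) ip mu G (psi m) ^+ 2.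

Lemma ip_sub_laguerre n G (b : nat -> R) : sqint mu G ->
  ip mu (fun x => G x - \sum_(m < n) b m * psi m x) (fun x => G x - \sum_(m < n) b m * psi m x) =
  ip mu G G - 2 * \sum_(m < n) b m * ip mu G (psi m) + \sum_(m < n) b m ^+ 2.
Proof.
move=> sG.
have sb m : sqint mu (fun x => b m * psi m x) by apply: sqintZ; exact: sqint_laguerre_fn.
have sS : sqint mu (fun x => \sum_(m < n) b m * psi m x) by exact: (@sqint_sum _ _ R mu n _ sb).
rewrite ip_sqrB//; congr (_ - 2 * _ + _).
  rewrite ipC (@ip_suml _ _ R mu n _ _ sb)//; apply: eq_bigr => m _.
  by rewrite ipZl// 1?ipC//; exact: sqint_laguerre_fn.
rewrite (@ip_suml _ _ R mu n _ _ sb)//; apply: eq_bigr => m _.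
rewrite ipZl//; last exact: sqint_laguerre_fn.
rewrite ipC (@ip_suml _ _ R mu n _ _ sb); last exact: sqint_laguerre_fn.
rewrite (bigD1 m)//= big1 ?addr0.
  by rewrite ipZl ?ip_laguerre_fn ?eqxx ?mulr1//; exact: sqint_laguerre_fn.
move=> l lm; rewrite ipZl; [|exact: sqint_laguerre_fn..].
by rewrite ip_laguerre_fn (_ : (_ == _) = false) ?mulr0//; exact/negbTE.
Qed.

Lemma defectE n G : sqint mu G ->
  defect n G = ip mu (fun x => G x - projection n G x) (fun x => G x - projection n G x).
Proof.
move=> sG; rewrite /projection (@ip_sub_laguerre n G (fun m => ip mu G (psi m)))//.
rewrite /defect; under [X in _ - 2 * X + _]eq_bigr do rewrite -expr2.
by move: (\sum_(_ < _) _) => z; ring.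
Qed.

Lemma defect_ge0 n G : sqint mu G -> 0 <= defect n G.
Proof. by move=> sG; rewrite defectE// ip_ge0. Qed.

Lemma defect_le n G : defect n G <= ip mu G G.
Proof. by rewrite /defect gerBl sumr_ge0// => i _; rewrite sqr_ge0. Qed.

Lemma defect_noninc n k G : (n <= k)%N -> defect k G <= defect n G.
Proof.
move=> nk; rewrite /defect lerD2l lerN2 -(subnKC nk) big_split_ord/= lerDl.
by apply: sumr_ge0 => i _; rewrite sqr_ge0.
Qed.

Lemma sqint_projection n G : sqint mu (projection n G).
Proof.
apply: (@sqint_sum _ _ R mu n (fun m x => ip mu G (psi m) * psi m x)) => m.
by apply: sqintZ; exact: sqint_laguerre_fn.
Qed.

Lemma defectB n G H : sqint mu G -> sqint mu H ->
  defect n (fun x => G x - H x) <= 2 * defect n G + 2 * defect n H.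
Proof.
move=> sG sH; have sGH := sqintB sG sH; rewrite !defectE//.
have -> : (fun x => G x - H x - projection n (fun x => G x - H x) x) =
    (fun x => (G x - projection n G x) - (H x - projection n H x)).
  apply/funext => x.
  rewrite (_ : projection n (fun x => G x - H x) x = projection n G x - projection n H x).
    by ring.
  rewrite /projection -sumrB; apply: eq_bigr => m _.
  by rewrite ipBl// ?mulrBl//; exact: sqint_laguerre_fn.
by apply: ip_sqrB_le; apply: sqintB => //; exact: sqint_projection.
Qed.

Lemma defectZ n G (c : R) : sqint mu G -> defect n (fun x => c * G x) = c ^+ 2 * defect n G.
Proof.
move=> sG; have scG := sqintZ c sG.
rewrite /defect ipZl// ipC ipZl// mulrBr mulr_sumr expr2 mulrA; congr (_ - _).
by apply: eq_bigr => m _; rewrite ipZl; [ring|by []|exact: sqint_laguerre_fn].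
Qed.

Definition parseval G : Prop := forall e : R, 0 < e -> exists n, defect n G <= e.

Lemma parsevalZ G (c : R) : sqint mu G -> parseval G -> parseval (fun x => c * G x).
Proof.
move=> sG pG e e0.
have c1 : 0 < 1 + c ^+ 2 by rewrite ltr_pwDl// sqr_ge0.
have [n hn] := pG (e / (1 + c ^+ 2)) (divr_gt0 e0 c1); exists n.
rewrite defectZ// (le_trans (ler_wpM2l (sqr_ge0 c) hn))//.
by rewrite mulrCA (ler_piMr (ltW e0))// ler_pdivrMr// mul1r lerDr.
Qed.

Lemma parsevalB G H : sqint mu G -> sqint mu H -> parseval G -> parseval H ->
  parseval (fun x => G x - H x).
Proof.
move=> sG sH pG pH e e0; have e4 : 0 < e / 4 by rewrite divr_gt0.
have [n hn] := pG _ e4; have [k hk] := pH _ e4; exists (maxn n k).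
have := defectB (maxn n k) sG sH.
have := defect_noninc G (leq_maxl n k); have := defect_noninc H (leq_maxr n k); lra.
Qed.

Lemma parsevalD G H : sqint mu G -> sqint mu H -> parseval G -> parseval H ->
  parseval (fun x => G x + H x).
Proof.
move=> sG sH pG pH; rewrite (_ : (fun x => _) = (fun x => G x - (-1) * H x)).
  by apply: parsevalB => //; [exact: sqintZ|exact: parsevalZ].
by apply/funext => x; rewrite mulN1r opprK.
Qed.

Lemma parseval_sum (n : nat) (F : nat -> R -> R) : (forall i, sqint mu (F i)) ->
  (forall i, parseval (F i)) -> parseval (fun x => \sum_(i < n) F i x).
Proof.
move=> sF pF; elim: n => [|n IH].
  rewrite (_ : (fun x => _) = (fun x => 0 * F 0 x)); first exact: parsevalZ.
  by apply/funext => x; rewrite big_ord0 mul0r.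
rewrite (_ : (fun x => _) = (fun x => \sum_(i < n) F i x + F n x)).
  by apply: parsevalD => //; exact: (@sqint_sum _ _ R mu n F).
by apply/funext => x; rewrite big_ord_recr.
Qed.

Lemma parseval_limit G : sqint mu G ->
  (forall e : R, 0 < e -> exists H, [/\ sqint mu H, parseval H &
     ip mu (fun x => G x - H x) (fun x => G x - H x) <= e]) -> parseval G.
Proof.
move=> sG GH e e0; have e4 : 0 < e / 4 by rewrite divr_gt0.
have [H [sH pH hH]] := GH _ e4; have [n hn] := pH _ e4; exists n.
have sGH := sqintB sG sH.
have := @defectB n (fun x => G x - H x) (fun x => (-1) * H x) sGH (sqintZ (-1) sH).
rewrite (_ : (fun x => _ - _) = G); last by apply/funext => x; ring.
have := defect_le n (fun x => G x - H x).
by rewrite defectZ// sqrrN expr1n mul1r; lra.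
Qed.

(** The defect equals q^n / (2 c) with q = ((c - 1) / (c + 1))^2 < 1. *)
Lemma parseval_exp c : 0 < c -> parseval (inv_exp c 1).
Proof.
move=> c0 e e0.
pose q := (1 - 2 / (1 + c)) ^+ 2.
have d0 : 0 < 1 + c by rewrite addr_gt0.
have q1 : q < 1.
  rewrite /q -subr_gt0 (_ : 1 - _ = 4 * c / (1 + c) ^+ 2).
    by rewrite divr_gt0 ?mulr_gt0// exprn_gt0.
  by field; rewrite gt_eqF.
have q0 : 0 <= q by rewrite sqr_ge0.
have defE n : defect n (inv_exp c 1) = (2 * c)^-1 * q ^+ n.
  rewrite /defect (ip_inv_exp 0 0)// addn0 fact0 expr1.
  under eq_bigr do rewrite ip_laguerre_fn_exp// exprMn -exprM mulnC exprM -/q.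
  rewrite -mulr_sumr.
  have -> : (Num.sqrt 2 / (1 + c)) ^+ 2 = (1 - q) * (2 * c)^-1.
    by rewrite exprMn sqr_sqrtr// /q; field; rewrite !gt_eqF.
  have g : (1 - q) * \sum_(i < n) q ^+ i = 1 - q ^+ n.
    by have := subrX1 q n; move: (\sum_(_ < _) _) => S; lra.
  rewrite mulrAC g (_ : c + c = 2 * c) ?div1r; last by ring.
  by move: (_^-1) (q ^+ n) => u w; ring.
have : (2 * c)^-1 * q ^+ n @[n --> \oo] --> (2 * c)^-1 * 0.
  by apply: cvgMr; apply: cvg_expr; rewrite ger0_norm.
rewrite mulr0 => /cvgrPdist_lt/(_ _ e0)[n _ /(_ n (leqnn n))].
rewrite sub0r normrN => h; exists n; rewrite defE ltW//.
exact: le_lt_trans (ler_norm _) h.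
Qed.

End LaguerreFunctions.

(** * Completeness *)

Section Clamp.
Context {R : realType}.
Implicit Types (lo hi x y : R).

Definition clamp lo hi y : R := Num.max lo (Num.min hi y).

Lemma clamp_itv lo hi y : lo <= hi -> lo <= clamp lo hi y <= hi.
Proof. by move=> h; rewrite /clamp le_max lexx ge_max h ge_min lexx. Qed.

Lemma clamp_id lo hi y : lo <= y <= hi -> clamp lo hi y = y.
Proof. by move=> /andP[h1 h2]; rewrite /clamp min_r// max_r. Qed.

Lemma clamp_lo lo hi y : lo <= hi -> y <= lo -> clamp lo hi y = lo.
Proof. by move=> h1 h2; rewrite /clamp max_l// ge_min h2 orbT. Qed.

Lemma clamp_hi lo hi y : lo <= hi -> hi <= y -> clamp lo hi y = hi.
Proof. by move=> h1 h2; rewrite /clamp min_l// max_r. Qed.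

Lemma continuous_clamp lo hi (f : R -> R) : continuous f -> continuous (fun x => clamp lo hi (f x)).
Proof.
move=> cf x; apply: (@continuous_max _ _ (cst lo) (fun x => Num.min hi (f x))).
  exact: cvg_cst.
by apply: (@continuous_min _ _ (cst hi) f); [exact: cvg_cst|exact: cf].
Qed.

Lemma clamp_lipschitz lo hi x y : lo <= hi -> `|clamp lo hi x - clamp lo hi y| <= `|x - y|.
Proof.
move=> h; wlog xy : x y / y <= x.
  move=> W; have [/W//|/ltW/W] := leP y x.
  by rewrite distrC [X in _ <= X -> _]distrC.
have D z : [\/ z <= lo /\ clamp lo hi z = lo, lo <= z <= hi /\ clamp lo hi z = z |
    hi <= z /\ clamp lo hi z = hi].
  have [zl|/ltW zl] := leP z lo; first by constructor 1; rewrite clamp_lo.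
  have [hz|/ltW hz] := leP hi z; first by constructor 3; rewrite clamp_hi.
  by constructor 2; rewrite clamp_id zl hz.
rewrite [leRHS]ger0_norm ?subr_ge0// ler_norml.
by case: (D x) => -[+ ->]; case: (D y) => -[+ ->]; lra.
Qed.

(** The truncated value lies between 0 and x, so the error of truncating G is dominated by G
    itself. *)
Lemma clamp_shrink (N x c : R) : 0 <= N -> 0 <= c <= 1 ->
  (x - clamp (- N) N x * c) ^+ 2 <= x ^+ 2.
Proof.
move=> n0 /andP[c0 c1].
have nn : - N <= N by lra.
have [x0|x0] := leP 0 x.
  have /andP[h1 h2] : 0 <= clamp (- N) N x <= x.
    have [Nx|/ltW xN] := leP N x; first by rewrite clamp_hi// n0.
    by rewrite clamp_id ?lexx ?x0// xN andbT (le_trans _ x0)// oppr_le0.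
  have h3 : clamp (- N) N x * c <= x by rewrite (le_trans _ h2)// ler_piMr.
  rewrite lerXn2r ?nnegrE ?subr_ge0// lerBlDr lerDl mulr_ge0//.
have /andP[h1 h2] : x <= clamp (- N) N x <= 0.
  have [Nx|/ltW xN] := leP x (- N); first by rewrite clamp_lo// Nx oppr_le0.
  by rewrite clamp_id ?lexx ?(ltW x0)// xN (le_trans (ltW x0)).
set y := _ * c.
have y0 : y <= 0 by rewrite mulr_le0_ge0.
have xy : x <= y by rewrite (le_trans h1)// ler_niMr.
rewrite -subr_ge0 (_ : _ - _ = y * (x + x - y)); last by ring.
by rewrite mulr_le0//; lra.
Qed.

End Clamp.

(** * Completeness for functions supported in [1, +oo) *)

Section Density.
Context {R : realType}.
Local Notation mu := (@lebesgue_measure R).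
Implicit Types (x : R).

(* With v = e^(-1/x), polynomials in v times e^(-1/x)/x are combinations of the
   functions e^(-k/x)/x with k >= 1, for which Parseval's identity is explicit. *)
Lemma parseval_compact_support (H : R -> R) (B : R) : 1 < B -> continuous H ->
  (forall x, x <= 1 -> H x = 0) -> (forall x, B <= x -> H x = 0) -> sqint mu H -> parseval H.
Proof.
move=> B1 cH H1 HB sH.
have B0 : 0 < B by rewrite (lt_trans _ B1).
pose lo : R := expR (- 1); pose hi : R := expR (- B^-1).
have lohi : lo <= hi by rewrite ler_expR lerN2 invf_le1// ltW.
have lo0 : 0 < lo by exact: expR_gt0.
have hi1 : hi < 1 by rewrite expR_lt1 oppr_lt0 invr_gt0.
(* The interval [lo, hi] is the image of [1, B] under x |-> e^(-1/x); clamping keeps ln away from 0,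
   so that h is continuous on the whole line. *)
pose w (v : R) := clamp lo hi v.
have wP v : lo <= w v <= hi by exact: clamp_itv.
have w0 v : 0 < w v by case/andP: (wP v) => h _; rewrite (lt_le_trans lo0).
have w1 v : w v < 1 by case/andP: (wP v) => _ h; rewrite (le_lt_trans h).
have ln0 v : ln (w v) < 0 by rewrite ln_lt0// w0 w1.
pose X (v : R) := - (ln (w v))^-1.
pose h (v : R) := X v * H (X v) / w v.
have cw : continuous w by exact: (@continuous_clamp R lo hi id (fun x => cvg_id)).
have cX : continuous X.
  move=> v; apply: cvgN; apply: cvgV; first by rewrite lt_eqF.
  by apply: (@cvg_comp _ _ _ w (@ln R) _ _ _ (cw v)); exact: continuous_ln.
have ch : continuous h.
  move=> v; apply: cvgM; last by apply: cvgV; [rewrite gt_eqF|exact: cw].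
  by apply: cvgM; [exact: cX|apply: (@cvg_comp _ _ _ X H _ _ _ (cX v)); exact: cH].
have HE x : 0 < x -> H x = inv_exp 1 1 x * h (expR (- x^-1)).
  move=> x0; rewrite inv_exp_pos// expr1 div1r.
  have [x1|x1] := leP x 1.
    rewrite H1// /h /X /w clamp_lo//; last first.
      by rewrite ler_expR lerN2 invf_ge1.
    by rewrite /lo expRK invrN invr1 opprK H1// mulr0 mul0r mulr0.
  have [xB|xB] := leP B x.
    rewrite HB// /h /X /w clamp_hi//; last first.
      by rewrite ler_expR lerN2 lef_pV2.
    by rewrite /hi expRK invrN invrK opprK HB// mulr0 mul0r mulr0.
  rewrite /h /X /w clamp_id; last first.
    by rewrite !ler_expR !lerN2 lef_pV2 ?posrE// (ltW xB) invf_le1// (ltW x1).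
  rewrite expRK invrN invrK opprK; have := expR_gt0 (- x^-1).
  by move: (expR _) => E E0; field; rewrite !gt_eqF.
apply: parseval_limit => // e e0.
pose d := Num.sqrt e.
have d0 : 0 < d by rewrite sqrtr_gt0.
have [p hp] := @weierstrass R h d d0 (continuous_subspaceT ch).
pose T x := \sum_(i < size p) p`_i * inv_exp i.+1%:R 1 x.
have sE (i : nat) : sqint mu (fun x => p`_i * inv_exp i.+1%:R 1 x).
  by apply: sqintZ; apply: sqint_inv_exp; rewrite ltr0n.
have TE x : 0 < x -> T x = inv_exp 1 1 x * p.[expR (- x^-1)].
  move=> x0; rewrite horner_coef mulr_sumr; apply: eq_bigr => i _.
  rewrite mulrCA; congr (_ * _); rewrite !inv_exp_pos// -mulrA -expRM_natl -expRD.
  by congr (_ * expR _); rewrite -natr1; ring.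
exists T; split.
- exact: (@sqint_sum _ _ R mu (size p) (fun i x => p`_i * inv_exp i.+1%:R 1 x)).
- apply: (@parseval_sum R (size p) (fun i x => p`_i * inv_exp i.+1%:R 1 x)) => // i.
  by apply: parsevalZ; [apply: sqint_inv_exp; rewrite ltr0n|apply: parseval_exp; rewrite ltr0n].
have sT : sqint mu T by exact: (@sqint_sum _ _ R mu (size p) (fun i x => p`_i * inv_exp i.+1%:R 1 x)).
have sHT := sqintB sH sT.
apply: (@le_trans _ _ (ip mu (fun x => d * inv_exp 1 1 x) (fun x => d * inv_exp 1 1 x))); last first.
  have s1 : sqint mu (inv_exp (1 : R) 1) by exact: sqint_inv_exp.
  have s2 := sqintZ d s1.
  rewrite ipZl// ipC ipZl// (ip_inv_exp 0 0)// mulrA -expr2 sqr_sqrtr ?(ltW e0)//.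
  by rewrite fact0 expr1 ler_piMr ?(ltW e0)// ler_pdivrMr// mul1r; lra.
have s2 := sqintZ d (@sqint_inv_exp R 1 0 ltr01).
apply: le_Rintegral => //; [exact: (sqintM sHT sHT)|exact: (sqintM s2 s2)|].
move=> x _; rewrite -!expr2 -(real_normK (num_real (H x - _))).
have [x0|x0] := leP x 0.
  rewrite H1 ?(le_trans x0)// /T big1; last by move=> i _; rewrite inv_exp_npos// mulr0.
  by rewrite subrr normr0 expr0n sqr_ge0.
rewrite lerXn2r ?nnegrE ?normr_ge0 ?mulr_ge0 ?inv_exp_ge0 ?(ltW d0)//.
rewrite HE// TE// -mulrBr normrM ger0_norm ?inv_exp_ge0// mulrC ler_wpM2r ?inv_exp_ge0//.
by apply: hp; rewrite expR_ge0/= -expR0 ler_expR oppr_le0 invr_ge0 ltW.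
Qed.

(** Values clamped to [-N, N] satisfy (u - v)^2 <= 2 N |u - v|, and clamping is a contraction; so
    L^1 closeness on E becomes L^2 closeness. *)
Lemma ip_sub_le_L1 (f g c : R -> R) (N : R) (E : set R) (e : R) : 0 <= N -> measurable E ->
  measurable_fun setT f -> measurable_fun setT g -> measurable_fun setT c ->
  (forall x, 0 <= c x <= 1) -> (forall x, ~ E x -> c x = 0) ->
  (\int[mu]_(x in E) `|(clamp (- N) N (f x) - g x)%:E| <= e%:E)%E ->
  ip mu (fun x => clamp (- N) N (f x) * c x - clamp (- N) N (g x) * c x)
        (fun x => clamp (- N) N (f x) * c x - clamp (- N) N (g x) * c x) <= 2 * N * e.
Proof.
move=> N0 mE mf mg mc c01 cE H.
have NN : - N <= N by lra.
have mcl : measurable_fun setT (clamp (- N) N).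
  by apply: continuous_measurable_fun; exact: (@continuous_clamp R (- N) N id (fun x => cvg_id)).
have mclf : measurable_fun setT (fun x => clamp (- N) N (f x)) by exact: measurableT_comp.
have mclg : measurable_fun setT (fun x => clamp (- N) N (g x)) by exact: measurableT_comp.
apply: (@sqint_of_le _ _ R mu
  (fun x => clamp (- N) N (f x) * c x - clamp (- N) N (g x) * c x) (2 * N * e) _ _).2.
  by apply: measurable_funB; exact: measurable_funM.
have md : measurable_fun setT (fun x => `|(clamp (- N) N (f x) - g x)%:E|%E).
  by apply: measurableT_comp => //; apply/measurable_EFinP; exact: measurable_funB.
apply: (@le_trans _ _ (\int[mu]_(x in E) ((2 * N)%:E * `|(clamp (- N) N (f x) - g x)%:E|))%E).
  rewrite [leRHS]integral_mkcond; apply: ge0_le_integral => //.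
  - by move=> x _; rewrite lee_fin sqr_ge0.
  - by apply/measurable_EFinP; apply: measurable_funX; apply: measurable_funB; exact: measurable_funM.
  - apply/(measurable_restrictT _ _).1 => //.
    by apply: measurable_funTS; apply: emeasurable_funM.
  move=> x _; rewrite patchE; case: (boolP (x \in E)) => [_|]; last first.
    by rewrite notin_setE => /cE ->; rewrite !mulr0 subrr expr0n.
  rewrite -EFinM lee_fin -mulrBl exprMn.
  set u := clamp _ _ (f x); set v := clamp _ _ (g x).
  have /andP[u1 u2] : - N <= u <= N by exact: clamp_itv.
  have /andP[v1 v2] : - N <= v <= N by exact: clamp_itv.
  have uv : `|u - v| <= `|u - g x|.
    by rewrite -{1}(@clamp_id _ (- N) N u) ?u1// clamp_lipschitz.
  have /andP[c0 c1] := c01 x.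
  apply: (@le_trans _ _ ((u - v) ^+ 2)); first by rewrite ler_piMr ?sqr_ge0// exprn_ile1.
  rewrite -(real_normK (num_real (u - v))) expr2 ler_pM//.
  by rewrite ler_norml; apply/andP; split; lra.
rewrite ge0_integralZl_EFin//.
- by rewrite (EFinM (2 * N)) lee_wpmul2l// lee_fin mulr_ge0.
- exact: measurable_funTS.
- by rewrite mulr_ge0.
Qed.

Lemma sqint_bounded_support (f : R -> R) (N : R) : measurable_fun setT f ->
  (forall x, `|f x| <= N) -> (forall x, ~ `[0, N]%classic x -> f x = 0) -> sqint mu f.
Proof.
move=> mf fN f0; split => //.
apply: (@integrable_dominated _ _ R mu _ (fun x => N ^+ 2 * \1_`[0, N] x)).
- exact: measurable_funX.
- apply: integrableZr; apply/integrableP; split.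
    by apply/measurable_EFinP; exact: measurable_indic.
  rewrite (_ : (fun x => _) = (fun x => (\1_`[0, N] x)%:E)); last first.
    by apply/funext => x /=; rewrite ger0_norm.
  rewrite integral_indic//= setIT lebesgue_measure_itv/=.
  by case: ifP => _; rewrite ?ltry.
move=> x; rewrite ger0_norm ?sqr_ge0// indicE; case: (boolP (x \in _)) => [_|].
  by rewrite mulr1 -(real_normK (num_real (f x))) lerXn2r ?nnegrE// (le_trans _ (fN x)).
by rewrite notin_setE => /f0 ->; rewrite mulr0 expr0n.
Qed.

(** G is truncated in height and support, the truncation is approximated in L^1 by a continuous
    function, and the latter is truncated in the same way, which makes [ip_sub_le_L1] and
    [parseval_compact_support] applicable. *)
Lemma parseval_support (G : R -> R) : sqint mu G -> (forall x, x < 1 -> G x = 0) -> parseval G.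
Proof.
move=> sG G1; have [mG iG] := sG.
(* A trapezoid: 0 for x <= 1 and for x >= n, and equal to 1 at any given x > 1 once n is large. *)
pose chi (n : nat) (x : R) := clamp 0 1 (Num.min (n%:R * (x - 1)) (n%:R - x)).
have chi01 n x : 0 <= chi n x <= 1 by exact: clamp_itv.
have chi_lo n x : x <= 1 -> chi n x = 0.
  move=> x1; apply: clamp_lo => //; rewrite ge_min.
  by rewrite mulr_ge0_le0// subr_le0.
have chi_hi n x : n%:R <= x -> chi n x = 0.
  by move=> nx; apply: clamp_lo => //; rewrite ge_min subr_le0 nx orbT.
have cchi n : continuous (chi n).
  apply: continuous_clamp => x; apply: (@continuous_min _ _ (fun x => n%:R * (x - 1)) (fun x => n%:R - x)).
    by apply: cvgMr; apply: cvgB; [exact: cvg_id|exact: cvg_cst].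
  by apply: cvgB; [exact: cvg_cst|exact: cvg_id].
have mchi n : measurable_fun setT (chi n) by exact: continuous_measurable_fun.
have ccl (N : R) : continuous (clamp (- N) N) by exact: (@continuous_clamp R (- N) N id (fun x => cvg_id)).
pose Gn (n : nat) x := clamp (- n%:R) n%:R (G x) * chi n x.
have mGn n : measurable_fun setT (Gn n).
  apply: measurable_funM => //; apply: measurableT_comp => //.
  exact: continuous_measurable_fun.
have Gncvg x : x != 1 -> \forall n \near \oo, Gn n x = G x.
  move=> xn1; have [x1|x1] := ltP x 1.
    by apply: nearW => n; rewrite /Gn chi_lo ?ltW// mulr0 G1.
  have {}x1 : 0 < x - 1 by rewrite subr_gt0 lt_def xn1.
  near=> n; rewrite /Gn (_ : chi n x = 1).
    by rewrite mulr1 clamp_id// -ler_norml; near: n; exact: nbhs_infty_ger.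
  apply: clamp_hi => //; rewrite le_min; apply/andP; split.
    by rewrite -ler_pdivrMr//; near: n; exact: nbhs_infty_ger.
  by rewrite lerBrDr; near: n; exact: nbhs_infty_ger.
have sqle n x : (G x - Gn n x) ^+ 2 <= G x ^+ 2 by exact: clamp_shrink.
have H1 : ip mu (fun x => G x - Gn n x) (fun x => G x - Gn n x) @[n --> \oo] --> (0 : R).
  rewrite (_ : (fun n => _) = (fun n => \int[mu]_x ((G x - Gn n x) ^+ 2))); last first.
    by apply/funext => n; exact: ip_sqrE.
  have -> : 0 = \int[mu]_(x in setT) (0 : R) by rewrite /Rintegral integral0.
  apply: (@real_dominated_convergence _ _ R mu setT _ _ (fun x => G x ^+ 2)) => //.
  - by move=> n; apply: measurable_funX; apply: measurable_funB; [exact: mG|exact: mGn].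
  - have one_null : {ae mu, forall x : R, x != 1}.
      exists [set 1]; split => //; first exact: lebesgue_measure_set1.
      by move=> x /=; move/negP; rewrite negbK => /eqP ->.
    have aeF : Filter (almost_everywhere mu) by exact: ae_filter_ringOfSetsType.
    apply: (@filterS _ _ aeF _ _ _ one_null) => x x1 _.
    apply: (@cvg_trans _ (nbhs ((fun _ : nat => 0 : R) @ \oo))); last exact: cvg_cst.
    apply: near_eq_cvg; apply: filterS (Gncvg x x1) => n ->.
    by rewrite subrr expr0n.
  - by move=> n x _; rewrite ger0_norm ?sqr_ge0.
apply: parseval_limit => // e e0.
have e4 : 0 < e / 4 by rewrite divr_gt0.
have [n n2 hn] : exists2 n, (1 < n)%N & ip mu (fun x => G x - Gn n x) (fun x => G x - Gn n x) <= e / 4.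
  have /cvgrPdist_lt/(_ _ e4)[n0 _ h] := H1; exists (maxn n0 2); first by rewrite leq_maxr.
  have := h (maxn n0 2) (leq_maxl _ _); rewrite /= sub0r normrN => /ltW.
  exact: le_trans (ler_norm _).
pose N : R := n%:R; have N0 : 0 < N by rewrite ltr0n (ltn_trans _ n2).
pose E : set R := `[0, N]%classic.
have mE : measurable E by exact: measurable_itv.
have fE : (mu E < +oo)%E by rewrite lebesgue_measure_itv/=; case: ifP => _; rewrite ?ltry.
pose f x := clamp (- N) N (G x).
have mf : measurable_fun setT f by apply: measurableT_comp => //; exact: continuous_measurable_fun.
have NN : - N <= N by lra.
have intf : mu.-integrable E (EFin \o f).
  apply: measurable_bounded_integrable => //; first exact: measurable_funTS.
  exists N; split; rewrite ?num_real// => M NM x _ /=.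
  by rewrite (le_trans _ (ltW NM))// ler_norml clamp_itv.
have [g [cg _ gcvg]] := approximation_continuous_integrable mE fE intf.
(* [ip_sub_le_L1] multiplies this tolerance by 2 N, which gives e / 4; the two errors e / 4 are then
   doubled by [ip_sqrB_le]. *)
have d0 : 0 < e / (8 * N) by rewrite divr_gt0// mulr_gt0.
have [j hj] : exists j, (\int[mu]_(x in E) `|(f x - g j x)%:E| <= (e / (8 * N))%:E)%E.
  move/fine_cvgP: gcvg => [[n1 _ h1] /cvgrPdist_le/(_ _ d0)[n3 _ h3]].
  exists (maxn n1 n3); have := h3 (maxn n1 n3) (leq_maxr _ _).
  rewrite /= sub0r normrN => h; rewrite -(fineK (h1 (maxn n1 n3) (leq_maxl _ _))) lee_fin.
  exact: le_trans (ler_norm _) h.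
have mg : measurable_fun setT (g j) by exact: continuous_measurable_fun.
pose H x := clamp (- N) N (g j x) * chi n x.
have cH : continuous H.
  by move=> x; apply: cvgM; [exact: continuous_clamp|exact: cchi].
have chiE x : ~ E x -> chi n x = 0.
  move=> Ex; have [x0|x0] := ltP x 0; first by rewrite chi_lo// (le_trans (ltW x0)).
  have [xN|xN] := leP N x; first exact: chi_hi.
  by exfalso; apply: Ex; rewrite /E/= in_itv/= x0 ltW.
have cut_sqint (k : R -> R) : measurable_fun setT k -> sqint mu (fun x => clamp (- N) N (k x) * chi n x).
  move=> mk; apply: (@sqint_bounded_support _ N).
  - apply: measurable_funM => //; apply: measurableT_comp => //.
    exact: continuous_measurable_fun.
  - move=> x; have /andP[c0 c1] := chi01 n x; rewrite normrM (ger0_norm c0).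
    apply: (@le_trans _ _ (`|clamp (- N) N (k x)|)); first by rewrite ler_piMr.
    by rewrite ler_norml clamp_itv.
  - by move=> x /chiE ->; rewrite mulr0.
have sH : sqint mu H by exact: cut_sqint.
exists H; split => //.
  apply: (@parseval_compact_support H N) => //.
  - by rewrite ltr1n.
  - by move=> x x1; rewrite /H chi_lo// mulr0.
  - by move=> x xN; rewrite /H chi_hi// mulr0.
have h2 : ip mu (fun x => Gn n x - H x) (fun x => Gn n x - H x) <= 2 * N * (e / (8 * N)).
  exact: (@ip_sub_le_L1 G (g j) (chi n) N E).
have sGn : sqint mu (Gn n) by exact: cut_sqint.
have := ip_sqrB_le (sqintB sG sGn) (sqintB sH sGn).
rewrite (_ : (fun x => _ - _) = (fun x => G x - H x)); last by apply/funext => x; ring.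
move/le_trans; apply.
have -> : ip mu (fun x => H x - Gn n x) (fun x => H x - Gn n x) =
  ip mu (fun x => Gn n x - H x) (fun x => Gn n x - H x).
  by apply: eq_Rintegral => x _; ring.
have e8 : 2 * N * (e / (8 * N)) = e / 4 by field; rewrite gt_eqF.
by move: h2 hn; rewrite e8; lra.
Unshelve. all: by end_near. Qed.

End Density.

(** * Pollaczek polynomials at half-integers *)

Section Delannoy.
Context {R : comRingType}.

Definition delannoy m n : R := \sum_(k < m.+1) 'C(m, k)%:R * 'C(n, k)%:R * 2 ^+ k.

Lemma delannoy_wide m n K : (m < K)%N ->
  delannoy m n = \sum_(k < K) 'C(m, k)%:R * 'C(n, k)%:R * 2 ^+ k.
Proof.
move=> mK; rewrite /delannoy (big_ord_widen _ (fun k => 'C(m, k)%:R * 'C(n, k)%:R * 2 ^+ k) mK).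
rewrite big_mkcond; apply: eq_bigr => k _; rewrite ltnS; case: leqP => // km.
by rewrite (@bin_small m) ?mul0r// ltnS.
Qed.

Lemma delannoy0n n : delannoy 0 n = 1.
Proof. by rewrite /delannoy big_ord1 !bin0 expr0 !mulr1. Qed.

Lemma delannoym0 m : delannoy m 0 = 1.
Proof.
rewrite /delannoy big_ord_recl !bin0 expr0 !mulr1 big1 ?addr0// => k _.
by rewrite (@bin_small 0)// mulr0 mul0r.
Qed.

Lemma delannoy_rec m n : delannoy m.+1 n.+1 = delannoy m n.+1 + delannoy m.+1 n + delannoy m n.
Proof.
rewrite !(@delannoy_wide _ _ m.+2)//.
pose T k : R := 'C(m, k)%:R * 'C(n, k)%:R * 2 ^+ k.
apply/eqP; rewrite -subr_eq0 !opprD !addrA -!sumrB big_ord_recl/=.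
(* Pascal's rule makes the difference of the two sides telescope. *)
rewrite (eq_bigr (fun i : 'I_m.+1 => 2 * T i - 2 * T i.+1)); last first.
  by move=> i _; rewrite /bump/= !add1n !binS !natrD /T exprS; ring.
rewrite sumrB -(big_mkord xpredT (fun i => 2 * T i)) -(big_mkord xpredT (fun i => 2 * T i.+1)).
rewrite -sumrB; under eq_bigr do rewrite -opprB.
rewrite sumrN telescope_sumr// /T !bin0 bin_small// expr0.
by apply/eqP; ring.
Qed.

End Delannoy.

(** * Uniqueness of power series coefficients *)

Section PowerSeries.
Context {R : realType}.
Implicit Types (c q : nat -> R[i]) (t : R).

Definition cpartial c t N : R[i] := \sum_(m < N) t%:C ^+ m * c m.

Lemma cvg_cmod (s : nat -> R[i]) (l : R[i]) : s n @[n --> \oo] --> (l : R[i]^o) ->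
  cmod (s n - l) @[n --> \oo] --> (0 : R).
Proof.
move=> /(cvgrPdist_lt (V := R[i]^o)) h; apply/cvgrPdist_lt => e e0.
have e0' : 0 < e%:C :> R[i] by rewrite ltcR.
apply: filterS (h _ e0') => n; rewrite normE ltcR cmodBC.
by rewrite sub0r normrN ger0_norm// cmod_ge0.
Qed.

Lemma cmod_sum (N : nat) (c : 'I_N -> R[i]) : cmod (\sum_(i < N) c i) <= \sum_(i < N) cmod (c i).
Proof.
elim/big_ind2: _ => [|x y z w h1 h2|//]; first by rewrite (cmodr (0 : R)) normr0.
by rewrite (le_trans (cmodD _ _))// lerD.
Qed.

(** The terms at t = 1/2 are bounded, so |c m| <= B 2^m. Once the coefficients below k vanish,
    dividing by t^k leaves |c k| <= B 2^(k+2) t for all small t > 0. *)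
Lemma pseries_eq0 c : (forall t, 0 < t < 1 -> cmod (cpartial c t N) @[N --> \oo] --> (0 : R)) ->
  forall m, c m = 0.
Proof.
move=> hc.
have [B B0 hB] : exists2 B : R, 0 <= B & forall m, cmod (c m) <= B * 2 ^+ m.
  have h2 : 0 < (2^-1 : R) < 1 by rewrite invr_gt0 invf_lt1//; apply/andP; split; lra.
  have /cvgrPdist_lt/(_ 1 ltr01)[N _ hN] := hc _ h2.
  pose B := 2 + \sum_(m < N) cmod (c m).
  have S0 : 0 <= \sum_(m < N) cmod (c m) by rewrite sumr_ge0// => i _; exact: cmod_ge0.
  exists B => [|m]; first by rewrite addr_ge0.
  have p1 : 1 <= 2 ^+ m :> R by rewrite exprn_ege1// ler1n.
  have [mN|mN] := ltnP m N.
    rewrite (le_trans _ (_ : B * 1 <= _))//; last by rewrite ler_wpM2l// addr_ge0.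
    rewrite mulr1 /B (bigD1 (Ordinal mN))//= addrCA lerDl addr_ge0// sumr_ge0// => i _.
    exact: cmod_ge0.
  have h1 := hN m mN; have h3 := hN m.+1 (leqW mN).
  rewrite /= sub0r normrN ger0_norm ?cmod_ge0// in h1.
  rewrite /= sub0r normrN ger0_norm ?cmod_ge0// in h3.
  have E : 2^-1%:C ^+ m * c m = cpartial c 2^-1 m.+1 - cpartial c 2^-1 m.
    by rewrite /cpartial big_ord_recr/= addrAC subrr add0r.
  have : cmod (2^-1%:C ^+ m * c m) <= 2.
    rewrite E (le_trans (cmodB _ _))//; lra.
  rewrite cmodM cmodX cmodr ger0_norm ?invr_ge0// exprVn ler_pdivrMl ?exprn_gt0// mulrC.
  by move=> /le_trans; apply; rewrite ler_wpM2r ?exprn_ge0// lerDl.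
elim/ltn_ind => k IH; apply/eqP; rewrite -cmod_eq0 eq_le cmod_ge0 andbT.
have key t : 0 < t < 4^-1 -> cmod (c k) <= B * 2 ^+ k.+2 * t.
  move=> /andP[t0 t4]; have t1 : 0 < t < 1 by rewrite t0; lra.
  have tk : 0 < t ^+ k by rewrite exprn_gt0.
  have geo N : \sum_(m < N) (2 * t) ^+ m <= 2.
    have := subrX1 (2 * t) N; have : 0 <= (2 * t) ^+ N by rewrite exprn_ge0// mulr_ge0// ltW.
    by move: (\sum_(_ < _) _) (_ ^+ N) => S y y0 E; nra.
  have bound N : t ^+ k * cmod (c k) - 2 * B * (2 * t) ^+ k.+1 <= cmod (cpartial c t (k.+1 + N)).
    rewrite /cpartial big_split_ord/= big_ord_recr/= big1 ?add0r; last first.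
      by move=> i _; rewrite IH// mulr0.
    have -> : t ^+ k * cmod (c k) = cmod (t%:C ^+ k * c k).
      by rewrite cmodM cmodX cmodr ger0_norm// ltW.
    set r := \sum_(_ < _) _; rewrite lerBlDr.
    rewrite -[t%:C ^+ k * c k in leLHS](addrK r) (le_trans (cmodB _ _))// lerD2l /r.
    rewrite (le_trans (cmod_sum _))//.
    apply: (@le_trans _ _ (\sum_(i < N) B * (2 * t) ^+ k.+1 * (2 * t) ^+ i)).
      apply: ler_sum => i _; rewrite cmodM cmodX cmodr ger0_norm ?(ltW t0)//.
      rewrite -mulrA -exprD exprMn; move: (k.+1 + i)%N => l.
      rewrite [leRHS](_ : _ = t ^+ l * (B * 2 ^+ l)); last by ring.
      by rewrite ler_wpM2l ?hB// exprn_ge0// ltW.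
    rewrite -mulr_sumr (mulrC 2 B) -!mulrA ler_wpM2l// mulrC ler_wpM2r//.
    by rewrite exprn_ge0// mulr_ge0// ltW.
  have h0 : t ^+ k * cmod (c k) - 2 * B * (2 * t) ^+ k.+1 <= 0.
    rewrite leNgt; apply/negP => p0.
    have /cvgrPdist_lt/(_ _ p0)[N _ hN] := hc t t1.
    have := hN (k.+1 + N)%N (leq_addl _ _).
    by rewrite /= sub0r normrN ger0_norm ?cmod_ge0// ltNge bound.
  move: h0; rewrite subr_le0 => h0; rewrite -(ler_pM2l tk) (le_trans h0)//.
  rewrite le_eqVlt; apply/orP; left; apply/eqP.
  by rewrite exprMn !exprS; move: (t ^+ k) (2 ^+ k) => x y; ring.
apply/ler_addgt0Pr => e e0; rewrite add0r.
pose M := B * 2 ^+ k.+2.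
have M0 : 0 <= M by rewrite mulr_ge0// exprn_ge0.
have d0 : 0 < e / (M + 1) by rewrite divr_gt0// ltr_wpDl.
pose t := Num.min 8^-1 (e / (M + 1)).
have t0 : 0 < t by rewrite lt_min d0 invr_gt0 ltr0n.
have t1 : t < 4^-1 by rewrite (@le_lt_trans _ _ 8^-1) ?ge_min ?lexx// ltf_pV2 ?posrE ?ltr_nat.
have t2 : t <= e / (M + 1) by rewrite ge_min lexx orbT.
rewrite (le_trans (key t _)) ?t0// -/M (le_trans (ler_wpM2l M0 t2))//.
by rewrite mulrCA (ler_piMr (ltW e0))// ler_pdivrMr ?mul1r ?lerDl// ltr_wpDl.
Qed.

(** Multiplication by t is the shift [sh] of coefficients, so both sides of the functional equation
    are power series whose difference falls under [pseries_eq0]. *)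
Lemma pseries_recurrence (q q' : nat -> R[i]) (G G' : R -> R[i]) (alpha : R[i]) :
  (forall t, 0 < t < 1 -> cmod (cpartial q t N - G t) @[N --> \oo] --> (0 : R)) ->
  (forall t, 0 < t < 1 -> cmod (cpartial q' t N - G' t) @[N --> \oo] --> (0 : R)) ->
  (forall t, 0 < t < 1 -> (1 + 'i * t%:C) * G' t = (1 + alpha * t%:C) * G t) ->
  q' 0 = q 0 /\ forall m, q' m.+1 + 'i * q' m = q m.+1 + alpha * q m.
Proof.
move=> hq hq' hG.
pose sh (c : nat -> R[i]) (m : nat) : R[i] := if m is m'.+1 then c m' else 0.
have sumsh c t N : cpartial (sh c) t N.+1 = t%:C * cpartial c t N.
  rewrite /cpartial big_ord_recl/= mulr0 add0r mulr_sumr.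
  by apply: eq_bigr => m _; rewrite /= /bump/= exprS mulrA.
pose d m := q' m + 'i * sh q' m - (q m + alpha * sh q m).
suff d0 m : d m = 0.
  split; first by have := d0 0; rewrite /d/= !mulr0 !addr0 => /eqP; rewrite subr_eq0 => /eqP.
  by move=> m; have := d0 m.+1; rewrite /d/= => /eqP; rewrite subr_eq0 => /eqP.
apply: pseries_eq0 => {}t t01.
have E N : cpartial d t N.+1 = (cpartial q' t N.+1 - G' t) + 'i * t%:C * (cpartial q' t N - G' t)
   - (cpartial q t N.+1 - G t) - alpha * t%:C * (cpartial q t N - G t).
  have -> : cpartial d t N.+1 = cpartial q' t N.+1 + 'i * cpartial (sh q') t N.+1 -
      (cpartial q t N.+1 + alpha * cpartial (sh q) t N.+1).
    rewrite /cpartial !mulr_sumr -!big_split/= -sumrB; apply: eq_bigr => i _; rewrite /d.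
    by move: (sh q' i) (sh q i) (q i) (q' i) (t%:C ^+ i) => a b x y z; ring.
  rewrite !sumsh; have := hG t t01.
  move: (cpartial q' t N.+1) (cpartial q t N.+1) (cpartial q' t N) (cpartial q t N) => x y z w.
  move: (G t) (G' t) (t%:C) => g g' s hg.
  apply/eqP; rewrite -subr_eq0; apply/eqP.
  transitivity ((1 + 'i * s) * g' - (1 + alpha * s) * g); last by rewrite hg subrr.
  by ring.
have c1 : cmod (cpartial q' t N.+1 - G' t) @[N --> \oo] --> (0 : R).
  by rewrite (cvg_shiftS (fun N => cmod (cpartial q' t N - G' t))); exact: hq'.
have c2 : cmod (cpartial q t N.+1 - G t) @[N --> \oo] --> (0 : R).
  by rewrite (cvg_shiftS (fun N => cmod (cpartial q t N - G t))); exact: hq.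
have c3 : cmod ('i * t%:C) * cmod (cpartial q' t N - G' t) @[N --> \oo] --> cmod ('i * t%:C) * 0.
  by apply: cvgMr; exact: hq'.
have c4 : cmod (alpha * t%:C) * cmod (cpartial q t N - G t) @[N --> \oo] --> cmod (alpha * t%:C) * 0.
  by apply: cvgMr; exact: hq.
rewrite -(cvg_shiftS (fun N => cmod (cpartial d t N))).
have c0 : cmod (cpartial q' t N.+1 - G' t) + cmod ('i * t%:C) * cmod (cpartial q' t N - G' t) +
    cmod (cpartial q t N.+1 - G t) + cmod (alpha * t%:C) * cmod (cpartial q t N - G t)
    @[N --> \oo] --> (0 : R).
  by have := cvgD (cvgD (cvgD c1 c3) c2) c4; rewrite !mulr0 !addr0; apply.
apply: (squeeze_cvgr _ (cvg_cst 0) c0); apply: nearW => N; rewrite /= cmod_ge0 E /=.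
by rewrite (le_trans (cmodB _ _))// cmodM lerD// (le_trans (cmodB _ _))// lerD//
  (le_trans (cmodD _ _))// cmodM.
Qed.

End PowerSeries.

(** * Values of the Pollaczek polynomials *)

Section PollaczekValues.
Context {R : realType}.
Implicit Types (z w : R[i]).

Lemma cexpD z w : cexp (z + w) = cexp z * cexp w.
Proof.
case: z w => [a b] [c d]; rewrite /cexp /= expRD cosD sinD.
by apply: complex_eqP => /=; ring.
Qed.

Lemma cexp0 : cexp (0 : R[i]) = 1.
Proof. by apply: complex_eqP; rewrite /= expR0 cos0 sin0; ring. Qed.

Lemma cexp_natr n w : cexp (n%:R * w) = cexp w ^+ n.
Proof.
elim: n => [|n IH]; first by rewrite mul0r cexp0.
by rewrite -natr1 mulrDl mul1r cexpD IH exprSr.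
Qed.

Lemma cexpN w : cexp (- w) = (cexp w)^-1.
Proof.
have h : cexp w * cexp (- w) = 1 by rewrite -cexpD subrr cexp0.
have w0 : cexp w != 0.
  by apply/eqP => e; move: h; rewrite e mul0r => /eqP; rewrite eq_sym oner_eq0.
by rewrite -[RHS]mulr1 -h mulKf.
Qed.

Lemma cexp_clog z : z != 0 -> cexp (clog z) = z.
Proof.
move=> z0; have m0 : 0 < cmod z by rewrite cmod_gt0.
have d1 : -1 <= complex.Re z / cmod z <= 1.
  by rewrite -ler_norml normrM normfV (ger0_norm (ltW m0)) ler_pdivrMr// mul1r le_Re_cmod.
have c1 : cos (carg z) = complex.Re z / cmod z.
  by rewrite /carg; case: ifP => _; rewrite ?cosN acosK// in_itv.
have s0 : sin (acos (complex.Re z / cmod z)) = `|complex.Im z| / cmod z.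
  rewrite sin_acos// -[RHS]ger0_norm ?divr_ge0 ?(ltW m0)// -sqrtr_sqr; congr Num.sqrt.
  have e := cmod_sqr z; rewrite !expr_div_n real_normK ?num_real// -[1](@divff _ (cmod z ^+ 2)).
    by rewrite -mulrBl {1}e addrAC subrr add0r.
  by rewrite expf_neq0// gt_eqF.
have s1 : sin (carg z) = complex.Im z / cmod z.
  rewrite /carg; case: leP => h; first by rewrite s0 ger0_norm.
  by rewrite sinN s0 ltr0_norm// mulNr opprK.
rewrite /cexp /clog /= lnK ?posrE// c1 s1.
move: (cmod z) m0 => m m0; case: z {z0 d1 c1 s0 s1} => x y.
by apply: complex_eqP => /=; field; rewrite gt_eqF.
Qed.

Lemma cpow_natr z n : z != 0 -> cpow z n%:R = z ^+ n.
Proof. by move=> z0; rewrite /cpow cexp_natr cexp_clog. Qed.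

Lemma cpow_natrN z n : z != 0 -> cpow z (- n%:R) = (z ^+ n)^-1.
Proof. by move=> z0; rewrite /cpow mulNr cexpN cexp_natr cexp_clog. Qed.

Lemma one_plus_imaginary_neq0 (y : R) : 1 + 'i * y%:C != 0 :> R[i].
Proof.
apply/eqP => /(congr1 (fun z => complex.Re z))/=; rewrite !mul0r !mul1r subr0 addr0.
by move/eqP; rewrite oner_eq0.
Qed.

(** At x = -i (n + 1/2) the exponents i x - 1/2 and -i x - 1/2 are the integers n and -(n + 1), so
    the branch of the complex power disappears. *)
Lemma pollaczek_generating (P : nat -> {poly R[i]}) n (t : R) : is_pollaczek P -> 0 < t < 1 ->
  cmod (cpartial (fun m => (P m).[- 'i * (n%:R + 2^-1)]) t N -
    (1 - 'i * t%:C) ^+ n / (1 + 'i * t%:C) ^+ n.+1) @[N --> \oo] --> (0 : R).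
Proof.
move=> hP /andP[t0 t1].
have ct : cmod (t%:C : R[i]) < 1 by rewrite cmodr ger0_norm// ltW.
have := hP (- 'i * (n%:R + 2^-1)) t%:C ct.
have ii : 'i * 'i = -1 :> R[i] by rewrite -expr2 sqr_i.
have -> : 'i * (- 'i * (n%:R + 2^-1)) = n%:R + 2^-1 :> R[i].
  by rewrite mulrA mulrN ii opprK mul1r.
have -> : n%:R + 2^-1 - 2^-1 = n%:R :> R[i] by rewrite addrK.
have -> : - (n%:R + 2^-1) - 2^-1 = - n.+1%:R :> R[i].
  by rewrite -natr1; field.
have n1 : 1 - 'i * t%:C != 0 :> R[i].
  by rewrite -mulrN -rmorphN one_plus_imaginary_neq0.
rewrite cpow_natr// cpow_natrN ?one_plus_imaginary_neq0//.
move=> /cvg_cmod; apply: cvg_trans; apply: near_eq_cvg; apply: nearW => N.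
by rewrite /cpartial /series/= big_mkord.
Qed.

(* The generating functions G_n of the values at -i (n + 1/2) satisfy
   (1 + it) G_(n+1) = (1 - it) G_n, which is the Delannoy recurrence. *)
Lemma pollaczek_half_integer (P : nat -> {poly R[i]}) m n : is_pollaczek P ->
  (P m).[- 'i * (n%:R + 2^-1)] = (- 'i) ^+ m * (delannoy m n)%:C.
Proof.
move=> hP.
pose q (l k : nat) := (P k).[- 'i * (l%:R + 2^-1)]; rewrite -/(q n m).
have hq l t : 0 < t < 1 -> cmod (cpartial (q l) t N -
    (1 - 'i * t%:C) ^+ l / (1 + 'i * t%:C) ^+ l.+1) @[N --> \oo] --> (0 : R).
  exact: pollaczek_generating.
(* For l = 0 the generating function is 1/(1 + i t), compared here with the constant series 1 and
   alpha = 0. *)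
have base : q 0 0 = 1 /\ forall m, q 0 m.+1 + 'i * q 0 m = 0.
  have [||t t01|h1 h2] := @pseries_recurrence R (fun m => (m == 0)%:R) (q 0)
    (fun=> 1) (fun t => (1 - 'i * t%:C) ^+ 0 / (1 + 'i * t%:C) ^+ 1) 0.
  - move=> t _; rewrite -cvg_shiftS.
    apply: (@cvg_trans _ (nbhs ((fun _ : nat => 0 : R) @ \oo))); last exact: cvg_cst.
    apply: near_eq_cvg; apply: nearW => N.
    rewrite /= /cpartial big_ord_recl/= expr0 mul1r big1; last by move=> i _; rewrite mulr0.
    by rewrite addr0 subrr (cmodr (0 : R)) normr0.
  - exact: hq.
  - have h := one_plus_imaginary_neq0 t; by rewrite expr0 expr1 mul0r addr0 mulr1 div1r divff.
  by split => // k; rewrite h2 mul0r addr0.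
have step l : q l.+1 0 = q l 0 /\ forall m, q l.+1 m.+1 + 'i * q l.+1 m = q l m.+1 - 'i * q l m.
  have [t t01|h1 h2] := @pseries_recurrence R (q l) (q l.+1) _ _ (- 'i) (hq l) (hq l.+1).
    rewrite mulNr [_ ^+ l.+1]exprS [(1 + _) ^+ l.+2]exprS.
    have h := one_plus_imaginary_neq0 t; have hl := expf_neq0 l.+1 h.
    move: h hl; move: (_ ^+ l.+1) (_ ^+ l) => A B; move: (1 + 'i * t%:C) => a.
    by move: (1 - 'i * t%:C) => b a0 A0; field; rewrite a0 A0.
  by split => // k; rewrite h2 mulNr.
elim: n m => [|n IHn] m.
  elim: m => [|m IHm]; first by rewrite base.1 delannoy0n expr0 mul1r.
  have := base.2 m; rewrite IHm !delannoym0 !mulr1 => /eqP; rewrite addr_eq0 => /eqP ->.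
  by rewrite exprS mulNr.
elim: m => [|m IHm]; first by rewrite (step n).1 IHn !delannoy0n.
have := (step n).2 m; rewrite IHm !IHn delannoy_rec !rmorphD/= exprS => h.
have -> : q n.+1 m.+1 = - 'i * (- 'i) ^+ m * (delannoy m.+1 n)%:C - 'i * ((- 'i) ^+ m * (delannoy m n)%:C)
   - 'i * ((- 'i) ^+ m * (delannoy m n.+1)%:C) by rewrite -h addrK.
by ring.
Qed.

End PollaczekValues.

(** * Convergence of the regularized expansions *)

Section CoefficientLimit.
Context {R : realType}.
Local Notation mu := (@lebesgue_measure R).
Implicit Types (x y : R) (G : R -> R).

Lemma cvg_dist0 (u : nat -> R) (l : R) : u n @[n --> \oo] --> l ->
  `|u n - l| @[n --> \oo] --> (0 : R).
Proof.
move=> ul; apply/cvgrPdist_lt => e e0; have /cvgrPdist_lt/(_ _ e0) := ul.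
by apply: filterS => n; rewrite sub0r normrN normr_id distrC.
Qed.

Lemma delannoy_ge0 m n : 0 <= delannoy m n :> R.
Proof. by apply: sumr_ge0 => k _; rewrite !mulr_ge0// exprn_ge0. Qed.

Lemma series_exp_cvg y : \sum_(j < N) y ^+ j / j`!%:R @[N --> \oo] --> expR y.
Proof.
rewrite (_ : (fun N => _) = series (exp_coeff y)); first exact: is_cvg_series_exp_coeff.
by apply/funext => N; rewrite /series/= big_mkord.
Qed.

(** Termwise, sum_n y^n / n! C(n, k) = e^y y^k / k!. At y = -1/x the limit is e^(-1/x) L_m(2/x); at
    y = 1 it bounds the weights absolutely. *)
Lemma delannoy_series m y :
  \sum_(n < N) y ^+ n / n`!%:R * delannoy m n @[N --> \oo] -->
  expR y * \sum_(k < m.+1) 'C(m, k)%:R * 2 ^+ k * (y ^+ k / k`!%:R).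
Proof.
have f0 k : (k`!%:R : R) != 0 by rewrite pnatr_eq0 -lt0n fact_gt0.
have term k : \sum_(n < N) y ^+ n / n`!%:R * 'C(n, k)%:R @[N --> \oo] --> expR y * (y ^+ k / k`!%:R).
  rewrite -(cvg_shiftn k) (_ : (fun N => _) = (fun N => (\sum_(j < N) y ^+ j / j`!%:R) * (y ^+ k / k`!%:R))).
    by apply: cvgMl; exact: series_exp_cvg.
  apply/funext => N; rewrite addnC big_split_ord/= big1 ?add0r; last first.
    by move=> i _; rewrite bin_small// mulr0.
  rewrite mulr_suml; apply: eq_bigr => j _.
  have := bin_fact (leq_addr j k); rewrite addKn => /(congr1 (fun n => n%:R : R)).
  rewrite !natrM exprD => e; have := f0 (k + j)%N; rewrite -e => e0.
  have c0 : ('C(k + j, k)%:R : R) != 0 by apply: contra_neq e0 => ->; rewrite mul0r.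
  move: (f0 k) (f0 j) c0; move: (_ ^+ k) (_ ^+ j) => X Y h1 h2 h3.
  by field; rewrite h1 h2 h3.
rewrite (_ : (fun N => _) = (fun N => \sum_(k < m.+1) 'C(m, k)%:R * 2 ^+ k *
    \sum_(n < N) y ^+ n / n`!%:R * 'C(n, k)%:R)); last first.
  apply/funext => N; under [RHS]eq_bigr do rewrite mulr_sumr.
  rewrite exchange_big/=; apply: eq_bigr => n _; rewrite /delannoy mulr_sumr.
  by apply: eq_bigr => k _; ring.
rewrite mulr_sumr; apply: cvg_big => [|k _]; first exact: add_continuous.
by rewrite mulrCA; apply: cvgMr; exact: term.
Qed.

(** The factor of a_n in i^m c_m, real because i^m P_m(-i (n + 1/2)) is a Delannoy number. *)
Definition laguerre_weight m n : R := Num.sqrt 2 * ((-1) ^+ n / n`!%:R * delannoy m n).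

(** Absolute summability serves twice: it bounds the effect of noise eps by K eps, and it gives the
    majorant for exchanging sum and integral. *)
Lemma laguerre_weight_bound m : exists2 K : R, 0 < K &
  forall N, \sum_(n < N) `|laguerre_weight m n| <= K.
Proof.
have h := @delannoy_series m 1; set l := expR 1 * _ in h.
have nd : {homo (fun N => \sum_(n < N) 1 ^+ n / n`!%:R * delannoy m n) : p q / (p <= q)%N >-> p <= q :> R}.
  move=> p q pq; rewrite -(subnKC pq) big_split_ord/= lerDl sumr_ge0// => i _.
  by rewrite expr1n mulr_ge0 ?delannoy_ge0.
have le_l N : \sum_(n < N) 1 ^+ n / n`!%:R * delannoy m n <= l.
  rewrite -(cvg_lim _ h)//; apply: (nondecreasing_cvgn_le nd).
  by apply/cvg_ex; exists l.
have l0 : 0 <= l by rewrite (le_trans _ (le_l 0))// big_ord0.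
exists (Num.sqrt 2 * l + 1); first by rewrite ltr_wpDl// mulr_ge0// sqrtr_ge0.
move=> N; rewrite (le_trans (_ : _ <= Num.sqrt 2 * l))//; last by rewrite lerDl.
rewrite (le_trans _ (ler_wpM2l (sqrtr_ge0 2) (le_l N)))// mulr_sumr.
apply: ler_sum => n _; rewrite /laguerre_weight !normrM normrX normrN1 expr1n.
by rewrite (ger0_norm (sqrtr_ge0 _)) (ger0_norm (delannoy_ge0 _ _)) ger0_norm ?expr1n// invr_ge0.
Qed.

(** With the moments written as integrals, the finite sums are inner products of G with S N, which
    tends pointwise to psi_m on [1, +oo) and is dominated there by K / x. *)
Lemma laguerre_coefficient_cvg m G (alpha : nat -> R) : sqint mu G ->
  (forall x, x < 1 -> G x = 0) -> (forall n, ip mu (inv_power n.+1) G = alpha n) ->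
  \sum_(n < N) laguerre_weight m n * alpha n @[N --> \oo] --> ip mu G (laguerre_fn m).
Proof.
move=> sG G1 hG; have [K K0 hK] := laguerre_weight_bound m.
have [mG _] := sG.
have sw (n : nat) : sqint mu (fun x => laguerre_weight m n * inv_power n.+1 x).
  by apply: sqintZ; exact: sqint_inv_power.
pose S N x := \sum_(n < N) laguerre_weight m n * inv_power n.+1 x.
have sS N : sqint mu (S N).
  exact: (@sqint_sum _ _ R mu N (fun n x => laguerre_weight m n * inv_power n.+1 x)).
rewrite (_ : (fun N => _) = (fun N => \int[mu]_x (S N x * G x))); last first.
  apply/funext => N; rewrite -/(ip mu (S N) G).
  rewrite (@ip_suml _ _ R mu N (fun n x => laguerre_weight m n * inv_power n.+1 x))//.
  by apply: eq_bigr => n _; rewrite ipZl ?hG//; exact: sqint_inv_power.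
apply: (@real_dominated_convergence _ _ R mu setT _ _ (fun x => K * `|inv_power 1 x * G x|)) => //.
- by move=> N; apply: measurable_funM => //; case: (sS N).
- by apply: measurable_funM => //; case: (@sqint_laguerre_fn R m).
- apply: nearW => x _; have [x1|x1] := ltP x 1.
    rewrite G1// mul0r; under eq_fun do rewrite mulr0; exact: cvg_cst.
  rewrite mulrC; apply: cvgMl.
  have x0 : 0 < x by rewrite (lt_le_trans _ x1).
  have -> : laguerre_fn m x = Num.sqrt 2 * x^-1 *
      (expR (- x^-1) * \sum_(k < m.+1) 'C(m, k)%:R * 2 ^+ k * ((- x^-1) ^+ k / k`!%:R)).
    rewrite /laguerre_fn inv_exp_pos// expr1 div1r (horner_coef_wide _ (size_poly _ _)).
    set A := \sum_(_ < _) _; set B := \sum_(_ < _) _.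
    have -> : A = B; last by ring.
    apply: eq_bigr => k _; rewrite coef_poly ltn_ord exprMn -[- x^-1]mulN1r exprMn.
    by ring.
  rewrite (_ : (fun N => _) = (fun N => Num.sqrt 2 * x^-1 *
      \sum_(n < N) (- x^-1) ^+ n / n`!%:R * delannoy m n)); last first.
    apply/funext => N; rewrite /S mulr_sumr; apply: eq_bigr => n _.
    rewrite inv_power_ge1// -exprVn exprS /laguerre_weight -[- x^-1]mulN1r exprMn.
    by ring.
  by apply: cvgMr; exact: delannoy_series.
- by apply: integrableZr; apply/integrable_norm; exact: (sqintM (sqint_inv_power 0) sG).
move=> N x _; rewrite !normrM mulrA ler_wpM2r// (le_trans (ler_norm_sum _ _ _))//.
rewrite (le_trans _ (ler_wpM2r _ (hK N)))// mulr_suml; apply: ler_sum => n _.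
rewrite normrM ler_wpM2l// !ger0_norm ?inv_power_ge0// /inv_power expr1 -exprVn exprS.
rewrite ler_piMr ?invr_ge0 ?le_max ?ler01// exprn_ile1 ?invr_ge0 ?le_max ?ler01//.
by rewrite invf_le1 ?le_max ?lexx// lt_max ltr01.
Qed.

Definition laguerre_coef (b : nat -> R[i]) N m : R[i] :=
  \sum_(n < N.+1) (laguerre_weight m n)%:C * b n.

Lemma coef_laguerre (P : nat -> {poly R[i]}) (b : nat -> R[i]) N m : is_pollaczek P ->
  coef P b N m * 'i ^+ m = laguerre_coef b N m.
Proof.
move=> hP; rewrite /coef /laguerre_coef -mulrA mulr_suml mulr_sumr.
have ii : 'i ^+ m * (- 'i) ^+ m = 1 :> R[i].
  by rewrite -exprMn mulrN -expr2 sqr_i opprK expr1n.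
apply: eq_bigr => n _; rewrite pollaczek_half_integer// /laguerre_weight !rmorphM/= fmorphV.
rewrite rmorphXn/= rmorphN1 rmorph_nat.
move: ii; move: ('i ^+ m) ((- 'i) ^+ m) => z w zw.
rewrite [RHS](_ : _ = z * w * ((Num.sqrt 2)%:C * ((-1) ^+ n / (n`!)%:R * (delannoy m n)%:C) * b n)).
  by move: (_^-1) => F; ring.
by rewrite zw mul1r.
Qed.

Lemma laguerre_coef_dist m (a b : nat -> R[i]) N (eps K : R) :
  (forall N, \sum_(n < N) `|laguerre_weight m n| <= K) -> 0 <= eps ->
  (forall n, (n <= N)%N -> cmod (b n - a n) <= eps) ->
  cmod (laguerre_coef b N m - laguerre_coef a N m) <= K * eps.
Proof.
move=> hK e0 hb; rewrite /laguerre_coef -sumrB (le_trans (cmod_sum _))//.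
rewrite (le_trans _ (ler_wpM2r e0 (hK N.+1)))// mulr_suml; apply: ler_sum => -[n nN] _ /=.
by rewrite -mulrBr cmodM cmodr ler_wpM2l// hb.
Qed.

Lemma laguerre_coef_cvg m (a : nat -> R[i]) (Gr Gi : R -> R) : sqint mu Gr -> sqint mu Gi ->
  (forall x, x < 1 -> Gr x = 0) -> (forall x, x < 1 -> Gi x = 0) ->
  (forall n, ip mu (inv_power n.+1) Gr = complex.Re (a n)) ->
  (forall n, ip mu (inv_power n.+1) Gi = complex.Im (a n)) ->
  cmod (laguerre_coef a N m - (ip mu Gr (laguerre_fn m) +i* ip mu Gi (laguerre_fn m)))
    @[N --> \oo] --> (0 : R).
Proof.
move=> sr si r1 i1 hr hi.
have hR := @laguerre_coefficient_cvg m _ _ sr r1 hr.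
have hI := @laguerre_coefficient_cvg m _ _ si i1 hi.
have reE N : complex.Re (laguerre_coef a N m) = \sum_(n < N.+1) laguerre_weight m n * complex.Re (a n).
  rewrite (big_morph (fun z : R[i] => complex.Re z) (@cReD R) (erefl : complex.Re 0 = 0)).
  by apply: eq_bigr => n _; rewrite cReM/= mul0r subr0.
have imE N : complex.Im (laguerre_coef a N m) = \sum_(n < N.+1) laguerre_weight m n * complex.Im (a n).
  rewrite (big_morph (fun z : R[i] => complex.Im z) (@cImD R) (erefl : complex.Im 0 = 0)).
  by apply: eq_bigr => n _; rewrite cImM/= mul0r addr0.
move: hR hI; rewrite -cvg_shiftS -[X in _ -> X -> _]cvg_shiftS => hR hI.
have c1 : `|complex.Re (laguerre_coef a N m) - ip mu Gr (laguerre_fn m)| +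
   `|complex.Im (laguerre_coef a N m) - ip mu Gi (laguerre_fn m)| @[N --> \oo] --> (0 : R).
  rewrite -(addr0 (0 : R)); apply: cvgD.
    rewrite (_ : (fun N => _) = (fun N => `|\sum_(n < N.+1) laguerre_weight m n * complex.Re (a n) - ip mu Gr (laguerre_fn m)|)).
      exact: cvg_dist0 hR.
    by apply/funext => N; rewrite reE.
  rewrite (_ : (fun N => _) = (fun N => `|\sum_(n < N.+1) laguerre_weight m n * complex.Im (a n) - ip mu Gi (laguerre_fn m)|)).
    exact: cvg_dist0 hI.
  by apply/funext => N; rewrite imE.
apply: (squeeze_cvgr _ (cvg_cst 0) c1); apply: nearW => N /=; rewrite cmod_ge0/=.
by rewrite (le_trans (cmod_le_ReIm _))// cReB cImB.
Qed.

End CoefficientLimit.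

(** * Strictness of Bessel's inequality *)

Section Strictness.
Context {R : realType}.
Local Notation mu := (@lebesgue_measure R).

Lemma poly_inv_zeros_null (q : {poly R}) : q != 0 ->
  mu.-negligible [set x : R | 0 < x < 1 /\ q.[x^-1] = 0].
Proof.
move=> q0; suff h : countable [set x : R | 0 < x < 1 /\ q.[x^-1] = 0].
  apply/negligibleP; last exact: countable_lebesgue_measure0.
  exact: countable_measurable.
apply: finite_set_countable.
apply: contrapT => /(@infinite_set_fset _ _ (size q))[B hB sB].
pose s := [seq x^-1 | x <- finmap.enum_fset B].
have us : uniq s by rewrite map_inj_uniq ?finmap.fset_uniq//; exact: invr_inj.
have rs : all (root q) s.
  apply/allP => y /mapP[x xB ->]; have [_ h] := hB x xB.
  by rewrite rootE h.
by have := max_poly_roots q0 rs us; rewrite size_map ltnNge sB.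
Qed.

Lemma sqr_integral_eq0 (h : R -> R) : sqint mu h -> ip mu h h = 0 -> {ae mu, forall x, h x = 0}.
Proof.
move=> [mh ih] h0.
have mh2 : measurable_fun setT (EFin \o (fun x => h x ^+ 2)).
  by apply/measurable_EFinP; exact: measurable_funX.
have : (\int[mu]_x `|(h x ^+ 2)%:E| = 0)%E.
  rewrite (_ : (fun x => _) = (EFin \o (fun x => h x ^+ 2))); last first.
    by apply/funext => x /=; rewrite ger0_norm// sqr_ge0.
  rewrite -(fineK (integrable_fin_num measurableT ih)).
  by move: h0; rewrite ip_sqrE /Rintegral => ->.
move/(ae_eq_integral_abs mu measurableT mh2).
have aeF : Filter (almost_everywhere mu) by exact: ae_filter_ringOfSetsType.
apply: (@filterS _ _ aeF) => x /(_ I) /= [] /eqP.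
by rewrite sqrf_eq0 => /eqP.
Qed.

Lemma defect_gt0 (G : R -> R) K : sqint mu G -> (forall x, x < 1 -> G x = 0) ->
  0 < ip mu G G -> 0 < defect K G.
Proof.
move=> sG G1 G0; rewrite lt_def defect_ge0// andbT; apply/eqP => d0.
have sP := sqint_projection K G.
have sGP := sqintB sG sP.
move: (d0); rewrite defectE// => /(sqr_integral_eq0 sGP) ae0.
(* The projection is q(1/x) e^(-1/x) / x for x > 0, so it can vanish almost everywhere on (0,1) only
   if q = 0. *)
pose q : {poly R} := \sum_(m < K) (ip mu G (laguerre_fn m) * Num.sqrt 2) *: (laguerre m \Po (2 *: 'X)).
have PE x : projection K G x = q.[x^-1] * inv_exp 1 1 x.
  rewrite /projection /q horner_sum mulr_suml; apply: eq_bigr => m _.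
  rewrite hornerZ horner_comp hornerZ hornerX /laguerre_fn; ring.
have q0 : q = 0.
  apply/eqP/negPn/negP => q0.
  have [N [mN N0 hN]] := ae0.
  have sub : `]0, 1[%classic `<=` N `|` [set x : R | 0 < x < 1 /\ q.[x^-1] = 0].
    move=> x; rewrite /= in_itv/= => /andP[x0 x1].
    have [h|/eqP h] := eqVneq q.[x^-1] 0; first by right; rewrite x0 x1.
    left; apply: hN => /= e; apply: h.
    move: e; rewrite G1// sub0r PE inv_exp_pos// => /eqP; rewrite oppr_eq0 mulf_eq0.
    by case/orP => [/eqP//|]; rewrite gt_eqF// mulr_gt0 ?expR_gt0// exprn_gt0// invr_gt0.
  have nI : mu.-negligible (`]0, 1[%classic : set R).
    apply: (@negligibleS _ _ _ mu _ _ sub).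
    apply: (@negligibleU _ _ _ mu); last exact: poly_inv_zeros_null.
    by apply/negligibleP.
  have := @measure_negligible _ _ _ mu _ (measurable_itv _) nI.
  by rewrite /= lebesgue_measure_itv/= lte_fin ltr01 oppr0 adde0 => /eqP; rewrite eqe oner_eq0.
move: d0; rewrite defectE// => d0.
have e : (fun x => G x - projection K G x) = G.
  by apply/funext => x; rewrite PE q0 horner0 mul0r subr0.
by move: G0; rewrite -e d0 ltxx.
Qed.

End Strictness.

(** * The final estimate *)

Section Convergence.
Context {R : realType}.
Local Notation mu := (@lebesgue_measure R).

(** Writing r_m = <G, psi_m>, the cross terms below K are handled by |b_m - r_m| <= d, those from K
    on by Young's inequality -2 b r <= s r^2 + s^-1 b^2, where the squares r^2 sum to at most the
    defect. Summed over real and imaginary parts, the terms -||G||^2 and sum b^2 together are at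
    most 0 when the index is admissible. *)
Lemma laguerre_error (G : R -> R) (b : nat -> R) (K k : nat) (d s : R) : sqint mu G ->
  (K <= k)%N -> 0 < s ->
  (forall m, (m < K)%N -> `|b m - ip mu G (laguerre_fn m)| <= d) ->
  ip mu (fun x => G x - \sum_(m < k) b m * laguerre_fn m x)
        (fun x => G x - \sum_(m < k) b m * laguerre_fn m x) <=
  (2 + s) * defect K G - ip mu G G + 2 * d * \sum_(m < K) `|ip mu G (laguerre_fn m)| +
  (1 + s^-1) * \sum_(m < k) b m ^+ 2.
Proof.
move=> sG Kk s0 hd; rewrite -(subnKC Kk); move: (k - K)%N => l {k Kk}.
rewrite ip_sub_laguerre//.
set r := fun m => ip mu G (laguerre_fn m).
have Dk := defect_ge0 (K + l) sG; rewrite /defect in Dk *.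
rewrite -/(r _) in Dk *.
move: Dk; rewrite !big_split_ord/= => Dk.
have h1 : \sum_(m < K) r m ^+ 2 - d * \sum_(m < K) `|r m| <= \sum_(m < K) b m * r m.
  rewrite mulr_sumr -sumrB; apply: ler_sum => -[m mK] _ /=.
  have := ler_wpM2r (normr_ge0 (r m)) (hd m mK); rewrite -/(r m) -normrM ler_norml.
  by rewrite mulrBl -expr2 => /andP[h _]; lra.
have h2 : - (2 * \sum_(m < l) b (K + m)%N * r (K + m)%N) <=
   s * \sum_(m < l) r (K + m)%N ^+ 2 + s^-1 * \sum_(m < l) b (K + m)%N ^+ 2.
  rewrite !mulr_sumr -sumrN -big_split/=; apply: ler_sum => m _.
  move: (b _) (r _) => x y.
  have : 0 <= s^-1 * (s * y + x) ^+ 2 by rewrite mulr_ge0 ?sqr_ge0// invr_ge0 ltW.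
  rewrite (_ : s^-1 * _ = s * y ^+ 2 + s^-1 * x ^+ 2 + 2 * (x * y)); last by field; rewrite gt_eqF.
  by lra.
have h3 : 0 <= s^-1 * \sum_(m < K) b m ^+ 2.
  by rewrite mulr_ge0 ?invr_ge0 ?(ltW s0)// sumr_ge0// => m _; rewrite sqr_ge0.
move: h1 h2 h3 Dk; change (\sum_(m < K) ip mu G (laguerre_fn m) ^+ 2) with (\sum_(m < K) r m ^+ 2).
move: (\sum_(m < K) r m ^+ 2) (\sum_(m < K) `|r m|) (\sum_(m < K) b m * r m) (\sum_(m < K) b m ^+ 2).
move: (\sum_(m < l) r (K + m)%N ^+ 2) (\sum_(m < l) b (K + m)%N * r (K + m)%N) (\sum_(m < l) b (K + m)%N ^+ 2).
move=> a1 a2 a3 c1 c2 c3 c4 h1 h2 h3 Dk.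
have h4 : s * (c1 + a1 - ip mu G G) <= 0 by rewrite pmulr_rle0//; lra.
by lra.
Qed.

Variables (P : nat -> {poly R[i]}) (a : nat -> R[i]) (F : R -> R[i]).
Hypothesis hP : is_pollaczek P.
Hypothesis ha : hausdorff_condition a.
Hypothesis hF : is_jump_function a F.
Hypothesis hF2 : in_L2 F.

Let Gr := cutoff (fun x => complex.Re (F x)).
Let Gi := cutoff (fun x => complex.Im (F x)).
Let C : R := ip mu Gr Gr + ip mu Gi Gi.

Let Gr_sqint : sqint mu Gr. Proof. by case: (in_L2_sqint hF2). Qed.
Let Gi_sqint : sqint mu Gi. Proof. by case: (in_L2_sqint hF2). Qed.

Lemma integral_sum_sqr (f g : R -> R) : sqint mu f -> sqint mu g ->
  (\int[mu]_x (f x ^+ 2 + g x ^+ 2)%:E = (ip mu f f + ip mu g g)%:E)%E.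
Proof.
move=> [mf if2] [mg ig2]; rewrite !ip_sqrE -RintegralD// /Rintegral fineK//.
by apply: integrable_fin_num => //; exact: integrableDr.
Qed.

Lemma L2norm_sqr_eq : (L2norm F ^+ 2 = C%:E)%E.
Proof. by rewrite L2norm_sqrE integral_sum_sqr. Qed.

Lemma approximantE (b : nat -> R[i]) N x : 1 <= x ->
  approximant P F b N x =
  \sum_(m < (k0 P F b N).+1) laguerre_coef b N m * (laguerre_fn m x)%:C.
Proof.
move=> x1; have x0 : 0 < x by rewrite (lt_le_trans _ x1).
apply: eq_bigr => m _; rewrite /phi mulrA coef_laguerre//; congr (_ * _%:C).
by rewrite /laguerre_fn inv_exp_pos// expr1 div1r (mulrC x^-1).
Qed.

Let re_residual (b : nat -> R[i]) N x :=
  Gr x - \sum_(m < (k0 P F b N).+1) complex.Re (laguerre_coef b N m) * laguerre_fn m x.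
Let im_residual (b : nat -> R[i]) N x :=
  Gi x - \sum_(m < (k0 P F b N).+1) complex.Im (laguerre_coef b N m) * laguerre_fn m x.

(** The residuals live on the whole line, where the Laguerre functions are orthonormal; restriction
    to [1, +oo) can only decrease the integral. *)
Lemma L2norm_error_le (b : nat -> R[i]) N :
  (L2norm (fun x => (F x - approximant P F b N x)%R) ^+ 2 <=
   (ip mu (re_residual b N) (re_residual b N) + ip mu (im_residual b N) (im_residual b N))%:E)%E.
Proof.
set h1 := re_residual b N; set h2 := im_residual b N; set k := (k0 P F b N).+1.
have sum_sqint (beta : nat -> R) : sqint mu (fun x => \sum_(m < k) beta m * laguerre_fn m x).
  apply: (@sqint_sum _ _ R mu k (fun m x => beta m * laguerre_fn m x)) => m.
  by apply: sqintZ; exact: sqint_laguerre_fn.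
have s1 : sqint mu h1 by apply: sqintB => //; exact: (sum_sqint (fun m => complex.Re (laguerre_coef b N m))).
have s2 : sqint mu h2 by apply: sqintB => //; exact: (sum_sqint (fun m => complex.Im (laguerre_coef b N m))).
have [[m1 _] [m2 _]] := (s1, s2).
have mh : measurable_fun setT (fun x => h1 x ^+ 2 + h2 x ^+ 2).
  by apply: measurable_funD; exact: measurable_funX.
rewrite L2norm_sqrE -integral_sum_sqr//.
set g := (fun x => (_ + _)%:E).
have gE : g = EFin \o cutoff (fun x => h1 x ^+ 2 + h2 x ^+ 2).
  apply/funext => x; rewrite /g /= !cutoffP; case: ifPn => [x1|_]; last by rewrite expr0n addr0.
  have re_sum : complex.Re (approximant P F b N x) =
      \sum_(m < k) complex.Re (laguerre_coef b N m) * laguerre_fn m x.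
    rewrite approximantE// (big_morph (fun z : R[i] => complex.Re z) (@cReD R) (erefl : complex.Re 0 = 0)).
    by apply: eq_bigr => m _; rewrite cReM/= mulr0 subr0.
  have im_sum : complex.Im (approximant P F b N x) =
      \sum_(m < k) complex.Im (laguerre_coef b N m) * laguerre_fn m x.
    rewrite approximantE// (big_morph (fun z : R[i] => complex.Im z) (@cImD R) (erefl : complex.Im 0 = 0)).
    by apply: eq_bigr => m _; rewrite cImM/= mulr0 add0r.
  by rewrite cReB cImB re_sum im_sum /h1 /h2 /re_residual /im_residual /Gr /Gi !cutoff_in.
rewrite gE; apply: ge0_le_integral => //.
- by move=> x _; rewrite /= lee_fin cutoffP; case: ifP => // _; rewrite addr_ge0 ?sqr_ge0.
- apply/measurable_EFinP; apply: measurable_cutoff; exact: measurable_funTS.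
- exact/measurable_EFinP.
by move=> x _; rewrite /= lee_fin cutoffP; case: ifP => // _; rewrite addr_ge0 ?sqr_ge0.
Qed.

Lemma admissibleE (b : nat -> R[i]) N k : admissible P F b N k <->
  \sum_(m < k.+1) complex.Re (laguerre_coef b N m) ^+ 2 +
  \sum_(m < k.+1) complex.Im (laguerre_coef b N m) ^+ 2 <= C.
Proof.
rewrite /admissible /mkset L2norm_sqr_eq lee_fin -big_split/=.
suff -> : \sum_(m < k.+1) cmod (coef P b N m) ^+ 2 = \sum_(i < k.+1)
    (complex.Re (laguerre_coef b N i) ^+ 2 + complex.Im (laguerre_coef b N i) ^+ 2) by [].
apply: eq_bigr => m _; rewrite -cmod_sqr -(coef_laguerre b N m hP) cmodM cmodX cmodi.
by rewrite expr1n mulr1.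
Qed.

Variable aeps : R -> nat -> nat -> R[i].
Hypothesis haeps : forall (eps : R) (N n : nat), 0 < eps -> (n <= N)%N ->
  cmod (aeps eps N n - a n) <= eps.

Let r (m : nat) : R[i] := ip mu Gr (laguerre_fn m) +i* ip mu Gi (laguerre_fn m).

Lemma noisy_coef_cvg m (d : R) : 0 < d ->
  \forall p \near filter_prod (0 : R)^'+ \oo,
    cmod (laguerre_coef (aeps p.1 p.2) p.2 m - r m) <= d.
Proof.
move=> d0; have d2 : 0 < d / 2 by rewrite divr_gt0.
have [K K0 hK] := @laguerre_weight_bound R m.
have mom := jump_moments ha hF hF2.
have Gr1 x : x < 1 -> Gr x = 0 by exact: cutoff_out.
have Gi1 x : x < 1 -> Gi x = 0 by exact: cutoff_out.
have /cvgrPdist_lt/(_ _ d2) hN := @laguerre_coef_cvg R m a Gr Gi Gr_sqint Gi_sqint Gr1 Gi1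
  (fun n => (mom n).1) (fun n => (mom n).2).
have dK : 0 < d / (2 * K) by rewrite divr_gt0// mulr_gt0.
(* Half of d absorbs the noise, by K eps <= d / 2, and the other half the truncation of the series
   at N. *)
exists ([set e : R | 0 < e <= d / (2 * K)], [set N | `|0 - cmod (laguerre_coef a N m - r m)| < d / 2]).
  split => //=; near=> e; apply/andP; split=> //.
  by near: e; exact: nbhs_right_le.
move=> [e N] /= [/andP[e0 ed]]; rewrite sub0r normrN ger0_norm ?cmod_ge0// => h.
have h2 := laguerre_coef_dist hK (ltW e0) (fun n nN => haeps e0 nN).
have -> : laguerre_coef (aeps e N) N m - r m =
  (laguerre_coef (aeps e N) N m - laguerre_coef a N m) + (laguerre_coef a N m - r m).
  by rewrite addrA subrK.
rewrite (le_trans (cmodD _ _))//.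
have h3 : K * e <= d / 2.
  by rewrite (le_trans (ler_wpM2l (ltW K0) ed))// [leLHS](_ : _ = d / 2)//; field; rewrite gt_eqF.
by apply: (le_trans (lerD (le_trans (h2 N) h3) (ltW h))); rewrite -splitr.
Unshelve. all: by end_near. Qed.

Lemma residual_small (e : R) : 0 < e -> \forall p \near filter_prod (0 : R)^'+ \oo,
  (exists k, is_max_admissible P F (aeps p.1 p.2) p.2 k) ->
  ip mu (re_residual (aeps p.1 p.2) p.2) (re_residual (aeps p.1 p.2) p.2) +
  ip mu (im_residual (aeps p.1 p.2) p.2) (im_residual (aeps p.1 p.2) p.2) <= e.
Proof.
move=> e0.
have C0 : 0 <= C by rewrite addr_ge0// ip_ge0.
have max_k0 (p : R * nat) : (exists k, is_max_admissible P F (aeps p.1 p.2) p.2 k) ->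
    is_max_admissible P F (aeps p.1 p.2) p.2 (k0 P F (aeps p.1 p.2) p.2).
  by move=> /(xgetPex 0%N).
(* For C = 0 there is no strict gap; [laguerre_error] with K = 0 and s = 1 already bounds the
   residual by 4 C = 0. *)
have [C00|Cn0] := eqVneq C 0.
  apply: nearW => p /max_k0[/admissibleE hk _].
  have hr := @laguerre_error Gr (fun m => complex.Re (laguerre_coef (aeps p.1 p.2) p.2 m)) 0
    (k0 P F (aeps p.1 p.2) p.2).+1 0 1 Gr_sqint (leq0n _) ltr01 (fun _ => ltac:(by [])).
  have hi := @laguerre_error Gi (fun m => complex.Im (laguerre_coef (aeps p.1 p.2) p.2 m)) 0
    (k0 P F (aeps p.1 p.2) p.2).+1 0 1 Gi_sqint (leq0n _) ltr01 (fun _ => ltac:(by [])).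
  apply: le_trans (lerD hr hi) _; rewrite /defect !big_ord0 !invr1 !subr0 !mulr0.
  by move: hk C00; rewrite /C; move: (\sum_(_ < _) _) (\sum_(_ < _) _) => S1 S2; lra.
have Cp : 0 < C by rewrite lt_def Cn0.
(* The choices make s^-1 C = e / 4 and (2 + s) eta = e / 4, two of the three quarters in the final
   bound. *)
pose s := 4 * C / e.
have s0 : 0 < s by rewrite divr_gt0// mulr_gt0.
pose eta := e / (4 * (2 + s)).
have s2 : 0 < 2 + s by rewrite addr_gt0.
have eta0 : 0 < eta by rewrite divr_gt0// mulr_gt0.
have Gr1 x : x < 1 -> Gr x = 0 by exact: cutoff_out.
have Gi1 x : x < 1 -> Gi x = 0 by exact: cutoff_out.
have eta2 : 0 < eta / 2 by rewrite divr_gt0.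
have [K1 hK1] := parseval_support Gr_sqint Gr1 eta2.
have [K2 hK2] := parseval_support Gi_sqint Gi1 eta2.
pose K := maxn K1 K2.
have hK : defect K.+1 Gr + defect K.+1 Gi <= eta.
  have := defect_noninc Gr (leqW (leq_maxl K1 K2)); have := defect_noninc Gi (leqW (leq_maxr K1 K2)).
  by rewrite -/K; lra.
(* The strict gap between C and the exact partial sum, positive since at least one of the two parts
   of F is nonzero. *)
pose gam := defect K.+1 Gr + defect K.+1 Gi.
have gam0 : 0 < gam.
  have [Gr0|] := ltP 0 (ip mu Gr Gr).
    by rewrite ltr_pwDl ?defect_gt0// defect_ge0.
  move=> Gr0; rewrite ltr_wpDl ?defect_ge0// defect_gt0//.
  by move: Cp; rewrite /C; lra.
(* For d <= 1, |x - y| <= d implies x^2 <= y^2 + d (2 |y| + 1); summing over real and imaginary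
   parts, the partial sum grows by at most d A. *)
pose A := \sum_(m < K.+1) (2 * `|complex.Re (r m)| + 2 * `|complex.Im (r m)| + 2).
have A0 : 0 <= A by apply: sumr_ge0 => m _; rewrite !addr_ge0// mulr_ge0.
have A1 : 0 < A + 1 by rewrite ltr_wpDl.
(* The three bounds serve, in order, the linearization of the squares, the admissibility of K (d A
   <= gam) and the cross terms of the error (d A <= e / 4). *)
pose d := Num.min 1 (Num.min (gam / (A + 1)) (e / (4 * (A + 1)))).
have d0 : 0 < d by rewrite !lt_min ltr01 !divr_gt0// mulr_gt0.
have d1 : d <= 1 by rewrite ge_min lexx.
have dg : d * A <= gam.
  have h : d <= gam / (A + 1) by rewrite !ge_min lexx !orbT.
  rewrite (le_trans (ler_wpM2r A0 h))// mulrAC ler_pdivrMr// ler_wpM2l ?lerDl// ltW//.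
have de : d * A <= e / 4.
  have h : d <= e / (4 * (A + 1)) by rewrite !ge_min lexx !orbT.
  rewrite (le_trans (ler_wpM2r A0 h))// invfM mulrA mulrAC ler_pdivrMr// ler_wpM2l ?lerDl//.
  by rewrite divr_ge0// ltW.
have near_all : \forall p \near filter_prod (0 : R)^'+ \oo, forall m : 'I_K.+1,
    cmod (laguerre_coef (aeps p.1 p.2) p.2 m - r m) <= d.
  by apply: filter_forall => m; exact: noisy_coef_cvg.
apply: filterS near_all => p hp /max_k0[/admissibleE hk kmax].
set k := k0 P F (aeps p.1 p.2) p.2 in hk kmax *.
pose beta m := laguerre_coef (aeps p.1 p.2) p.2 m.
have hre m : (m < K.+1)%N -> `|complex.Re (beta m) - complex.Re (r m)| <= d.
  by move=> mK; rewrite -cReB (le_trans (le_Re_cmod _))// (hp (Ordinal mK)).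
have him m : (m < K.+1)%N -> `|complex.Im (beta m) - complex.Im (r m)| <= d.
  by move=> mK; rewrite -cImB (le_trans (le_Im_cmod _))// (hp (Ordinal mK)).
have sqle (x y : R) : `|x - y| <= d -> x ^+ 2 <= y ^+ 2 + d * (2 * `|y| + 1).
  move=> h; rewrite -(real_normK (num_real x)) -(real_normK (num_real y)).
  have : `|x| <= `|y| + d.
    by rewrite -lerBlDl (le_trans (lerB_dist _ _)).
  by have := normr_ge0 x; have := normr_ge0 y; move: `|x| `|y| => p1 p2; nra.
(* K is admissible, so maximality of k gives K <= k; the successors appear because admissible sums
   include their last index. *)
have Kk : (K.+1 <= k.+1)%N.
  rewrite ltnS; apply: kmax; apply/admissibleE.
  have -> : C = \sum_(m < K.+1) complex.Re (r m) ^+ 2 + \sum_(m < K.+1) complex.Im (r m) ^+ 2 + gam.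
    by rewrite /gam /defect /C /=; ring.
  apply: (@le_trans _ _ (\sum_(m < K.+1) complex.Re (r m) ^+ 2 + \sum_(m < K.+1) complex.Im (r m) ^+ 2 + d * A)).
    rewrite /A mulr_sumr -!big_split/=; apply: ler_sum => -[m mK] _ /=.
    have := sqle _ _ (hre m mK); have := sqle _ _ (him m mK); rewrite /beta /r /= => h1 h2.
    by lra.
  by rewrite lerD2l.
have hr := @laguerre_error Gr (fun m => complex.Re (beta m)) K.+1 k.+1 d s Gr_sqint Kk s0 hre.
have hi := @laguerre_error Gi (fun m => complex.Im (beta m)) K.+1 k.+1 d s Gi_sqint Kk s0 him.
apply: le_trans (lerD hr hi) _.
have q1 : (2 + s) * (defect K.+1 Gr + defect K.+1 Gi) <= e / 4.
  rewrite (le_trans (ler_wpM2l (ltW s2) hK))// /eta.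
  by rewrite [leLHS](_ : _ = e / 4)//; move: (2 + s) s2 => z z0; field; rewrite gt_eqF.
have q2 : 2 * d * \sum_(m < K.+1) `|ip mu Gr (laguerre_fn m)| +
    2 * d * \sum_(m < K.+1) `|ip mu Gi (laguerre_fn m)| <= e / 4.
  rewrite (le_trans _ de)// -mulrDr -big_split/= mulrAC mulrC ler_wpM2l ?(ltW d0)// mulr_sumr.
  by apply: ler_sum => m _; rewrite mulrDr lerDl.
have q3 : s^-1 * C = e / 4 by rewrite /s; field; rewrite !gt_eqF.
have q4 : s^-1 * (\sum_(m < k.+1) complex.Re (beta m) ^+ 2 + \sum_(m < k.+1) complex.Im (beta m) ^+ 2) <= e / 4.
  by rewrite -q3 ler_wpM2l// invr_ge0 ltW.
move: hk q1 q2 q4; rewrite /C.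
move: (\sum_(m < k.+1) _) (\sum_(m < k.+1) _) => S1 S2.
lra.
Qed.

Lemma L2norm_error_cvg : L2norm (fun x => F x - approximant P F (aeps p.1 p.2) p.2 x)
    @[p --> within
              [set p : R * nat |
                 exists k, is_max_admissible P F (aeps p.1 p.2) p.2 k]
              (filter_prod (0 : R)^'+ \oo)]
    --> (0 : \bar R).
Proof.
set D := [set p : R * nat | _]; set FF := within _ _.
have FFF : Filter FF by exact: within_filter.
have small (e : R) : 0 < e -> \forall p \near FF,
    (L2norm (fun x => (F x - approximant P F (aeps p.1 p.2) p.2 x)%R) <= e%:E)%E.
  move=> e0; have e2 : 0 < e ^+ 2 by rewrite exprn_gt0.
  have := residual_small e2; rewrite /FF near_withinE; apply: filterS => p h Dp.
  have := le_trans (L2norm_error_le (aeps p.1 p.2) p.2) (_ : _ <= (e ^+ 2)%:E)%E.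
  rewrite lee_fin => /(_ (h Dp)).
  have : (0 <= L2norm (fun x => (F x - approximant P F (aeps p.1 p.2) p.2 x)%R))%E by exact: Lnorm_ge0.
  case: (L2norm _) => [z| |]//; rewrite !lee_fin => z0.
  by rewrite -expr2 ler_sqr// nnegrE ltW.
apply/fine_cvgP; split.
  apply: filterS (small 1 ltr01) => p h.
  by rewrite ge0_fin_numE ?Lnorm_ge0// (le_lt_trans h)// ltry.
apply/cvgrPdist_le => e e0; apply: filterS (small e e0) => p h.
rewrite sub0r normrN ger0_norm; last by apply: fine_ge0; exact: Lnorm_ge0.
have f : L2norm (fun x => (F x - approximant P F (aeps p.1 p.2) p.2 x)%R) \is a fin_num.
  by rewrite ge0_fin_numE ?Lnorm_ge0// (le_lt_trans h)// ltry.
by rewrite -lee_fin fineK.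
Qed.

End Convergence.

Theorem theorem3 (R : realType) (P : nat -> {poly R[i]}) (a : nat -> R[i])
    (F : R -> R[i]) (aeps : R -> nat -> nat -> R[i])
    (hP : is_pollaczek P)
    (ha : hausdorff_condition a)
    (hF : is_jump_function a F)
    (hF2 : in_L2 F)
    (haeps : forall (eps : R) (N n : nat), 0 < eps -> (n <= N)%N ->
       cmod (aeps eps N n - a n) <= eps) :
  L2norm (fun x => F x - approximant P F (aeps p.1 p.2) p.2 x)
    @[p --> within
              [set p : R * nat |
                 exists k, is_max_admissible P F (aeps p.1 p.2) p.2 k]
              (filter_prod (0 : R)^'+ \oo)]
    --> (0 : \bar R).
Proof. exact: (L2norm_error_cvg hP ha hF hF2 haeps). Qed.
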